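(* Let $p$ be a prime, $k\ge1$, $d\geq 1$, and let $G = (\mathbb{Z}_p)^k$, a group of order $r=p^k$. Let $\Delta_{k(p-1),p^k}^{\mathbf{1};\mathbb{L}}$ be the multiple chessboard complex based on a $k(p-1)\times p^k$ chessboard, where $\mathbf{1} = (1,\dots, 1)\in \mathbb{R}^{p^k}$ and $\mathbb{L} = (1,p,\dots, p^{k-1})^{\times (p-1)}\in \mathbb{R}^{k(p-1)}$. Let $\partial\Delta_{[p^k]}\cong S^{p^k-2}$ be the boundary of a simplex with $p^k$ vertices. Then there does not exist a $G$-equivariant (continuous) map $$f : (\Delta_{k(p-1),p^k}^{\mathbf{1};\mathbb{L}})^{\ast (d+1)}\ast [p^k] \longrightarrow (\partial\Delta_{[p^k]})^{\ast (d+1)}\cong (S^{p^k-2})^{\ast (d+1)} \cong S^{(p^k -1)(d+1)-1} .$$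
   Context: For $\mathbb{K}=(k_1,\dots,k_n)$ and $\mathbb{L}=(l_1,\dots,l_m)$, the multiple chessboard complex $\Delta_{m,n}^{\mathbb{K};\mathbb{L}}$ is the abstract simplicial complex on the vertex set $[m]\times[n]$ whose simplices are the subsets with at most $k_i$ elements in each row $[m]\times\{i\}$ ($i\in[n]$) and at most $l_j$ elements in each column $\{j\}\times[n]$ ($j\in[m]$). Thus in $\Delta_{m,n}^{\mathbf{1};\mathbb{L}}$ at most one element is allowed in each row. $(1,p,\dots,p^{k-1})^{\times(p-1)}$ is the concatenation of $p-1$ copies of $(1,p,\dots,p^{k-1})$. $[p^k]$ is the $0$-dimensional simplicial complex with $p^k$ points, $\ast$ is the join, and $X^{\ast(d+1)}$ is the $(d+1)$-fold join of $X$. The symmetric group $S_{p^k}$ acts on $[m]\times[p^k]$ by permuting the rows (i.e. on the second coordinate), hence on $\Delta_{m,p^k}^{\mathbf{1};\mathbb{L}}$; it also acts on $[p^k]$ and on $\partial\Delta_{[p^k]}$ by permuting vertices. The group $G=(\mathbb{Z}_p)^k$ is embedded in $S_{p^k}$ by its regular action (identify $[p^k]$ with $G$ and let $G$ act by translations), and acts diagonally on all joins. *)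

(* Defs.v *)
From HB Require Import structures.
From mathcomp Require Import all_boot all_order all_fingroup all_algebra.
From mathcomp Require Import all_classical all_reals all_analysis.
Import numFieldNormedType.Exports.

Set Implicit Arguments.
Unset Strict Implicit.
Unset Printing Implicit Defensive.

Import Order.TTheory GRing.Theory Num.Theory.

Local Open Scope nat_scope.
Local Open Scope set_scope.

(* The empty set counts as a simplex, and not every element of the vertex     *)
(* type [V] is required to be a vertex of the complex.                        *)
Record scomplex (V : finType) := SComplex {
  simplices :> {set {set V}};
  simplices_sub : forall A B : {set V},
    A \in simplices -> B \subset A -> B \in simplices }.

(* Squares are pairs (column, row) of [m] x [n]: at most [tnth K i] of them   *)
(* in the row [m] x {i}, at most [tnth L j] in the column {j} x [n].          *)
Section Chessboard.
Variables (m n : nat) (K : n.-tuple nat) (L : m.-tuple nat).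

Definition chessboard_simplices : {set {set 'I_m * 'I_n}} :=
  [set A : {set 'I_m * 'I_n} |
    [forall i : 'I_n, #|[set v in A | v.2 == i]| <= tnth K i] &&
    [forall j : 'I_m, #|[set v in A | v.1 == j]| <= tnth L j]].

Lemma chessboard_sub (A B : {set 'I_m * 'I_n}) :
  A \in chessboard_simplices -> B \subset A -> B \in chessboard_simplices.
Proof.
have le (P : pred ('I_m * 'I_n)) : B \subset A ->
    #|[set v in B | P v]| <= #|[set v in A | P v]|.
  move=> sBA; apply/subset_leq_card/fintype.subsetP => v; rewrite !inE.
  by case/andP=> /(fintype.subsetP sBA) -> ->.
rewrite !inE => /andP[/forallP rowA /forallP colA] sBA.
apply/andP; split; apply/forallP => i.
  exact: leq_trans (le _ sBA) (rowA i).
exact: leq_trans (le _ sBA) (colA i).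
Qed.

Definition chessboard : scomplex ('I_m * 'I_n)%type := SComplex chessboard_sub.
End Chessboard.

Section Points.
Variable n : nat.

Definition points_simplices : {set {set 'I_n}} :=
  [set A : {set 'I_n} | #|A| <= 1].

Lemma points_sub (A B : {set 'I_n}) :
  A \in points_simplices -> B \subset A -> B \in points_simplices.
Proof. by rewrite !inE => cA /subset_leq_card/leq_trans; apply. Qed.

Definition points : scomplex 'I_n := SComplex points_sub.
End Points.

Section SimplexBoundary.
Variable n : nat.

Definition boundary_simplices : {set {set 'I_n}} :=
  [set A : {set 'I_n} | A \proper [set: 'I_n]].

Lemma boundary_sub (A B : {set 'I_n}) :
  A \in boundary_simplices -> B \subset A -> B \in boundary_simplices.
Proof. by rewrite !inE => pA sBA; apply: sub_proper_trans sBA pA. Qed.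

Definition simplex_boundary : scomplex 'I_n := SComplex boundary_sub.
End SimplexBoundary.

(* Joins are taken simplicially, on disjoint unions of vertex sets: a simplex *)
(* of the join is a disjoint union of one simplex from each factor.           *)
Section Join.
Variables (V W : finType) (K : scomplex V) (L : scomplex W).

Definition join_simplices : {set {set V + W}} :=
  [set A : {set V + W} | (inl @^-1: A \in K) && (inr @^-1: A \in L)].

Lemma join_sub (A B : {set V + W}) :
  A \in join_simplices -> B \subset A -> B \in join_simplices.
Proof.
rewrite !inE => /andP[AK AL] sBA; apply/andP.
by split; [apply: simplices_sub AK _ | apply: simplices_sub AL _];
  apply: preimsetS.
Qed.

Definition join : scomplex (V + W)%type := SComplex join_sub.
End Join.

(* The N-fold join of K with itself: the disjoint union of N copies of the    *)
(* vertex set V is 'I_N * V.                                                  *)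
Section IteratedJoin.
Variables (N : nat) (V : finType) (K : scomplex V).

Definition iterjoin_simplices : {set {set 'I_N * V}} :=
  [set A : {set 'I_N * V} | [forall i, pair i @^-1: A \in K]].

Lemma iterjoin_sub (A B : {set 'I_N * V}) :
  A \in iterjoin_simplices -> B \subset A -> B \in iterjoin_simplices.
Proof.
rewrite !inE => /forallP AK sBA; apply/forallP => i.
by apply: simplices_sub (AK i) _; apply: preimsetS.
Qed.

Definition iterjoin : scomplex ('I_N * V)%type := SComplex iterjoin_sub.
End IteratedJoin.

Definition row_act (m n : nat) (s : 'S_n) (v : 'I_m * 'I_n) : 'I_m * 'I_n :=
  (v.1, s v.2).

Definition join_act (V W : finType) (a : V -> V) (b : W -> W) (v : V + W) :
    V + W :=
  match v with inl x => inl (a x) | inr y => inr (b y) end.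

Definition iterjoin_act (N : nat) (V : finType) (a : V -> V) (v : 'I_N * V) :
    'I_N * V :=
  (v.1, a v.2).

(* rho is the embedding of G in S_n by the regular action, for some           *)
(* identification e of [n] with G.                                            *)
Definition regular_embedding (G : zmodType) (n : nat) (rho : G -> 'S_n) :
    Prop :=
  exists2 e : 'I_n -> G, bijective e &
    forall (g : G) (i : 'I_n), e (rho g i) = (g + e i)%R.

(* L = (1, p, ..., p^(k-1))^{x (p-1)} *)
Definition Lseq (p k : nat) : seq nat :=
  flatten (nseq (p - 1) [seq p ^ i | i <- iota 0 k]).

Lemma size_Lseq (p k : nat) : size (Lseq p k) == k * (p - 1).
Proof.
by rewrite size_flatten /shape map_nseq sumn_nseq size_map size_iota.
Qed.

Definition Ltuple (p k : nat) : (k * (p - 1)).-tuple nat :=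
  Tuple (size_Lseq p k).

Local Open Scope classical_set_scope.
Local Open Scope ring_scope.

(* Points are given by their barycentric coordinates; {ptws V -> R} is R^V    *)
(* with the product topology, of which the realization is a subspace.         *)
Definition realization (R : realType) (V : finType) (K : scomplex V) :
    set {ptws V -> R} :=
  fun x => [/\ forall v, 0 <= x v, \sum_v x v = 1 &
               finset (fun v => x v != 0) \in K].
Arguments realization R {V} K.

(* The affine extension to the realizations of a map between vertex sets.     *)
Definition realize_map (R : realType) (V W : finType) (a : V -> W)
    (x : {ptws V -> R}) : {ptws W -> R} :=
  fun w => \sum_(v | a v == w) x v.

(* f restricts to a continuous map |K| -> |L| which is equivariant for the    *)
(* actions of G on |K| and |L| induced by the vertex actions aK and aL; the   *)
(* values of f outside |K| are irrelevant.                                    *)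
Definition equivariant_map (R : realType) (G : Type) (V W : finType)
    (K : scomplex V) (aK : G -> V -> V) (L : scomplex W) (aL : G -> W -> W)
    (f : {ptws V -> R} -> {ptws W -> R}) : Prop :=
  [/\ {within realization R K, continuous f},
      forall x, realization R K x -> realization R L (f x) &
      forall (g : G) x, realization R K x ->
        f (realize_map (aK g) x) = realize_map (aL g) (f x)].

(* Main.v *)
(* Suppose that an equivariant f exists, and let S be the target and Y the     *)
(* join of the d+1 chessboard complexes, so that the source is Y * [p^k]. On a *)
(* fine iterated barycentric subdivision f has an equivariant approximation,   *)
(* which induces an equivariant chain map phi over F_p into the order complex  *)
(* of S. Counting the empty simplex in degree 0 makes all homology reduced.    *)
(*                                                                             *)
(* Since the capacities of the columns add up to p^k - 1, forgetting the       *)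
(* columns maps Y to S, and the fundamental cycle of S pulls back to an        *)
(* invariant cycle y of Y of the same dimension. Its image is the D-th         *)
(* multiple of the fundamental cycle: here D, the number of facets of Y over a *)
(* facet of S, is the (d+1)-st power of a multinomial coefficient of p^k - 1,  *)
(* prime to p by Legendre's formula. But y bounds in Y * [p^k], hence          *)
(* phi(y) = 0, as S has no chains above its dimension.                         *)
(*                                                                             *)
(* These facts are contradictory: Smith theory, applied to the generators of G *)
(* one at a time, shows that the vanishing of an equivariant chain map on y    *)
(* passes to the simplices fixed by more and more generators and back. Only    *)
(* the empty simplex is fixed by all of G, and there phi and the projection    *)
(* agree.                                                                      *)
From HB Require Import structures.
Require Import Defs.
From mathcomp Require Import all_boot all_order all_fingroup all_algebra.

Set Implicit Arguments.
Unset Strict Implicit.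
Unset Printing Implicit Defensive.

Import Order.TTheory GRing.Theory Num.Theory.

(** * The p-adic valuation of the multinomial coefficient *)

(** Two equivariant chain maps over F_p start from the order complex of [Y]: [Phi], the
    approximation of f restricted to [Y], and [Psi], induced by forgetting the columns. On the
    invariant top cycle y, [Phi] vanishes because y bounds in the larger join while the sphere has
    no chains one degree higher ([Phi_top]). But [Psi y] is non-zero: it is the fundamental cycle
    times the number of facets over a facet ([fund_proj], [card_facets_over]), prime to p by
    [multinomial_coprime]. So the point is that [Phi y = 0] forces [Psi y = 0] ([tower_zero]), a
    chain-level congruence of degrees modulo p.

    Let Y_i and S_i consist of the flags fixed by the first i generators. S_i has the homology of
    the join of boundaries of simplices with p^(k-i) vertices, again a sphere ([stage_acyclic],
    [stage_onedim]), and flags of Y_i are no longer than facets of S_i. For the next generator g,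
    with norm N = 1 + g + ... + g^(p-1), the operators N and 1 - g are exact against each other up
    to fixed simplices ([smith_exact]). Hence an invariant top cycle c of Y_i is N z, the boundary
    of z is (1 - g) z', and so on, until a cycle v of Y_(i+1) of the largest possible degree appears
    ([desc_exists]).

    An equivariant chain map that vanishes on c vanishes on v, as the fixed part of its target has
    no chains above that degree ([desc_zero]). For [Phi] this carries the vanishing down; for 1 -
    g_j it carries down the invariance under the other generators. At stage k only the empty simplex
    is left and [Phi] fixes it, so the last v is 0 and [Psi] kills it. Back up, [Psi v = 0] gives
    [Psi c = 0] ([desc_top]): S_i and S_(i+1) are acyclic below the top, and N kills the top cycles
    of S_i, which form a line. The map [Phi] itself comes from uniform continuity
    ([realization_unif]) and iterated subdivision ([approx_exists]). *)

Lemma prod_fact_dvdn (r : seq nat) : \prod_(l <- r) l`! %| (\sum_(l <- r) l)`!.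
Proof.
elim: r => [|l r IH]; first by rewrite !big_nil.
rewrite !big_cons; apply: dvdn_trans (_ : l`! * (\sum_(i <- r) i)`! %| _).
  by rewrite dvdn_mul.
by rewrite -(bin_fact (leq_addr _ l)) addKn dvdn_mull.
Qed.

Section Digits.
Variables (p k : nat).
Hypothesis p_prime : prime p.
Let p0 : 0 < p := prime_gt0 p_prime.
Let p1 : 1 < p := prime_gt1 p_prime.

Lemma big_Lseq (R : Type) (idx : R) (op : Monoid.com_law idx) (f : nat -> R) :
  \big[op/idx]_(l <- Lseq p k) f l =
  iterop (p - 1) op (\big[op/idx]_(i < k) f (p ^ i)) idx.
Proof.
rewrite /Lseq big_flatten big_nseq Monoid.iteropE big_map.
by rewrite -[X in iota 0 X](subn0 k) -/(index_iota 0 k) big_mkord.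
Qed.

(** The geometric series (p^k - 1)/(p - 1), taken p - 1 times: the columns of a board hold exactly
    one square fewer than there are rows. *)
Lemma sum_Lseq : \sum_(l <- Lseq p k) l = (p ^ k).-1.
Proof.
rewrite (big_Lseq _ id) Monoid.iteropE iter_addn_0 mulnC subn1.
by rewrite [RHS]predn_exp.
Qed.

(** Legendre's formula, whose terms beyond the i-th vanish. *)
Lemma logn_fact_expn i : logn p (p ^ i)`! = \sum_(j < i) p ^ j.
Proof.
rewrite logn_fact // (@big_cat_nat _ _ _ i.+1) //=; last by rewrite ltnS ltnW // ltn_expl.
rewrite [X in _ + X]big_nat_cond [X in _ + X]big1 ?addn0 => [|j /andP[/andP[ij _] _]]; last first.
  by rewrite divn_small // ltn_exp2l.
rewrite big_add1 /= big_mkord (reindex_inj rev_ord_inj) /=.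
apply: eq_bigr => j _; rewrite -expnB ?leq_subr //; last by rewrite subnSK ?leq_subr.
by rewrite subnSK // subKn // ltnW.
Qed.

Lemma logn_prod_fact (r : seq nat) :
  logn p (\prod_(l <- r) l`!) = \sum_(l <- r) logn p l`!.
Proof.
elim: r => [|l r IH]; first by rewrite !big_nil logn1.
by rewrite !big_cons lognM ?fact_gt0 ?IH // prodn_gt0 // => i; apply: fact_gt0.
Qed.

(** All base-p digits of p^k - 1 equal p - 1, so adding up the capacities produces no carries and
    the multinomial coefficient has valuation 0, as in Kummer's theorem. *)
Lemma logn_fact_predn : logn p ((p ^ k).-1)`! = \sum_(l <- Lseq p k) logn p l`!.
Proof.
rewrite (big_Lseq _ (fun l => logn p l`!)) Monoid.iteropE iter_addn_0 subn1.
(* Adding k replaces (p^k - 1)! by (p^k)!; the identity then follows termwise from p^i = 1 + (p - 1)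
   v_p((p^i)!), summed over i < k. *)
apply: (@addnI k); have -> : k + logn p ((p ^ k).-1)`! = logn p (p ^ k)`!.
  have pk : 0 < p ^ k by rewrite expn_gt0 p0.
  rewrite -{2}(prednK pk) factS prednK // lognM ?fact_gt0 //.
  by rewrite pfactorK.
rewrite logn_fact_expn (eq_bigr (fun i : 'I_k => 1 + p.-1 * logn p (p ^ i)`!)) => [|i _].
  rewrite big_split /= sum_nat_const card_ord muln1 -big_distrr /=.
  by congr (_ + _); rewrite mulnC.
by rewrite logn_fact_expn -predn_exp add1n prednK // expn_gt0 p0.
Qed.

Lemma multinomial_coprime a X : X = \prod_(l <- Lseq p k) l`! ->
  ~~ (p %| ((p ^ k).-1)`! ^ a %/ X ^ a).
Proof.
move=> eX; have dX : X ^ a %| ((p ^ k).-1)`! ^ a.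
  by rewrite dvdn_exp2r // eX -sum_Lseq prod_fact_dvdn.
set D := _ %/ _; have eD : D * X ^ a = ((p ^ k).-1)`! ^ a by rewrite divnK.
have X0 : 0 < X by rewrite eX prodn_gt0 // => i; apply: fact_gt0.
have D0 : 0 < D.
  have Y0 : 0 < ((p ^ k).-1)`! ^ a by rewrite expn_gt0 fact_gt0.
  by rewrite lt0n; apply: contraTneq Y0 => D0; rewrite -eD D0.
have := congr1 (logn p) eD; rewrite lognM ?expn_gt0 ?X0 // !lognX logn_fact_predn eX.
rewrite -logn_prod_fact => /eqP; rewrite -{2}[a * _]add0n eqn_add2r => /eqP D1.
apply/negP => pD; have : p \in primes D by rewrite mem_primes p_prime D0.
by rewrite -logn_gt0 D1.
Qed.

End Digits.

Local Open Scope ring_scope.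

(** * Reduced simplicial chains and subdivision *)

Section Chains.
Variable F : fieldType.

(** Chains are functions on all subsets, so operators are total and independent of the complex;
    support and degree are imposed separately by [inC]. *)
Definition chain (T : finType) : Type := {ffun {set T} -> F^o}.
HB.instance Definition _ (T : finType) := GRing.Lmodule.on (chain T).

Definition delta (T : finType) (A : {set T}) : chain T := [ffun B => (B == A)%:R].

Definition lin (T T' : finType) (f : {set T} -> chain T') (c : chain T) : chain T' :=
  \sum_A c A *: f A.

Lemma lin_is_linear (T T' : finType) (f : {set T} -> chain T') : linear (lin f).
Proof.
move=> a u v; rewrite /lin scaler_sumr -big_split /=; apply: eq_bigr => A _.
by rewrite !ffunE scalerDl scalerA.
Qed.

HB.instance Definition _ (T T' : finType) (f : {set T} -> chain T') :=
  GRing.isLinear.Build F (chain T) (chain T') *:%R (lin f) (lin_is_linear f).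

Lemma linE (T T' : finType) (f : {set T} -> chain T') (c : chain T) B : lin f c B = \sum_A c A * f A B.
Proof. by rewrite /lin sum_ffunE; apply: eq_bigr => A _; rewrite ffunE. Qed.

Section Lin.
Variables T T' T'' : finType.
Implicit Types (c : chain T) (f g : {set T} -> chain T').

Lemma lin_delta f A : lin f (delta A) = f A.
Proof.
rewrite /lin (bigD1 A) //= ffunE eqxx scale1r big1 ?addr0 // => B /negPf nB.
by rewrite ffunE nB scale0r.
Qed.

Lemma lin_deltaE c : lin (@delta T) c = c.
Proof.
apply/ffunP => B; rewrite linE (bigD1 B) //= ffunE eqxx mulr1 big1 ?addr0 //.
by move=> A nA; rewrite ffunE eq_sym (negPf nA) mulr0.
Qed.

Lemma lin_comp (g : {set T'} -> chain T'') f c :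
  lin g (lin f c) = lin (fun A => lin g (f A)) c.
Proof. by rewrite {2}/lin linear_sum; apply: eq_bigr => A _; rewrite linearZ. Qed.

Lemma lin_add f g c : lin f c + lin g c = lin (fun A => f A + g A) c.
Proof. by rewrite /lin -big_split; apply: eq_bigr => A _; rewrite scalerDr. Qed.

Lemma lin_opp f c : - lin f c = lin (fun A => - f A) c.
Proof. by rewrite /lin -sumrN; apply: eq_bigr => A _; rewrite scalerN. Qed.

Lemma eq_lin f g c : (forall A, c A != 0 -> f A = g A) -> lin f c = lin g c.
Proof.
move=> eqfg; apply: eq_bigr => A _.
by have [->|/eqfg->//] := eqVneq (c A) 0; rewrite !scale0r.
Qed.

Lemma lin_eq0 f c : (forall A, c A != 0 -> f A = 0) -> lin f c = 0.
Proof. by move=> /eq_lin->; rewrite /lin big1 // => A _; rewrite scaler0. Qed.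

End Lin.

(* Homogeneous chains: [q] counts vertices, so that the empty simplex spans   *)
(* degree 0 and all homology below is reduced.                                *)
Definition inC (T : finType) (K : {set {set T}}) (q : nat) (c : chain T) :=
  forall A, c A != 0 -> A \in K /\ #|A| = q.

Section InC.
Variables T : finType.
Implicit Types (K : {set {set T}}) (c : chain T) (q : nat).

Lemma inC0 K q : inC K q 0.
Proof. by move=> A; rewrite ffunE eqxx. Qed.

Lemma inCD K q c1 c2 : inC K q c1 -> inC K q c2 -> inC K q (c1 + c2).
Proof.
move=> h1 h2 A; rewrite ffunE; have [->|/h1//] := eqVneq (c1 A) 0.
by rewrite add0r; apply: h2.
Qed.

Lemma inCZ K q a c : inC K q c -> inC K q (a *: c).
Proof.
by move=> h A; rewrite ffunE; have [->|/h//] := eqVneq (c A) 0; rewrite scaler0 eqxx.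
Qed.

Lemma inCN K q c : inC K q c -> inC K q (- c).
Proof. by rewrite -scaleN1r; apply: inCZ. Qed.

Lemma inCB K q c1 c2 : inC K q c1 -> inC K q c2 -> inC K q (c1 - c2).
Proof. by move=> h1 h2; apply: inCD => //; apply: inCN. Qed.

Lemma inC_sum I (r : seq I) (P : pred I) K q (c : I -> chain T) :
  (forall i, P i -> inC K q (c i)) -> inC K q (\sum_(i <- r | P i) c i).
Proof. by move=> h; elim/big_ind: _ => //; [exact: inC0|exact: inCD]. Qed.

Lemma inC_delta K q A : A \in K -> #|A| = q -> inC K q (delta A).
Proof.
by move=> KA cA B; rewrite ffunE; case: (B =P A) => [->|_] //; rewrite eqxx.
Qed.

End InC.

Lemma inC_lin T T' (K : {set {set T}}) (K' : {set {set T'}}) q q'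
    (f : {set T} -> chain T') c :
  (forall A, A \in K -> #|A| = q -> inC K' q' (f A)) ->
  inC K q c -> inC K' q' (lin f c).
Proof.
move=> h hc; rewrite /lin; apply: inC_sum => A _.
have [->|/hc[KA cA]] := eqVneq (c A) 0; first by rewrite scale0r; apply: inC0.
by apply: inCZ; apply: h.
Qed.

Lemma inC_sub T (K K' : {set {set T}}) q (c : chain T) : {subset K <= K'} -> inC K q c -> inC K' q c.
Proof. by move=> s h A /h[/s]. Qed.

Lemma inC_eq0 T (K : {set {set T}}) q (c : chain T) : (forall A, A \in K -> (#|A| < q)%N) -> inC K q c -> c = 0.
Proof.
move=> h hc; apply/ffunP => A; rewrite [RHS]ffunE.
by apply/eqP; apply: contraT => /hc[/h ltAq eqAq]; rewrite eqAq ltnn in ltAq.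
Qed.

Lemma eq_lin_inC T T' (K : {set {set T}}) q (f g : {set T} -> chain T') c : inC K q c ->
  (forall A, A \in K -> #|A| = q -> f A = g A) -> lin f c = lin g c.
Proof. by move=> hc h; apply: eq_lin => A /hc[KA cA]; apply: h. Qed.

Definition dclosed (T : finType) (K : {set {set T}}) :=
  forall A B : {set T}, A \in K -> B \subset A -> B \in K.

(** A rank replaces an orientation: the vertices of a simplex are ordered by it and signs count the
    vertices of lower rank. Injectivity is asked on simplices only, so that a rank can be invariant
    under a group. *)
Definition ranked (T : finType) (rk : T -> nat) (K : {set {set T}}) :=
  forall A, A \in K -> {in A &, injective rk}.

Section Boundary.
Variables (T : finType) (rk : T -> nat).
Implicit Types (x y a : T) (A B : {set T}) (c : chain T).

Definition lo x A := #|[set y in A | (rk y < rk x)%N]|.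

Definition boundary A : chain T := \sum_(x in A) (-1) ^+ lo x A *: delta (A :\ x).

Lemma lo_setU1 x a A : a \notin A -> lo x (a |: A) = ((rk a < rk x) + lo x A)%N.
Proof.
move=> aA; rewrite /lo; have [ax|ax] := boolP (rk a < rk x)%N.
  rewrite (_ : [set y in a |: A | (rk y < rk x)%N] = a |: [set y in A | (rk y < rk x)%N]).
    by rewrite cardsU1 !inE (negPf aA).
  by apply/setP => y; rewrite !inE; case: eqP => // ->.
rewrite add0n; apply: eq_card => y; rewrite !inE.
by case: eqP => // ->; rewrite (negPf ax) !andbF.
Qed.

Lemma lo_setU1x x A : lo x (x |: A) = lo x A.
Proof.
by apply: eq_card => y; rewrite !inE; case: eqP => // ->; rewrite ltnn !andbF.
Qed.

Lemma lo_setD1x x A : lo x (A :\ x) = lo x A.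
Proof.
by apply: eq_card => y; rewrite !inE; case: eqP => // ->; rewrite ltnn !andbF.
Qed.

Lemma lo_setD1 x a A : a \in A -> lo x A = ((rk a < rk x) + lo x (A :\ a))%N.
Proof. by move=> aA; rewrite -lo_setU1 ?setD1K // !inE eqxx. Qed.

Lemma signr_swap x y A : x \in A -> y \in A -> x != y -> {in A &, injective rk} ->
  (-1) ^+ lo x A * (-1) ^+ lo y (A :\ x) = - ((-1) ^+ lo y A * (-1) ^+ lo x (A :\ y)) :> F.
Proof.
move=> xA yA xy inj.
rewrite (lo_setD1 x yA) (lo_setD1 y xA) !exprD.
have : rk x != rk y by apply: contraNneq xy => /inj->.
case: (ltngtP (rk x) (rk y)) => //= _ _; rewrite expr0 expr1 ?mul1r ?mulN1r.
  by rewrite mulNr opprK mulrC.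
by rewrite mulNr mulrC.
Qed.

Lemma bd_bd A : {in A &, injective rk} -> lin boundary (boundary A) = 0.
Proof.
move=> inj; rewrite {2}/boundary linear_sum /=.
under eq_bigr => x xA do rewrite linearZ /= lin_delta /boundary scaler_sumr.
pose E x y := (-1) ^+ lo x A * (-1) ^+ lo y (A :\ x) : F.
have -> : \sum_(x in A) \sum_(y in A :\ x)
     (-1) ^+ lo x A *: ((-1) ^+ lo y (A :\ x) *: delta (A :\ x :\ y)) =
   \sum_(x in A) \sum_(y in A | (rk y < rk x)%N) E x y *: delta (A :\: [set x; y])
   + \sum_(x in A) \sum_(y in A | (rk x < rk y)%N) E x y *: delta (A :\: [set x; y]).
  rewrite -big_split; apply: eq_bigr => x xA /=.
  rewrite (bigID (fun y => (rk y < rk x)%N)) /=; congr (_ + _).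
    apply: eq_big => [y|y]; rewrite !inE.
      by case: eqP => // ->; rewrite ltnn !andbF.
    by move=> _; rewrite scalerA; congr (_ *: delta _); rewrite setDDl.
  apply: eq_big => [y|y].
    rewrite !inE -leqNgt leq_eqVlt; case: eqP => [->|nyx]; first by rewrite ltnn !andbF.
    have [yA|] //= := boolP (y \in A).
    by case: eqP => // /(inj _ _ xA yA) exy; case: nyx.
  by move=> _; rewrite scalerA; congr (_ *: delta _); rewrite setDDl.
rewrite [X in _ + X](exchange_big_dep (mem A)) //=; last by move=> x y xA /andP[].
rewrite -big_split big1 // => x xA /=.
rewrite [X in _ + X](eq_bigl (fun y => (y \in A) && (rk y < rk x)%N)) => [|y]; last first.
  by rewrite xA.
rewrite -big_split big1 // => y /andP[yA lt_yx] /=.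
rewrite [[set y; x]]setUC -scalerDl /E signr_swap ?addNr ?scale0r //.
by apply: contraTneq lt_yx => ->; rewrite ltnn.
Qed.

Lemma bdD K q c : dclosed K -> inC K q.+1 c -> inC K q (lin boundary c).
Proof.
move=> dK; apply: inC_lin => A KA cA; rewrite /boundary; apply: inC_sum => x xA.
apply/inCZ/inC_delta; first exact: dK KA (subD1set _ _).
by have := cardsD1 x A; rewrite xA cA add1n => -[->].
Qed.

Lemma bd0 K c : inC K 0 c -> lin boundary c = 0.
Proof.
move=> hc; apply: lin_eq0 => A /hc[_ /eqP]; rewrite cards_eq0 => /eqP->.
by rewrite /boundary big_set0.
Qed.

Lemma lin_bd_bd K q c : ranked rk K -> inC K q c -> lin boundary (lin boundary c) = 0.
Proof.
move=> rK hc; rewrite lin_comp; apply: lin_eq0 => A /hc[KA _].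
by apply: bd_bd; apply: rK.
Qed.

Lemma bdE c B : lin boundary c B = \sum_(x | x \notin B) (-1) ^+ lo x B * c (x |: B).
Proof.
rewrite linE.
transitivity (\sum_(A : {set T}) \sum_(x | (x \in A) && (A :\ x == B))
                 (-1) ^+ lo x B * c A).
  apply: eq_bigr => A _; rewrite /boundary sum_ffunE mulr_sumr big_mkcondr.
  apply: eq_bigr => x xA; rewrite !ffunE eq_sym; case: eqP => [<-|_].
    by rewrite lo_setD1x mulrC; congr (_ * _); apply: mulr1.
  by rewrite scaler0 mulr0.
rewrite (exchange_big_dep (fun x => x \notin B)) /=; last first.
  by move=> A x _ /andP[_ /eqP<-]; rewrite !inE eqxx.
apply: eq_bigr => x xB; rewrite (big_pred1 (x |: B)) // => A /=.
apply/andP/eqP => [[xA /eqP<-]|->]; first by rewrite setD1K.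
by rewrite setU11 setU1K.
Qed.

Definition cone_simplex a A : chain T :=
  if a \in A then 0 else (-1) ^+ lo a A *: delta (a |: A).

(** The cone is a contracting homotopy in the reduced complex, including simplices that already
    contain the apex: there only the face opposite to [a] contributes. *)
Lemma coneP a A : {in a |: A &, injective rk} ->
  lin boundary (cone_simplex a A) + lin (cone_simplex a) (boundary A) = delta A.
Proof.
move=> inj; rewrite {2}/boundary linear_sum /= {1}/cone_simplex.
under eq_bigr => x xA do rewrite linearZ /= lin_delta.
case: ifPn => aA.
  rewrite linear0 add0r (bigD1 a) //= {1}/cone_simplex !inE eqxx /= scalerA.
  rewrite lo_setD1x -expr2 sqrr_sign scale1r setD1K // big1 ?addr0 //.
  by move=> x /andP[xA nxa]; rewrite /cone_simplex !inE eq_sym nxa aA scaler0.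
rewrite linearZ /= lin_delta {1}/boundary big_setU1 //= setU1K // lo_setU1x scalerDr.
rewrite scalerA -expr2 sqrr_sign scale1r -addrA scaler_sumr -big_split big1 ?addr0 //.
move=> x xA /=.
have nxa : x != a by apply: contraNneq aA => <-.
rewrite /cone_simplex !inE (negPf aA) andbF !scalerA.
have -> : (a |: A) :\ x = a |: (A :\ x).
  by apply/setP=> y; rewrite !inE; case: (eqVneq y a) => // ->; rewrite eq_sym nxa.
rewrite -scalerDl lo_setU1 // (lo_setD1 a xA) !exprD.
have : rk x != rk a by apply: contraNneq nxa => /inj->; rewrite ?setU11 ?setU1r.
case: (ltngtP (rk x) (rk a)) => //= _ _; rewrite expr0 expr1 ?mul1r ?mulN1r.
  by rewrite mulNr [X in - X + _]mulrC addNr scale0r.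
by rewrite mulrN [X in - X + _]mulrC addNr scale0r.
Qed.

End Boundary.
End Chains.

(** * Chain maps induced by vertex maps, and group actions on chains *)

Section Maps.
Variable F : fieldType.
Local Notation chain := (chain F).
Local Notation delta := (@delta F _).
Local Notation bd := (@boundary F _).
Local Notation cone := (@cone_simplex F _).

(** Pull-back along [f], hence the push-forward by its inverse when [f] is bijective. No sign occurs
    because [f] will preserve ranks. *)
Definition act (T : finType) (f : T -> T) (c : chain T) : chain T :=
  [ffun A : {set T} => c (f @: A)].

Lemma act_is_linear (T : finType) (f : T -> T) : linear (act f).
Proof. by move=> a u v; apply/ffunP => A; rewrite !ffunE. Qed.

HB.instance Definition _ (T : finType) (f : T -> T) :=
  GRing.isLinear.Build F (chain T) (chain T) *:%R (act f) (act_is_linear f).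

Lemma lo_imset (T T' : finType) (rk : T -> nat) (rk' : T' -> nat) (f : T -> T') (A : {set T}) x :
  {in A &, injective f} -> x \in A ->
  {in A &, forall y z, (rk' (f y) < rk' (f z))%N = (rk y < rk z)%N} ->
  lo rk' (f x) (f @: A) = lo rk x A.
Proof.
move=> inj xA mono; rewrite /lo.
rewrite -(@card_in_imset _ _ f [set y in A | (rk y < rk x)%N]); last first.
  by move=> y z; rewrite !inE => /andP[yA _] /andP[zA _]; apply: inj.
apply: eq_card => z; rewrite !inE; apply/andP/imsetP => [[/imsetP[y yA ->]]|[y]].
  by rewrite mono // => yx; exists y; rewrite // inE yA.
by rewrite inE => /andP[yA yx] ->; rewrite imset_f // mono.
Qed.

Lemma act_bd (T : finType) (rk : T -> nat) (f : T -> T) (c : chain T) :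
  injective f -> (forall x, rk (f x) = rk x) ->
  act f (lin (bd rk) c) = lin (bd rk) (act f c).
Proof.
move=> inj rkf; apply/ffunP => B; rewrite ffunE !bdE.
rewrite (reindex f) /=; last exact/onW_bij/(injF_bij inj).
apply: eq_big => [x|x xB]; first by rewrite mem_imset.
rewrite ffunE imsetU1; congr (_ * _).
congr (_ ^+ _); rewrite -(lo_setU1x rk x B) -(lo_setU1x rk (f x)) -imsetU1.
by apply: lo_imset; rewrite ?setU11 //; [exact: in2W | move=> y z _ _; rewrite !rkf].
Qed.

Definition push_simplex (T T' : finType) (f : T -> T') (A : {set T}) : chain T' :=
  if #|f @: A| == #|A| then delta (f @: A) else 0.

Lemma push_inC (T T' : finType) (f : T -> T') (A : {set T}) (K : {set {set T'}}) :
  f @: A \in K -> inC K #|A| (push_simplex f A).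
Proof.
rewrite /push_simplex; case: eqP => [<- KA|_ _]; first exact: inC_delta.
exact: inC0.
Qed.

Section PushBoundary.
Variables (T T' : finType) (rk : T -> nat) (rk' : T' -> nat) (f : T -> T').

(** If [f] is injective on [A] the faces correspond with equal signs. If it identifies two vertices,
    only the two faces omitting one of them can be non-degenerate; those have the same image and
    opposite signs. *)
Lemma push_bd (A : {set T}) :
  {in A &, injective rk} -> {in f @: A &, injective rk'} ->
  {in A &, forall x y, (rk x < rk y)%N -> (rk' (f x) <= rk' (f y))%N} ->
  lin (bd rk') (push_simplex f A) = lin (push_simplex f) (bd rk A).
Proof.
move=> injA injfA mono; rewrite [X in _ = lin _ X]/boundary linear_sum /=.
under eq_bigr => x xA do rewrite linearZ /= lin_delta.
rewrite {1}/push_simplex; case: ifPn => [/imset_injP inj | /imset_injP ninj].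
  have fE x : x \in A -> f @: (A :\ x) = (f @: A) :\ f x.
    move=> xA; apply/setP => u; rewrite !inE; apply/imsetP/andP => [[y]|].
      rewrite !inE => /andP[nyx yA] ->; rewrite imset_f //; split => //.
      by apply: contraNneq nyx => /inj->.
    case=> nu /imsetP[y yA def_u]; exists y => //; rewrite !inE yA andbT.
    by apply: contraNneq nu => <-; rewrite def_u.
  rewrite lin_delta /boundary big_imset //=; apply: eq_bigr => x xA.
  rewrite /push_simplex (_ : #|_| == _); last first.
    by apply/imset_injP => y z; rewrite !inE => /andP[_ ?] /andP[_ ?]; apply: inj.
  rewrite fE // (@lo_imset _ _ rk rk') // => y z yA zA.
  have [yz|zy|eyz] := ltngtP (rk y) (rk z).
  - rewrite ltn_neqAle mono // andbT; apply/eqP => /injfA e.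
    have/inj: f y = f z by apply: e; rewrite imset_f.
    by move=> e'; rewrite e' ?ltnn // in yz.
  - by rewrite ltnNge mono.
  by rewrite (injA _ _ yA zA eyz) ltnn.
have [x [y [xA yA nxy fxy]]] : exists x y, [/\ x \in A, y \in A, (rk x < rk y)%N & f x = f y].
  have [/existsP[x /existsP[y /and4P[]]]|] := boolP [exists x, exists y,
    [&& x \in A, y \in A, (rk x < rk y)%N & f x == f y]].
    by move=> ? ? ? /eqP ?; exists x, y.
  move=> nex; case: ninj => x y xA yA fxy.
  have nex' u v : u \in A -> v \in A -> f u = f v -> (rk u < rk v)%N -> False.
    move=> uA vA fuv uv; case/existsP: nex; exists u; apply/existsP; exists v.
    by rewrite uA vA uv fuv eqxx.
  have [lt|lt|] := ltngtP (rk x) (rk y); last exact: injA.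
    by case: (nex' x y).
  by case: (nex' y x).
rewrite linear0.
have nexy : x != y by apply: contraTneq nxy => ->; rewrite ltnn.
rewrite (bigD1 x) //= (bigD1 y) /=; last by rewrite yA eq_sym.
rewrite [X in _ + (_ + X)]big1 ?addr0; last first.
  move=> z /andP[/andP[zA nzx] nzy]; rewrite /push_simplex ifN ?scaler0 //.
  apply/imset_injP => /(_ x y); rewrite !inE xA yA (eq_sym x) (eq_sym y) nzx nzy.
  by move=> /(_ isT isT fxy) /eqP; rewrite (negPf nexy).
have fE u v : u \in A -> v \in A -> u != v -> f u = f v -> f @: (A :\ u) = f @: A.
  move=> uA vA nuv fuv; apply/eqP; rewrite eqEsubset imsetS ?subD1set //=.
  apply/subsetP => _ /imsetP[z zA ->]; case: (eqVneq z u) => [->|nzu].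
    by rewrite fuv imset_f // !inE eq_sym nuv.
  by rewrite imset_f // !inE nzu.
have neyx : y != x by rewrite eq_sym.
rewrite /push_simplex (fE x y) // (fE y x) //.
have -> : #|A :\ x| = #|A :\ y|.
  by have := cardsD1 x A; rewrite (cardsD1 y A) xA yA => /addnI.
case: ifP => [inj|_]; last by rewrite !scaler0 addr0.
rewrite -scalerDl.
have injx : {in A :\ x &, injective f}.
  apply/imset_injP; rewrite (fE x y) // (eqP inj).
  by have := cardsD1 x A; rewrite (cardsD1 y A) xA yA => /addnI->.
(* By monotonicity a vertex ranked strictly between x and y would have the same image as both,
   against the injectivity of [f] on [A :\ x]; so x and y are consecutive. *)
suff -> : lo rk y A = (lo rk x A).+1.
  by rewrite exprS mulN1r subrr scale0r.
rewrite /lo (_ : [set z in A | (rk z < rk y)%N] = x |: [set z in A | (rk z < rk x)%N]).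
  by rewrite cardsU1 !inE ltnn andbF.
apply/setP => z; rewrite !inE; case: (eqVneq z x) => [->|nzx] /=; first by rewrite xA nxy.
have [zA|//] /= := boolP (z \in A).
apply/idP/idP => [zy|/ltn_trans->//].
rewrite ltn_neqAle leqNgt; apply/andP; split.
  by apply: contraNneq nzx => /injA->.
apply/negP => xz.
have e : f z = f y.
  apply: injfA; rewrite ?imset_f //; apply/eqP.
  by rewrite eqn_leq mono //= -fxy mono.
have/injx : f z = f y by [].
by rewrite !inE nzx zA eq_sym nexy yA => /(_ isT isT) ezy; rewrite ezy ltnn in zy.
Qed.

End PushBoundary.

Lemma push_comp (T T' T'' : finType) (f : T -> T') (g : T' -> T'') (A : {set T}) :
  lin (push_simplex g) (push_simplex f A) = push_simplex (g \o f) A.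
Proof.
rewrite {1}/push_simplex /push_simplex imset_comp; case: eqP => [eA|neA].
  by rewrite lin_delta /push_simplex eA.
rewrite linear0 ifN //; apply/eqP => e; apply: neA.
by apply/eqP; rewrite eqn_leq leq_imset_card -{1}e leq_imset_card.
Qed.

Lemma push_id (T : finType) (f : T -> T) (A : {set T}) :
  {in A, f =1 id} -> push_simplex f A = delta A.
Proof.
move=> fid; rewrite /push_simplex (_ : f @: A = A) ?eqxx //.
by rewrite (eq_in_imset fid) imset_id.
Qed.

Lemma act_push (T T' : finType) (g : T -> T) (h : T' -> T') (f : T -> T') c :
  injective g -> injective h -> (forall x, f (g x) = h (f x)) ->
  act h (lin (push_simplex f) c) = lin (push_simplex f) (act g c).
Proof.
move=> injg injh fg; apply/ffunP => B; rewrite ffunE !linE.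
rewrite (reindex (fun A : {set T} => g @: A)) /=; last first.
  exact/onW_bij/(injF_bij (imset_inj injg)).
apply: eq_bigr => A _; rewrite ffunE; congr (_ * _).
have e : f @: (g @: A) = h @: (f @: A).
  by rewrite -!imset_comp; apply: eq_imset.
rewrite /push_simplex e (card_imset _ injh) (card_imset _ injg); case: ifP => _; rewrite !ffunE //.
by rewrite (inj_eq (imset_inj injh)).
Qed.

Section ConeChain.
Variables (T : finType) (rk : T -> nat).

Lemma lin_coneP a K q (c : chain T) : inC K q c ->
  (forall A, A \in K -> {in a |: A &, injective rk}) ->
  lin (bd rk) (lin (cone rk a) c) = c - lin (cone rk a) (lin (bd rk) c).
Proof.
move=> hc good; apply/eqP; rewrite eq_sym subr_eq; apply/eqP.
rewrite !lin_comp lin_add -[LHS]lin_deltaE; apply: eq_lin => A /hc[KA _].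
by rewrite coneP //; apply: good.
Qed.

Lemma coneE a (c : chain T) A :
  lin (cone rk a) c A = if a \in A then (-1) ^+ lo rk a (A :\ a) * c (A :\ a) else 0.
Proof.
rewrite linE; case: ifPn => aA.
  rewrite (bigD1 (A :\ a)) //= big1 ?addr0 => [|B nB]; last first.
    rewrite /cone_simplex; case: ifPn => aB; first by rewrite ffunE mulr0.
    rewrite !ffunE; case: eqP => [e|_]; last by rewrite scaler0 mulr0.
    by move: nB; rewrite e setU1K ?eqxx.
  rewrite /cone_simplex !inE eqxx /= ffunE setD1K // ffunE eqxx mulrC; congr (_ * _).
  exact: mulr1.
rewrite big1 // => B _; rewrite /cone_simplex; case: ifPn => aB; first by rewrite ffunE mulr0.
rewrite !ffunE; case: eqP => [e|_]; last by rewrite scaler0 mulr0.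
by move: aA; rewrite e setU11.
Qed.

End ConeChain.
End Maps.

(** * Flags of simplices *)

Section Flags.
Variable T : finType.
Implicit Types (K : {set {set T}}) (t : {set {set T}}) (A B : {set T}).

(* The order complex of the nonempty simplices, i.e. the barycentric           *)
(* subdivision of [K].                                                        *)
Definition flags K : {set {set {set T}}} :=
  [set t : {set {set T}} | [forall A in t, (A \in K) && (A != set0)] &&
     [forall A in t, forall B in t, (A \subset B) || (B \subset A)]].

Lemma flagsP K t :
  reflect ((forall A, A \in t -> A \in K /\ A != set0) /\
           {in t &, forall A B, (A \subset B) || (B \subset A)})
          (t \in flags K).
Proof.
rewrite inE; apply: (iffP andP) => -[h1 h2]; split.
- by move=> A /(forall_inP h1)/andP[].
- by move=> A B At Bt; have /forall_inP := forall_inP h2 A At; apply.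
- by apply/forall_inP => A /h1[-> ->].
- by apply/forall_inP => A At; apply/forall_inP => B Bt; apply: h2.
Qed.

Lemma flags0 K : set0 \in flags K.
Proof. by apply/flagsP; split=> [A|A B]; rewrite inE. Qed.

Lemma flags_dclosed K : dclosed (flags K).
Proof.
move=> t u /flagsP[h1 h2] /subsetP sut; apply/flagsP; split=> [A /sut/h1//|].
by move=> A B /sut At /sut Bt; apply: h2.
Qed.

Lemma flags_ranked K : ranked (fun A : {set T} => #|A|) (flags K).
Proof.
move=> t /flagsP[_ h] A B At Bt /= eAB; apply/eqP.
by case/orP: (h A B At Bt) => s; [|rewrite eq_sym]; rewrite eqEcard s eAB leqnn.
Qed.

Lemma flags_sub K K' : {subset K <= K'} -> {subset flags K <= flags K'}.
Proof. by move=> s t /flagsP[h1 h2]; apply/flagsP; split=> // A /h1[/s]. Qed.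

Lemma flags_card K s n t : (0 < s)%N ->
  (forall A, A \in K -> (s %| #|A|)%N /\ (#|A| <= n * s)%N) ->
  t \in flags K -> (#|t| <= n)%N.
Proof.
move=> s0 h tK; have /flagsP[h1 _] := tK.
rewrite cardE -(size_map (fun A : {set T} => #|A| %/ s)%N) -[n in (_ <= n)%N](size_iota 1).
apply: uniq_leq_size.
  rewrite map_inj_in_uniq ?enum_uniq // => A B; rewrite !mem_enum => At Bt e.
  apply: (flags_ranked tK) => //.
  have [[/h[dA _] _] [/h[dB _] _]] := (h1 A At, h1 B Bt).
  by rewrite -(divnK dA) e divnK.
move=> x /mapP[A]; rewrite mem_enum => /h1[/h[dA leA] nA] {x}->.
rewrite mem_iota add1n ltnS divn_gt0 // leq_divLR // leA andbT.
by rewrite dvdn_leq // lt0n cards_eq0.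
Qed.

Lemma flags_setU1 K A t : A \in K -> A != set0 -> t \in flags K ->
  {in t, forall B, (B \subset A) || (A \subset B)} -> A |: t \in flags K.
Proof.
move=> KA nA /flagsP[h1 h2] cmp; apply/flagsP; split=> [B|B C].
  by rewrite !inE => /predU1P[->|/h1].
rewrite !inE => /predU1P[->|Bt] /predU1P[->|Ct]; rewrite ?subxx //.
- by rewrite orbC cmp.
- exact: cmp.
exact: h2.
Qed.

End Flags.

(** * Acyclic carriers *)

Section Sd.
Variable F : fieldType.
Local Notation chain := (chain F).
Local Notation delta := (@delta F _).
Local Notation bd := (@boundary F _).
Local Notation cone := (@cone_simplex F _).
Local Notation push := (@push_simplex F _ _).

Definition acyclic (T : finType) (rk : T -> nat) (K : {set {set T}}) (q : nat) :=
  forall c : chain T, inC K q c -> lin (bd rk) c = 0 ->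
  exists2 b, inC K q.+1 b & lin (bd rk) b = c.

Lemma cone_inC (T : finType) (rk : T -> nat) (K : {set {set T}}) a q (c : chain T) :
  (forall A, A \in K -> a |: A \in K) -> inC K q c -> inC K q.+1 (lin (cone rk a) c).
Proof.
move=> h; apply: inC_lin => A KA cA; rewrite /cone_simplex; case: ifPn => aA; first exact: inC0.
by apply/inCZ/inC_delta; [exact: h | rewrite cardsU1 aA cA].
Qed.

Lemma cone_acyclic (T : finType) (rk : T -> nat) (K : {set {set T}}) a q :
  ranked rk K -> (forall A, A \in K -> a |: A \in K) -> acyclic rk K q.
Proof.
move=> rK h c hc zc; exists (lin (cone rk a) c); first exact: cone_inC.
by rewrite (lin_coneP hc) ?zc ?linear0 ?oppr0 ?addr0 // => A KA; apply/rK/h.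
Qed.

Lemma bd_supp (T : finType) (rk : T -> nat) (A B : {set T}) :
  bd rk A B != 0 -> B \subset A /\ #|A| = #|B|.+1.
Proof.
case cA: #|A| => [|n].
  by move/eqP: cA; rewrite cards_eq0 => /eqP->; rewrite /boundary big_set0 ffunE eqxx.
have: inC (powerset A) n (bd rk A).
  rewrite -(lin_delta (bd rk) A); apply: bdD; last by apply: inC_delta => //; rewrite powersetE.
  by move=> C D; rewrite !powersetE => sCA /subset_trans; apply.
by move=> h /h[]; rewrite powersetE => -> ->.
Qed.

(** The acyclic carrier method: a chain map carried by acyclic subcomplexes is null-homotopic. A
    primitive of the image of the empty simplex is a separate hypothesis, which starts the induction
    on the degree. *)
Lemma homotopy (T T' : finType) (rk : T -> nat) (rk' : T' -> nat) (K : {set {set T}})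
    (Car : {set T} -> {set {set T'}}) (alpha : {set T} -> chain T') :
  dclosed K -> ranked rk K ->
  (forall A, A \in K -> ranked rk' (Car A)) ->
  (forall A B : {set T}, B \in K -> A \subset B -> {subset Car A <= Car B}) ->
  (forall A, A \in K -> inC (Car A) #|A| (alpha A)) ->
  (forall A, A \in K -> lin (bd rk') (alpha A) = lin alpha (bd rk A)) ->
  (forall A, A \in K -> A != set0 -> acyclic rk' (Car A) #|A|) ->
  (exists2 b, inC (Car set0) 1 b & lin (bd rk') b = alpha set0) ->
  exists2 E : {set T} -> chain T',
    (forall A, A \in K -> inC (Car A) #|A|.+1 (E A)) &
    (forall A, A \in K -> lin (bd rk') (E A) + lin E (bd rk A) = alpha A).
Proof.
move=> dK rK rCar mCar aC abd acy [b0 b0C b0bd].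
suff [E h1 h2] : exists2 E : {set T} -> chain T',
    (forall A, A \in K -> (#|A| <= #|T|)%N -> inC (Car A) #|A|.+1 (E A)) &
    (forall A, A \in K -> (#|A| <= #|T|)%N ->
       lin (bd rk') (E A) + lin E (bd rk A) = alpha A).
  by exists E => A KA; [apply: h1|apply: h2]; rewrite ?max_card.
elim: #|T| => [|n [E h1 h2]].
  exists (fun _ => b0) => A KA; rewrite leqn0 cards_eq0 => /eqP->; rewrite ?cards0 //.
  by rewrite /boundary big_set0 linear0 addr0.
have ext (A : {set T}) : exists e : chain T', ((#|A| <= n)%N -> e = E A) /\ (A \in K -> (#|A| <= n.+1)%N ->
    inC (Car A) #|A|.+1 e /\ lin (bd rk') e + lin E (bd rk A) = alpha A).
  have [leAn|ltnA] := leqP #|A| n; first by exists (E A); split=> // KA _; split; [apply: h1|apply: h2].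
  have [KA|nKA] := boolP (A \in K); last by exists 0.
  have [leA|gtA] := leqP #|A| n.+1; last by exists 0; split=> // _ /leq_trans/(_ (leqnn _)).
  have cA : #|A| = n.+1 by apply/eqP; rewrite eqn_leq leA.
  have KD : inC [set B in K | B \subset A] n (bd rk A).
    rewrite -(lin_delta (bd rk) A); apply: bdD.
      move=> B C; rewrite !inE => /andP[KB sBA] sCB.
      by rewrite (dK B) // (subset_trans sCB).
    by apply: inC_delta => //; rewrite inE KA /=.
  have C1 : inC (Car A) n.+1 (lin E (bd rk A)).
    apply: inC_lin KD => B; rewrite inE => /andP[KB sBA] cB.
    by apply: inC_sub (mCar _ _ KA sBA) _; rewrite -cB; apply: h1; rewrite // cB.
  have nA : A != set0 by rewrite -cards_eq0 cA.
  have C2 : inC (Car A) #|A| (alpha A - lin E (bd rk A)).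
    by apply: inCB; [exact: aC | rewrite cA].
  (* The chain [alpha A - lin E (bd rk A)] is a cycle: in lower degree [alpha - E d] equals [d E],
     and d d = 0. Any primitive of it can serve as E at [A]. *)
  have [|e eC bde] := acy A KA nA _ C2.
    rewrite linearB /= abd //; apply/eqP; rewrite subr_eq0; apply/eqP/esym.
    rewrite lin_comp (eq_lin_inC (g := fun B => alpha B - lin E (bd rk B)) KD).
      rewrite -lin_add -lin_opp -lin_comp bd_bd; last exact: rK.
      by rewrite linear0 oppr0 addr0.
    move=> B; rewrite inE => /andP[KB _] cB.
    by rewrite -(h2 B KB) ?addrK // cB.
  by exists e; split=> [//|_ _]; rewrite bde subrK; split.
have [E' hE'] := fin_all_exists ext.
exists E' => A KA cA; first by have [_ /(_ KA cA)[]] := hE' A.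
have [_ /(_ KA cA)[_ <-]] := hE' A; congr (_ + _); apply: eq_lin => B nB.
have [_ cB] := bd_supp nB.
by have [->] := hE' B; rewrite // -ltnS -cB.
Qed.

End Sd.

(** * The barycentric subdivision operator *)

Section Subdivision.
Variable F : fieldType.
Local Notation chain := (chain F).
Local Notation delta := (@delta F _).
Local Notation bd := (@boundary F _).
Local Notation cone := (@cone_simplex F _).
Local Notation push := (@push_simplex F _ _).

Definition crk (T : finType) (A : {set T}) := #|A|.

Lemma flags_powerset (T : finType) (A B : {set T}) t :
  t \in flags (powerset A) -> B \in t -> B \subset A.
Proof. by case/flagsP=> h _ /h[]; rewrite powersetE. Qed.

Lemma flags_powersetS (T : finType) (A B : {set T}) : A \subset B ->
  {subset flags (powerset A) <= flags (powerset B)}.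
Proof. by move=> sAB; apply: flags_sub => C; rewrite !powersetE => /subset_trans->. Qed.

Lemma flags_apex (T : finType) (A : {set T}) t : A != set0 ->
  t \in flags (powerset A) -> A |: t \in flags (powerset A).
Proof.
move=> nA tA; apply: flags_setU1; rewrite ?powersetE // => B /(flags_powerset tA)->.
by [].
Qed.

Section Sd.
Variables (T : finType) (rk : T -> nat).

(** The cone with apex the barycentre [A] over the subdivided boundary; [n] is fuel, taken equal to
    the number of vertices of [A]. *)
Fixpoint sdn (n : nat) (A : {set T}) : chain {set T} :=
  if n is n'.+1 then lin (cone (@crk T) A) (lin (sdn n') (bd rk A)) else delta set0.

Definition sd (A : {set T}) := sdn #|A| A.

Lemma sd0 : sd set0 = delta set0.
Proof. by rewrite /sd cards0. Qed.

Lemma sdE (A : {set T}) : A != set0 -> sd A = lin (cone (@crk T) A) (lin sd (bd rk A)).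
Proof.
rewrite -cards_eq0 /sd; case cA: #|A| => [|n] //= _; congr (lin _ _).
by apply: eq_lin => B /bd_supp[_]; rewrite cA => -[->].
Qed.

Lemma sd_inC (A : {set T}) : inC (flags (powerset A)) #|A| (sd A).
Proof.
have [n] := ubnP #|A|; elim: n A => // n IH A; rewrite ltnS => leA.
have [->|nA] := eqVneq A set0.
  by rewrite sd0 cards0; apply: inC_delta; rewrite ?flags0 ?cards0.
rewrite sdE //; have [m cA] : exists m, #|A| = m.+1.
  by exists #|A|.-1; rewrite prednK // card_gt0.
rewrite cA; apply: cone_inC; first by move=> t; apply: flags_apex.
apply: (@inC_lin _ _ _ (powerset A) _ m) => [B|]; last first.
  by move=> B /bd_supp[sBA]; rewrite powersetE sBA cA => -[->].
rewrite powersetE => sBA cB; rewrite -cB.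
apply: inC_sub (IH B _); first exact: flags_powersetS.
by rewrite (leq_trans _ leA) // cA cB.
Qed.

Lemma sd_inC_flags (K : {set {set T}}) (A : {set T}) : dclosed K -> A \in K ->
  inC (flags K) #|A| (sd A).
Proof.
move=> dK KA; apply: (inC_sub _ (@sd_inC A)); apply: flags_sub => B.
by rewrite powersetE; apply: dK.
Qed.

Lemma lin_sd_inC (K : {set {set T}}) q (c : chain T) : dclosed K -> inC K q c ->
  inC (flags K) q (lin sd c).
Proof. by move=> dK; apply: inC_lin => A KA <-; apply: sd_inC_flags. Qed.

Lemma sd_bd (A : {set T}) : {in A &, injective rk} ->
  lin (bd (@crk T)) (sd A) = lin sd (bd rk A).
Proof.
have [n] := ubnP #|A|; elim: n A => // n IH A; rewrite ltnS => leA inj.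
have [->|nA] := eqVneq A set0.
  by rewrite sd0 lin_delta /boundary !big_set0 linear0.
rewrite {1}sdE //; have [m cA] : exists m, #|A| = m.+1.
  by exists #|A|.-1; rewrite prednK // card_gt0.
have C : inC (flags (powerset A)) m (lin sd (bd rk A)).
  apply: lin_sd_inC => [B C|B /bd_supp[sBA]]; rewrite !powersetE.
    by move=> sBA /subset_trans->.
  by rewrite sBA cA => -[->].
rewrite (lin_coneP C) => [|t tA]; last exact/flags_ranked/flags_apex/tA.
rewrite -[RHS]subr0; congr (_ - _).
rewrite [lin (bd _) _]lin_comp (@eq_lin _ _ _ _ (fun B => lin sd (bd rk B))).
  by rewrite -(lin_comp sd (bd rk)) bd_bd ?linear0.
move=> B /bd_supp[sBA cB]; apply: IH; first by rewrite -cB.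
by move=> x y /(subsetP sBA) xA /(subsetP sBA); apply: inj.
Qed.

Lemma lin_sd_bd (K : {set {set T}}) q (c : chain T) : ranked rk K -> inC K q c ->
  lin (bd (@crk T)) (lin sd c) = lin sd (lin (bd rk) c).
Proof.
move=> rK cK; rewrite !lin_comp; apply: (eq_lin_inC cK) => A KA _.
by apply: sd_bd; apply: rK.
Qed.

End Sd.

Section SdNatural.
Variables (T T' : finType) (rk : T -> nat) (rk' : T' -> nat) (f : T -> T').

(** The recursion for [sd] only sees inclusions, cardinalities and relative ranks, all preserved by
    a rank-compatible injection. *)
Lemma sd_natural (A : {set T}) (t : {set {set T}}) :
  {in A &, injective f} ->
  {in A &, forall y z, (rk' (f y) < rk' (f z))%N = (rk y < rk z)%N} ->
  (forall B, B \in t -> B \subset A) ->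
  sd rk' (f @: A) ((fun B : {set T} => f @: B) @: t) = sd rk A t.
Proof.
have [n] := ubnP #|A|; elim: n A t => // n IH A t; rewrite ltnS => leA inj mono tA.
have injS : {in powerset A &, injective (fun B : {set T} => f @: B)}.
  move=> B C; rewrite !powersetE => sBA sCA e.
  have sub (B1 C1 : {set T}) : B1 \subset A -> C1 \subset A -> f @: B1 = f @: C1 ->
      B1 \subset C1.
    move=> sB sC e1; apply/subsetP => x xB.
    have: f x \in f @: C1 by rewrite -e1 imset_f.
    by case/imsetP => y yC /inj -> //; [exact: (subsetP sB) | exact: (subsetP sC)].
  by apply/eqP; rewrite eqEsubset; apply/andP; split; apply: sub.
have [eA|nA] := eqVneq A set0.
  rewrite eA imset0 !sd0 !ffunE; congr (_ %:R); congr nat_of_bool.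
  by rewrite imset_eq0.
have nfA : f @: A != set0 by rewrite imset_eq0.
rewrite !sdE // !coneE.
have memt (u : {set {set T}}) (B : {set T}) : B \subset A ->
    (forall C : {set T}, C \in u -> C \subset A) ->
    (f @: B \in [set f @: (x : {set T}) | x in u]) = (B \in u).
  move=> sB uA; apply/imsetP/idP => [[C Cu /injS->//]|Bu]; last by exists B.
    by rewrite powersetE.
  by rewrite powersetE uA.
rewrite memt //; case: ifP => // At.
rewrite !lo_setD1x; congr ((-1) ^+ _ * _).
  apply: (@lo_imset _ _ (@crk T) (@crk T')) => //.
    by move=> B C /tA sB /tA sC; apply: injS; rewrite powersetE.
  have cim (B : {set T}) : B \in t -> #|f @: B| = #|B|.
    move=> /tA/subsetP sB; apply: card_in_imset => x y /sB xA /sB yA.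
    exact: inj.
  by move=> B C Bt Ct; rewrite /crk !cim.
have imt : [set f @: (x : {set T}) | x in t] :\ (f @: A) = [set f @: (x : {set T}) | x in t :\ A].
  apply/setP => u; rewrite !inE; apply/andP/imsetP => [[nu /imsetP[B Bt eu]]|[B]].
    exists B; rewrite // !inE Bt andbT; apply: contraNneq nu => eB.
    by rewrite eu eB.
  rewrite !inE => /andP[nB Bt] ->; rewrite imset_f //; split=> //.
  by apply: contraNneq nB => /injS->; rewrite // powersetE // tA.
have fD x : x \in A -> f @: (A :\ x) = (f @: A) :\ f x.
  move=> xA; apply/setP => u; rewrite !inE; apply/imsetP/andP => [[y]|].
    rewrite !inE => /andP[nyx yA] ->; rewrite imset_f //; split => //.
    by apply: contraNneq nyx => /inj->.
  case=> nu /imsetP[y yA def_u]; exists y => //; rewrite !inE yA andbT.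
  by apply: contraNneq nu => <-; rewrite def_u.
rewrite imt /boundary !linear_sum /= big_imset //= !sum_ffunE; apply: eq_bigr => x xA.
rewrite !linearZ /= !lin_delta !ffunE (@lo_imset _ _ rk rk') // -fD //; congr (_ *: _).
have tA' (B : {set T}) : B \in t :\ A -> B \subset A by rewrite inE => /andP[_ /tA].
have [/forall_inP sub|] := boolP [forall B in t :\ A, B \subset A :\ x].
  apply: IH => //; first by rewrite (leq_trans _ leA) // [in X in (_ < X)%N](cardsD1 x A) xA.
    by move=> y z /setD1P[_ yA] /setD1P[_ zA]; apply: inj.
  by move=> y z /setD1P[_ yA] /setD1P[_ zA]; apply: mono.
rewrite negb_forall_in => /exists_inP[B Bt nB].
have -> : sd rk (A :\ x) (t :\ A) = 0.
  by apply/eqP; apply: contraNT nB => /sd_inC[h _]; apply: flags_powerset h Bt.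
apply/eqP; apply: contraNT nB => /sd_inC[h _].
have /subsetP sfB : f @: B \subset f @: (A :\ x).
  by apply: flags_powerset h _; apply: imset_f.
apply/subsetP => y yB; have /imsetP[z zA] := sfB _ (imset_f f yB).
move/inj => -> //; first exact: (subsetP (tA' _ Bt)).
by case/setD1P: zA.
Qed.

Lemma push_sd (A : {set T}) :
  {in A &, injective f} ->
  {in A &, forall y z, (rk' (f y) < rk' (f z))%N = (rk y < rk z)%N} ->
  lin (push (fun B : {set T} => f @: B)) (sd rk A) = sd rk' (f @: A).
Proof.
move=> inj mono; apply/ffunP => u; rewrite linE.
have injS : {in powerset A &, injective (fun B : {set T} => f @: B)}.
  move=> B C; rewrite !powersetE => sBA sCA e.
  have sub (B1 C1 : {set T}) : B1 \subset A -> C1 \subset A -> f @: B1 = f @: C1 ->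
      B1 \subset C1.
    move=> sB sC e1; apply/subsetP => x xB.
    have: f x \in f @: C1 by rewrite -e1 imset_f.
    by case/imsetP => y yC /inj -> //; [exact: (subsetP sB) | exact: (subsetP sC)].
  by apply/eqP; rewrite eqEsubset; apply/andP; split; apply: sub.
have injt (t : {set {set T}}) : t \subset powerset A ->
    #|[set f @: (B : {set T}) | B in t]| = #|t|.
  move=> st; apply: card_in_imset => B C /(subsetP st) BA /(subsetP st).
  exact: injS.
have suppA (t : {set {set T}}) : sd rk A t != 0 -> t \subset powerset A.
  by move=> /sd_inC[h _]; apply/subsetP => B /(flags_powerset h); rewrite powersetE.
have [uA|] := boolP (u \subset powerset (f @: A)).
  pose t := [set B : {set T} | (B \subset A) && (f @: B \in u)].
  have tA : t \subset powerset A.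
    by apply/subsetP => B; rewrite inE powersetE => /andP[].
  have ft : [set f @: (B : {set T}) | B in t] = u.
    apply/setP => C; apply/imsetP/idP => [[B]|Cu].
      by rewrite inE => /andP[_ ?] ->.
    have := subsetP uA _ Cu; rewrite powersetE => sC.
    have eC : f @: (A :&: f @^-1: C) = C.
      apply/setP => y; apply/imsetP/idP => [[x]|yC].
        by rewrite !inE => /andP[_ ?] ->.
      have /imsetP[x xA ey] := subsetP sC _ yC.
      by exists x; rewrite // !inE xA -ey.
    by exists (A :&: f @^-1: C); rewrite // inE subsetIl eC.
  rewrite (bigD1 t) //= big1 => [|t' nt]; last first.
    have [->|/suppA st'] := eqVneq (sd rk A t') 0; first by rewrite mul0r.
    rewrite /push_simplex injt // eqxx ffunE -ft; case: eqP => [e|_]; last by rewrite mulr0.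
    case/eqP: nt; apply/setP => B; apply/idP/idP => Bt.
      have: f @: B \in [set f @: (B : {set T}) | B in t] by rewrite e imset_f.
      case/imsetP=> C Ct /injS -> //; first exact: (subsetP st').
      exact: (subsetP tA).
    have: f @: B \in [set f @: (B : {set T}) | B in t'] by rewrite -e imset_f.
    case/imsetP=> C Ct /injS -> //; first exact: (subsetP tA).
    exact: (subsetP st').
  rewrite /push_simplex injt // eqxx ffunE ft eqxx mulr1 addr0 -ft sd_natural //.
  by move=> B /(subsetP tA); rewrite powersetE.
move=> nuA; rewrite big1 => [|t _].
  apply/esym/eqP; apply: contraNT nuA => /sd_inC[h _]; apply/subsetP => B.
  by move=> /(flags_powerset h); rewrite powersetE.
have [->|/suppA st] := eqVneq (sd rk A t) 0; first by rewrite mul0r.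
rewrite /push_simplex injt // eqxx ffunE; case: eqP => [e|_]; last by rewrite mulr0.
case/negP: nuA; rewrite e; apply/subsetP => C /imsetP[B Bt ->].
by rewrite powersetE imsetS //; have := subsetP st _ Bt; rewrite powersetE.
Qed.

End SdNatural.

Lemma act_sd (T : finType) (rk : T -> nat) (f : T -> T) (c : chain T) :
  injective f -> (forall x, rk (f x) = rk x) ->
  act (fun B : {set T} => f @: B) (lin (sd rk) c) = lin (sd rk) (act f c).
Proof.
move=> inj rkf; apply/ffunP => t; rewrite ffunE !linE.
rewrite (reindex (fun A : {set T} => f @: A)) /=; last first.
  exact/onW_bij/(injF_bij (imset_inj inj)).
apply: eq_bigr => A _; rewrite ffunE; congr (_ * _).
have [tA|] := boolP (t \subset powerset A).
  apply: sd_natural; [exact: in2W | by move=> y z _ _; rewrite !rkf|].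
  by move=> B /(subsetP tA); rewrite powersetE.
move=> nA; transitivity (0 : F); last apply/esym; apply/eqP; apply: contraNT nA.
  move=> /sd_inC[h _]; apply/subsetP => B Bt.
  have := flags_powerset h (imset_f _ Bt); rewrite powersetE => /subsetP sB.
  by apply/subsetP => x /(imset_f f)/sB; rewrite mem_imset.
by move=> /sd_inC[h _]; apply/subsetP => B /(flags_powerset h); rewrite powersetE.
Qed.
End Subdivision.

(** * Smith theory *)

Section CyclicOrbits.
Variables (F : fieldType) (X : finType) (phi : X -> X) (p : nat).
Hypotheses (p_prime : prime p) (phi_inj : injective phi).
Hypothesis phip : forall x, iter p phi x = x.

Lemma iter_modp n x : iter (n %% p) phi x = iter n phi x.
Proof.
rewrite {2}(divn_eq n p) addnC iterD; congr (iter _ _ _).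
by elim: (n %/ p)%N => // k IH; rewrite mulSn iterD -IH phip.
Qed.

(** As p is prime, a point that is not fixed has an orbit of exactly p points. *)
Lemma iter_inj_lt i j x : phi x != x -> (i < p)%N -> (j < p)%N ->
  iter i phi x = iter j phi x -> i = j.
Proof.
move=> nx; wlog lt_ij : i j / (i < j)%N => [hw ip jp e|ip jp e].
  case: (ltngtP i j) => // lt; first exact: hw.
  exact/esym/hw.
case/eqP: nx; have e1 : iter (j - i) phi x = x.
  have inj_i : injective (iter i phi) by elim: (i) => //= k IH; exact: inj_comp.
  by apply: inj_i; rewrite -iterD subnKC // ltnW.
have cop : coprime (j - i) p.
  rewrite coprime_sym prime_coprime // gtnNdvd ?subn_gt0 //.
  exact: leq_ltn_trans (leq_subr _ _) jp.
have e2 k : iter (k * (j - i)) phi x = x.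
  by elim: k => // k IH; rewrite mulSn iterD IH.
have lt0 : (0 < j - i)%N by rewrite subn_gt0.
(* Bezout: a multiple of j - i is 1 plus a multiple of p, so [phi] itself would fix x. *)
have [/= k l e3 _] := egcdnP p lt0.
by rewrite -{2}(e2 k) e3 (eqP cop) addnC iterD /= -(iter_modp (l * p)) modnMl.
Qed.

(* [froot phi] selects one representative in each orbit.                      *)
Definition oidx x := findex phi x (froot phi x).

Lemma oidxP x : (oidx x < p)%N /\ iter (oidx x) phi x = froot phi x.
Proof.
have c : fconnect phi x (froot phi x) by rewrite connect_root.
split; last exact: iter_findex.
have := findex_max c; rewrite -/(oidx x) => /leq_trans; apply.
rewrite /order; apply: leq_trans (_ : size (traject phi x p) <= _)%N; last by rewrite size_traject.
apply: leq_trans (card_size _); apply: subset_leq_card; apply/subsetP => y.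
move=> /iter_findex <-; rewrite -iter_modp; apply/trajectP.
by exists (findex phi x y %% p)%N; rewrite // ltn_mod prime_gt0.
Qed.

Lemma froot_phi x : froot phi (phi x) = froot phi x.
Proof.
apply/esym/eqP; rewrite (root_connect (fconnect_sym phi_inj)).
exact: fconnect1.
Qed.

Lemma oidx_uniq x i : phi x != x -> (i < p)%N -> iter i phi x = froot phi x -> i = oidx x.
Proof. by move=> nx ip e; have [op eo] := oidxP x; apply: (iter_inj_lt nx); rewrite // e eo. Qed.

(** Exactly one point of a free orbit is its representative, so restricting an invariant function to
    representatives gives a preimage under the norm. *)
Lemma sum_froot (c : X -> F) x : phi x != x -> (forall y, c (phi y) = c y) ->
  \sum_(j < p) (froot phi (iter j phi x) == iter j phi x)%:R * c (iter j phi x) = c x.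
Proof.
move=> nx cphi; have [op eo] := oidxP x.
have rj j : froot phi (iter j phi x) = froot phi x.
  by elim: j => //= j IH; rewrite froot_phi.
have cj j : c (iter j phi x) = c x by elim: j => //= j IH; rewrite cphi.
rewrite (bigD1 (Ordinal op)) //= rj eo eqxx mul1r -{1}eo cj big1 ?addr0 // => j nj.
rewrite rj; case: eqP => [e|_]; last by rewrite mul0r.
by case/eqP: nj; apply: val_inj; apply: (oidx_uniq nx (ltn_ord j)); rewrite e.
Qed.

(** Summing [c] along the orbit up to the representative gives a discrete primitive, that is, a
    preimage under 1 - [phi]. *)
Lemma sum_oidx (c : X -> F) x : phi x != x ->
  \sum_(j < p) c (iter j phi x) = 0 ->
  \sum_(j < oidx x) c (iter j phi x) - \sum_(j < oidx (phi x)) c (iter j phi (phi x)) = c x.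
Proof.
move=> nx s0; have [op eo] := oidxP x.
have nx1 : phi (phi x) != phi x by rewrite (inj_eq phi_inj).
have sE n : \sum_(j < n) c (iter j phi (phi x)) = \sum_(1 <= j < n.+1) c (iter j phi x).
  rewrite big_add1 /= big_mkord; apply: eq_bigr => j _.
  by rewrite -iterSr.
have sE' n : \sum_(j < n.+1) c (iter j phi x) = c x + \sum_(1 <= j < n.+1) c (iter j phi x).
  by rewrite -(big_mkord predT (fun j => c (iter j phi x))) big_ltn.
case def_o : (oidx x) => [|n].
  (* Past the representative the index jumps to p - 1; the vanishing of the orbit sum absorbs this
     jump. *)
  have -> : oidx (phi x) = p.-1.
    apply/esym/oidx_uniq => //; first by rewrite prednK // prime_gt0.
    rewrite -iterSr prednK ?prime_gt0 // phip froot_phi -eo.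
    by rewrite def_o.
  rewrite big_ord0 sE prednK ?prime_gt0 // sub0r.
  move: s0; case: (p) p_prime => // m _; rewrite sE' => /eqP.
  by rewrite addr_eq0 => /eqP.
have -> : oidx (phi x) = n.
  apply/esym/oidx_uniq => //; first by rewrite (leq_trans _ op) // def_o.
  by rewrite -iterSr froot_phi -eo def_o.
by rewrite sE sE' addrK.
Qed.

End CyclicOrbits.

Section Smith.
Variables (F : fieldType) (p : nat).
Hypotheses (p_prime : prime p) (charF : p \in [pchar F]).
Local Notation chain := (chain F).
Local Notation bd := (@boundary F _).

(* [smith false] is the norm of the cyclic group generated by [f], and        *)
(* [smith true] is 1 - f; each has the image of the other as its kernel, up   *)
(* to chains on fixed simplices (see [smith_exact]).                          *)
Definition smith (T : finType) (f : T -> T) (b : bool) (c : chain T) : chain T :=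
  if b then c - act f c else \sum_(i < p) iter i (act f) c.

Arguments smith : simpl never.

Lemma smithT (T : finType) (f : T -> T) c : smith f true c = c - act f c.
Proof. by []. Qed.

Lemma smithF (T : finType) (f : T -> T) c :
  smith f false c = \sum_(i < p) iter i (act f) c.
Proof. by []. Qed.

Lemma iter_act_linear (T : finType) (f : T -> T) i : linear (iter i (@act F T f)).
Proof. by elim: i => //= i IH a u v; rewrite /= IH linearP. Qed.

Lemma smith_is_linear (T : finType) (f : T -> T) b : linear (smith f b).
Proof.
case: b => a u v; rewrite /smith.
  by rewrite linearP /= opprD addrACA scalerBr.
rewrite scaler_sumr -big_split; apply: eq_bigr => i _; exact: iter_act_linear.
Qed.

HB.instance Definition _ (T : finType) (f : T -> T) b :=
  GRing.isLinear.Build F (chain T) (chain T) *:%R (smith f b) (smith_is_linear f b).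

Definition fixset (T : finType) (f : T -> T) (K : {set {set T}}) : {set {set T}} :=
  [set A in K | [forall x in A, f x == x]].

Lemma fixsetP (T : finType) (f : T -> T) (K : {set {set T}}) (A : {set T}) :
  reflect (A \in K /\ {in A, forall x, f x = x}) (A \in fixset f K).
Proof.
rewrite inE; apply: (iffP andP) => -[KA h]; split=> //.
  by move=> x /(forall_inP h)/eqP.
by apply/forall_inP => x /h/eqP.
Qed.

Lemma fixset_sub (T : finType) (f : T -> T) (K : {set {set T}}) : {subset fixset f K <= K}.
Proof. by move=> A /fixsetP[]. Qed.

Record zp_complex (T : finType) (rk : T -> nat) (f : T -> T) (K : {set {set T}}) : Prop :=
  ZpComplex {
    zp_dclosed : dclosed K;
    zp_ranked : ranked rk K;
    zp_inj : injective f;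
    zp_iter : forall x, iter p f x = x;
    zp_rk : forall x, rk (f x) = rk x;
    zp_stable : forall A : {set T}, (f @: A \in K) = (A \in K) }.

Section OneComplex.
Variables (T : finType) (rk : T -> nat) (f : T -> T) (K : {set {set T}}).
Hypothesis hK : zp_complex rk f K.
Local Notation Kf := (fixset f K).
Local Notation op := (smith f).
Let dK := zp_dclosed hK.
Let rK := zp_ranked hK.
Let f_inj := zp_inj hK.
Let fp := zp_iter hK.
Let rkf := zp_rk hK.
Let fK := zp_stable hK.
Let phi (A : {set T}) := f @: A.

Let phi_inj : injective phi. Proof. exact: imset_inj. Qed.

Let iter_phi i (A : {set T}) : iter i phi A = iter i f @: A.
Proof.
elim: i => /= [|i ->]; first by rewrite imset_id.
by rewrite /phi -imset_comp.
Qed.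

Let phip (A : {set T}) : iter p phi A = A.
Proof.
by rewrite iter_phi (eq_imset (g := id)) ?imset_id.
Qed.

Lemma iter_actE i (c : chain T) (A : {set T}) : iter i (act f) c A = c (iter i phi A).
Proof. by elim: i c A => //= i IH c A; rewrite ffunE IH -iterSr. Qed.

Lemma iterp_act (c : chain T) : iter p (act f) c = c.
Proof. by apply/ffunP => A; rewrite iter_actE phip. Qed.

Lemma smithN c : act f (op false c) = op false c.
Proof.
rewrite smithF linear_sum /=.
under eq_bigr do rewrite -iterS.
rewrite -(big_mkord predT (fun i => iter i.+1 (act f) c)).
rewrite -(big_mkord predT (fun i => iter i (act f) c)).
rewrite -(prednK (prime_gt0 p_prime)) big_nat_recr //= [RHS]big_nat_recl //=.
by rewrite -iterS prednK ?prime_gt0 // iterp_act addrC.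
Qed.

Lemma smith_act b c : op b (act f c) = act f (op b c).
Proof.
case: b; first by rewrite !smithT linearB.
rewrite !smithF linear_sum; apply: eq_bigr => i _.
by rewrite -iterSr -iterS.
Qed.

Lemma smithNK b c : op b (op (~~ b) c) = 0.
Proof.
case: b; rewrite /= smithT; first by rewrite smithN subrr.
by rewrite linearB /= smith_act smithN subrr.
Qed.

Lemma smith_inC b q c : inC K q c -> inC K q (op b c).
Proof.
move=> cK; have actK c' : inC K q c' -> inC K q (act f c').
  by move=> h A; rewrite ffunE => /h; rewrite fK card_imset.
case: b; first by rewrite smithT; apply: inCB => //; apply: actK.
by rewrite smithF; apply: inC_sum => i _; elim: (nat_of_ord i) => //= j; apply: actK.
Qed.

Lemma smith_bd b c : op b (lin (bd rk) c) = lin (bd rk) (op b c).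
Proof.
case: b; first by rewrite !smithT linearB /= act_bd.
rewrite !smithF linear_sum; apply: eq_bigr => i _.
by elim: (nat_of_ord i) => //= j ->; rewrite act_bd.
Qed.

(** Since [f] preserves a rank that is injective on simplices, a simplex mapped to itself is fixed
    vertex by vertex. *)
Let fixE (A : {set T}) : A \in K -> (phi A == A) = (A \in Kf).
Proof.
move=> KA; apply/eqP/fixsetP => [e|[_ h]].
  split=> // x xA; apply: (rK KA) => //.
  by rewrite -e imset_f.
by rewrite /phi (eq_in_imset h) imset_id.
Qed.

(** On invariant chains 1 - f is zero and the norm is multiplication by p, zero in [F]. *)
Lemma smith_fixed b q w : inC Kf q w -> op b w = 0.
Proof.
move=> wK; have aw : act f w = w.
  apply/ffunP => A; rewrite ffunE -/(phi A).
  have [nA|] := boolP ((w A != 0) || (w (phi A) != 0)).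
    have /eqP-> // : phi A == A.
    have [KA hA] : A \in Kf /\ True.
      case/orP: nA => /wK[h _]; split => //.
      have /fixsetP[KfA h2] := h; apply/fixsetP; split; first by rewrite -fK.
      by move=> x xA; apply: f_inj; apply: h2; apply: imset_f.
    by rewrite fixE // (fixset_sub KA).
  by rewrite negb_or !negbK => /andP[/eqP-> /eqP->].
case: b; first by rewrite smithT aw subrr.
rewrite smithF; have iw i : iter i (act f) w = w by elim: i => //= i ->.
under eq_bigr do rewrite iw.
by rewrite sumr_const card_ord -scaler_nat (pcharf0 charF) scale0r.
Qed.

Lemma smith_off b q z A : inC K q z -> A \in Kf -> op b z A = 0.
Proof.
move=> zK AK; have /eqP eA : phi A == A by rewrite fixE // (fixset_sub AK).
case: b; rewrite /smith; first by rewrite !ffunE -/(phi A) eA subrr.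
rewrite sum_ffunE; under eq_bigr do rewrite iter_actE.
have iA i : iter i phi A = A by elim: i => //= i ->.
under eq_bigr do rewrite iA.
by rewrite sumr_const card_ord -mulr_natl (pcharf0 charF) mul0r.
Qed.

Lemma smith_eq_fixed b q q' z w : inC K q z -> inC Kf q' w -> op b z = w -> w = 0 /\ op b z = 0.
Proof.
move=> zK wK e; suff w0 : w = 0 by rewrite e.
apply/ffunP => A; rewrite [RHS]ffunE; apply/eqP; apply: contraT => /[dup] nA.
by move=> /wK[AK _]; rewrite -e (smith_off _ zK) ?eqxx // in nA.
Qed.

(** Here [w] is the restriction of [c] to the fixed simplices; on the free orbits, [z] comes from
    [sum_froot] for b = true and from [sum_oidx] for b = false. *)
Lemma smith_exact b q c : inC K q c -> op b c = 0 ->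
  exists z w, [/\ inC K q z, inC Kf q w & c = op (~~ b) z + w].
Proof.
move=> cK c0.
pose w : chain T := [ffun A => if phi A == A then c A else 0].
have wK : inC Kf q w.
  move=> A; rewrite ffunE; case: ifP => [e /cK[KA cA]|]; last by rewrite eqxx.
  by rewrite -fixE.
case: b c0 => c0 /=.
  have ce (A : {set T}) : c (phi A) = c A.
    by move/eqP: c0; rewrite smithT subr_eq0 => /eqP e; rewrite {2}e ffunE.
  pose z : chain T := [ffun A : {set T} => if phi A == A then 0 else (froot phi A == A)%:R * c A].
  exists z, w; split=> //.
    move=> A; rewrite ffunE; case: ifP => [_|_]; first by rewrite eqxx.
    by move=> h; apply: cK; apply: contraNneq h => ->; rewrite mulr0.
  apply/ffunP => A; rewrite smithF !ffunE sum_ffunE.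
  under eq_bigr do rewrite iter_actE ffunE.
  have ie i : (phi (iter i phi A) == iter i phi A) = (phi A == A).
    by rewrite -iterS iterSr; elim: i => //= i <-; rewrite (inj_eq phi_inj).
  under eq_bigr do rewrite ie.
  case: ifPn => [e|ne]; first by rewrite sumr_const card_ord mul0rn add0r.
  by rewrite (sum_froot p_prime phi_inj phip) ?addr0.
have ce (A : {set T}) : \sum_(j < p) c (iter j phi A) = 0.
  have := congr1 (fun u : chain T => u A) c0; rewrite smithF ffunE sum_ffunE => e.
  by rewrite -[RHS]e; apply: eq_bigr => i _; rewrite iter_actE.
pose z : chain T := [ffun A : {set T} => if phi A == A then 0 else
  \sum_(j < oidx phi A) c (iter j phi A)].
exists z, w; split=> //.
  move=> A; rewrite ffunE; case: ifP => [_|_]; first by rewrite eqxx.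
  move=> h; have [j nj] : exists j : 'I_(oidx phi A), c (iter j phi A) != 0.
    apply/existsP; apply: contraNT h; rewrite negb_exists => /forallP h.
    by rewrite big1 // => j _; apply/eqP; rewrite -[_ == _]negbK.
  have := cK _ nj; elim: (nat_of_ord j) => //= i IH [KA cA]; apply: IH.
  by rewrite -fK -(card_imset _ f_inj).
apply/ffunP => A; rewrite smithT !ffunE -/(phi A) (inj_eq phi_inj).
case: ifPn => [e|ne]; first by rewrite subrr add0r.
by rewrite addr0 (sum_oidx p_prime phi_inj phip).
Qed.

(* The connecting homomorphisms of Smith theory, iterated: [c] is reached from *)
(* [v], a chain of fixed simplices, by alternating [op] and the boundary.      *)
Fixpoint desc (n : nat) (b : bool) (q : nat) (c v : chain T) : Prop :=
  if n is n'.+1 then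
    exists z, [/\ inC K q z, c = op (~~ b) z & desc n' (~~ b) q.-1 (lin (bd rk) z) v]
  else exists z, [/\ inC K q z, inC Kf q v & c = op (~~ b) z + v].

Lemma fixset_dclosed : dclosed Kf.
Proof.
move=> A B /fixsetP[KA h] /[dup] sBA /subsetP sB; apply/fixsetP; split.
  exact: dK KA sBA.
by move=> x /sB/h.
Qed.

Lemma inC_bd q c : inC K q c -> inC K q.-1 (lin (bd rk) c).
Proof. by case: q => [/bd0->|q /bdD]; [apply: inC0|apply]. Qed.

(* The boundary of a fixed chain is fixed, whereas the image of an operator   *)
(* [op b] has no component on fixed simplices.                                *)
Lemma smith_bd_split b q z w : inC K q z -> inC Kf q w ->
  lin (bd rk) (op b z + w) = 0 -> lin (bd rk) w = 0 /\ op b (lin (bd rk) z) = 0.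
Proof.
case: q => [|q] zK wK; first by rewrite (bd0 _ wK) (bd0 _ zK) linear0.
rewrite linearD /= -smith_bd addrC => /eqP; rewrite addr_eq0 => /eqP ew.
have wK' := bdD (rk := rk) fixset_dclosed wK; have zK' := bdD (rk := rk) dK zK.
have [w0] := smith_eq_fixed (inCN zK') wK' (etrans (linearN _ _) (esym ew)).
by rewrite linearN /= => /eqP; rewrite oppr_eq0 => /eqP.
Qed.

(** Write [c] as an operator applied to z plus a fixed part. While the degree exceeds the size of
    all fixed simplices the fixed part is 0, and the boundary of z is a cycle killed by the other
    operator, so the process repeats one degree lower. *)
Lemma desc_exists n b q c : (n <= q)%N ->
  (forall A, A \in Kf -> (#|A| <= q - n)%N) ->
  inC K q c -> lin (bd rk) c = 0 -> op b c = 0 ->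
  exists v, [/\ desc n b q c v, inC Kf (q - n) v & lin (bd rk) v = 0].
Proof.
elim: n b q c => [|n IH] b q c nq Kn cK zc c0; have [z [w [zK wK e]]] := smith_exact cK c0.
  exists w; rewrite subn0; split => //; first by exists z.
  by rewrite e in zc; have [] := smith_bd_split zK wK zc.
have w0 : w = 0.
  apply: inC_eq0 wK => A /Kn; move: nq; case: q {cK zK Kn} => // q _.
  by rewrite subSS ltnS => /leq_trans; apply; apply: leq_subr.
rewrite w0 addr0 in e.
case: q nq Kn cK zK {wK} => // q nq Kn cK zK.
have [||||v [dv vK zv]] := IH (~~ b) q (lin (bd rk) z) nq.
- by move=> A /Kn; rewrite subSS.
- exact: bdD.
- by apply: lin_bd_bd rK zK.
- by rewrite smith_bd -e.
by exists v; rewrite subSS; split=> //; exists z.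
Qed.

End OneComplex.
End Smith.
Arguments smith : simpl never.

(** * Equivariant chain maps along the Smith descent *)

Section Descent.
Variables (F : fieldType) (p : nat).
Hypotheses (p_prime : prime p) (charF : p \in [pchar F]).
Local Notation chain := (chain F).
Local Notation bd := (@boundary F _).
Local Notation op f := (@smith F p _ f).

Record zp_map (T T' : finType) (rk : T -> nat) (f : T -> T) (K : {set {set T}})
    (rk' : T' -> nat) (f' : T' -> T') (K' : {set {set T'}})
    (Phi : {linear chain T -> chain T'}) : Prop := ZpMap {
  zp_map_inC : forall q c, inC K q c -> inC K' q (Phi c);
  zp_map_fix : forall q c, inC (fixset f K) q c -> inC (fixset f' K') q (Phi c);
  zp_map_bd : forall q c, inC K q c -> lin (bd rk') (Phi c) = Phi (lin (bd rk) c);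
  zp_map_act : forall q c, inC K q c -> act f' (Phi c) = Phi (act f c) }.

Variables (T T' : finType) (rk : T -> nat) (rk' : T' -> nat) (f : T -> T) (f' : T' -> T').
Variables (K : {set {set T}}) (K' : {set {set T'}}).
Variable Phi : {linear chain T -> chain T'}.
Hypotheses (cK : zp_complex p rk f K) (cK' : zp_complex p rk' f' K').
Hypothesis mPhi : zp_map rk f K rk' f' K' Phi.
Local Notation Kf := (fixset f K).
Local Notation Kf' := (fixset f' K').

Let dK := zp_dclosed cK.
Let rK := zp_ranked cK.
Let dK' := zp_dclosed cK'.
Let rK' := zp_ranked cK'.

Lemma zp_map_smith b q c : inC K q c -> op f' b (Phi c) = Phi (op f b c).
Proof.
have fi := zp_inj cK; have fK := zp_stable cK; move=> hc.
have hi i : inC K q (iter i (act f) c).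
  by elim: i => //= i IH A; rewrite ffunE => /IH; rewrite fK card_imset.
case: b; first by rewrite !smithT linearB /= (zp_map_act mPhi hc).
rewrite !smithF linear_sum; apply: eq_bigr => i _.
by elim: (nat_of_ord i) => //= j ->; rewrite (zp_map_act mPhi (hi j)).
Qed.

(** The hypothesis says that [Phi c] is a boundary of an operator image plus a fixed chain; it is
    stable under one step of the descent. The two kinds of chains meet only in 0 ([smith_eq_fixed]),
    and [smith_exact] then supplies the next primitives [a'] and [b']. In the last degree no room is
    left for a fixed primitive, so [Phi v] itself is 0. *)
Lemma desc_zero n b q c v a b0 : (n <= q)%N -> desc p rk f K n b q c v ->
  inC K' q.+1 a -> inC Kf' q.+1 b0 ->
  Phi c = op f' (~~ b) (lin (bd rk') a) + lin (bd rk') b0 ->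
  (forall A, A \in Kf' -> (#|A| <= q - n)%N) -> Phi v = 0.
Proof.
elim: n b q c a b0 => [|n IH] b q c a b0 nq /= [z [zK]].
  move=> vK -> aK bK; rewrite linearD -(zp_map_smith _ zK) => e; rewrite subn0 => Kn.
  have b00 : b0 = 0 by apply: inC_eq0 bK => A /Kn; rewrite ltnS.
  have C : inC K' q (Phi z - lin (bd rk') a).
    by apply: inCB; [apply: (zp_map_inC mPhi zK) | apply: bdD].
  have [||v0 _] := @smith_eq_fixed _ _ charF _ _ _ _ cK' (~~ b) _ q _ (- Phi v) C.
  - by apply/inCN/(zp_map_fix mPhi).
  - rewrite linearB /=; move: e; rewrite b00 linear0 addr0 => <-.
    by rewrite opprD addrA subrr add0r.
  by apply/eqP; rewrite -oppr_eq0 v0.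
case: q nq zK => // q nq zK -> dz aK bK; rewrite -(zp_map_smith _ zK) => e Kn.
have C : inC K' q.+1 (Phi z - lin (bd rk') a).
  by apply: inCB; [apply: (zp_map_inC mPhi zK) | apply: bdD].
have [||e0 e1] := @smith_eq_fixed _ _ charF _ _ _ _ cK' (~~ b) _ q.+1 _ (lin (bd rk') b0) C.
  - exact: bdD (fixset_dclosed cK') bK.
  - by rewrite linearB /= e addrC addKr.
have [a' [b' [aK' bK' e']]] := smith_exact p_prime cK' C e1.
have zE : Phi z = lin (bd rk') a + (op f' (~~ ~~ b) a' + b').
  by rewrite -e' addrC subrK.
apply: (IH _ _ _ a' b' nq dz) => //.
rewrite -(zp_map_bd mPhi zK) zE !linearD /= (lin_bd_bd rK' aK) add0r.
by rewrite (smith_bd cK').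
Qed.

(** One step back up: the difference between [Phi z] and the given primitive is a cycle, hence a
    boundary. Applying the other operator removes both the operator image and the fixed chain. *)
Lemma desc_acyclic_step b q z y b0 : inC K q z ->
  acyclic F rk' K' q -> inC K' q y -> inC Kf' q b0 ->
  Phi (lin (bd rk) z) = lin (bd rk') (op f' (~~ ~~ b) y + b0) ->
  exists2 y', inC K' q.+1 y' & op f' (~~ b) (Phi z) = lin (bd rk') (op f' (~~ b) y').
Proof.
move=> zK acy yK bK e.
have C : inC K' q (Phi z - (op f' (~~ ~~ b) y + b0)).
  apply: inCB; first exact: (zp_map_inC mPhi zK).
  by apply: inCD; [apply: (smith_inC cK' yK) | apply: inC_sub bK; apply: fixset_sub].
have [|y' yK' ey] := acy _ C; first by rewrite linearB /= (zp_map_bd mPhi zK) e subrr.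
exists y' => //; rewrite -(smith_bd cK') ey linearB linearD /=.
by rewrite (smithNK p_prime cK') (smith_fixed charF cK' _ bK) addr0 subr0.
Qed.

(** Without information on the fixed part, acyclicity of the fixed complex up to degree [q] gives a
    primitive for it. This treats the degrees below the one where a descent stopped. *)
Lemma desc_acyclic0 b q c : inC K q c -> lin (bd rk) c = 0 -> op f b c = 0 ->
  (forall i, (i <= q)%N -> acyclic F rk' K' i) ->
  (forall i, (i <= q)%N -> acyclic F rk' Kf' i) ->
  exists y b0, [/\ inC K' q.+1 y, inC Kf' q.+1 b0 &
    Phi c = lin (bd rk') (op f' (~~ b) y + b0)].
Proof.
elim/ltn_ind: q b c => q IH b c hc zc c0 acy acyf.
have [z [w [zK wK e]]] := smith_exact p_prime cK hc c0.
rewrite e in zc; have [zw oz] := smith_bd_split charF cK zK wK zc.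
have [||b1 b1K eb1] := acyf q (leqnn _) (Phi w).
- exact: (zp_map_fix mPhi wK).
- by rewrite (zp_map_bd mPhi (inC_sub (@fixset_sub _ _ _) wK)) zw linear0.
have [y0 [b0 [y0K b0K e0]]] : exists y b0, [/\ inC K' q y, inC Kf' q b0 &
    Phi (lin (bd rk) z) = lin (bd rk') (op f' (~~ ~~ b) y + b0)].
  case: q {hc wK b1K} zK IH acy acyf => [|q] zK IH acy acyf.
    exists 0, 0; split; try exact: inC0.
    by rewrite (bd0 _ zK) !linear0 addr0 linear0.
  have dz := lin_bd_bd (zp_ranked cK) zK.
  apply: (IH q (ltnSn _) _ _ (inC_bd cK zK) dz oz) => i iq.
    by apply: acy; apply: leqW.
  by apply: acyf; apply: leqW.
have [y yK ey] := desc_acyclic_step zK (acy _ (leqnn _)) y0K b0K e0.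
exists y, b1; split=> //.
by rewrite e !linearD /= -ey (zp_map_smith _ zK) eb1.
Qed.

Lemma desc_acyclic n b q c v : (n <= q)%N -> desc p rk f K n b q c v -> inC K q c ->
  lin (bd rk) c = 0 -> Phi v = 0 ->
  (forall i, (i <= q)%N -> acyclic F rk' K' i) ->
  (forall i, (i < q - n)%N -> acyclic F rk' Kf' i) ->
  exists y b0, [/\ inC K' q.+1 y, inC Kf' q.+1 b0 &
    Phi c = lin (bd rk') (op f' (~~ b) y + b0)].
Proof.
elim: n b q c => [|n IH] b q c nq /= [z [zK]].
  rewrite subn0 => vK e hc zc v0 acy acyf.
  rewrite e in zc; have [zv oz] := smith_bd_split charF cK zK vK zc.
  have [y0 [b0 [y0K b0K e0]]] : exists y b0, [/\ inC K' q y, inC Kf' q b0 &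
      Phi (lin (bd rk) z) = lin (bd rk') (op f' (~~ ~~ b) y + b0)].
    case: q {nq hc vK} zK acy acyf => [|q] zK acy acyf.
      exists 0, 0; split; try exact: inC0.
      by rewrite (bd0 _ zK) !linear0 addr0 linear0.
    have dz := lin_bd_bd (zp_ranked cK) zK.
    apply: desc_acyclic0 (inC_bd cK zK) dz oz _ _ => i iq.
      by apply: acy; apply: leqW.
    by apply: acyf; rewrite ltnS.
  have [y yK ey] := desc_acyclic_step zK (acy _ (leqnn _)) y0K b0K e0.
  exists y, 0; split=> //; first exact: inC0.
  by rewrite e addr0 linearD /= v0 addr0 -ey (zp_map_smith _ zK).
case: q nq zK => // q nq zK e dz hc zc v0 acy acyf.
have [|||y0 [b0 [y0K b0K e0]]] := IH (~~ b) q _ nq dz (inC_bd cK zK) _ v0.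
- exact: lin_bd_bd (zp_ranked cK) zK.
- by move=> i iq; apply: acy; apply: leqW.
- by move=> i iq; apply: acyf; rewrite subSS.
have [y yK ey] := desc_acyclic_step zK (acy _ (leqnn _)) y0K b0K e0.
exists y, 0; split=> //; first exact: inC0.
by rewrite e addr0 -ey (zp_map_smith _ zK).
Qed.

(** In the top degree there is no acyclicity, but [c] is a norm N z. Below the top, [desc_acyclic]
    gives [Phi] of the boundary of z a primitive of the form (1 - f) y0 + b0; its difference with
    [Phi z] is a top cycle, which N kills, as it kills the primitive. *)
Lemma desc_top n q c v : (n < q)%N -> desc p rk f K n.+1 true q c v -> inC K q c ->
  Phi v = 0 ->
  (forall i, (i < q)%N -> acyclic F rk' K' i) ->
  (forall i, (i < q - n.+1)%N -> acyclic F rk' Kf' i) ->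
  (forall t, inC K' q t -> lin (bd rk') t = 0 -> op f' false t = 0) ->
  Phi c = 0.
Proof.
case: q => // q nq [z [zK /= -> dz]] hc v0 acy acyf top.
have [|||y0 [b0 [y0K b0K e0]]] := @desc_acyclic n false q _ v nq dz (inC_bd cK zK) _ v0.
- exact: lin_bd_bd (zp_ranked cK) zK.
- by move=> i iq; apply: acy; rewrite ltnS.
- by move=> i iq; apply: acyf; rewrite subSS.
have C : inC K' q.+1 (Phi z - (op f' true y0 + b0)).
  apply: inCB; first exact: (zp_map_inC mPhi zK).
  by apply: inCD; [apply: (smith_inC cK' y0K) | apply: inC_sub b0K; apply: fixset_sub].
have zC : lin (bd rk') (Phi z - (op f' true y0 + b0)) = 0.
  by rewrite linearB /= (zp_map_bd mPhi zK) e0 subrr.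
have := top _ C zC; rewrite linearB linearD /= (zp_map_smith _ zK) (smith_fixed charF cK' _ b0K).
by rewrite -[true]/(~~ false) (smithNK p_prime cK') addr0 subr0.
Qed.
End Descent.

(** * The join of boundaries of simplices and its order complex *)

Lemma card_blocks (I Q : finType) (A : {set I * Q}) :
  #|A| = (\sum_i #|[set q | (i, q) \in A]|)%N.
Proof.
rewrite -sum1_card (eq_bigr (fun i => \sum_(q | (i, q) \in A) 1)%N) => [|i _].
  by rewrite pair_big_dep /=; apply: eq_big => [[i q]|[i q] _].
by rewrite sum1dep_card.
Qed.

Section BoundaryJoin.
Variables (F : fieldType) (I Q : finType) (q0 : Q).
Variable rk : I * Q -> nat.
Hypothesis rk_inj : injective rk.
Local Notation chain := (chain F (I * Q)%type).
Local Notation delta := (@delta F (I * Q)%type).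
Local Notation bd := (@boundary F _ rk).

(** The [I]-fold join of the boundary of the simplex on [Q]: no block may be complete. *)
Definition nofull : {set {set I * Q}} :=
  [set A : {set I * Q} | [forall i, exists q, (i, q) \notin A]].

Lemma nofullP (A : {set I * Q}) :
  reflect (forall i, exists q, (i, q) \notin A) (A \in nofull).
Proof.
rewrite inE; apply: (iffP forallP) => h i; first by case/existsP: (h i) => q; exists q.
by have [q ?] := h i; apply/existsP; exists q.
Qed.

Lemma nofull_dclosed : dclosed nofull.
Proof.
move=> A B /nofullP h /subsetP sBA; apply/nofullP => i.
by have [q nq] := h i; exists q; apply: contra nq; apply: sBA.
Qed.

Lemma nofull_ranked : ranked rk nofull.
Proof. by move=> A _; apply: in2W. Qed.

(** The number of vertices of a facet, that is, one more than the dimension of the sphere. *)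
Definition sphdim := (#|I| * #|Q|.-1)%N.

Lemma nofull_block (A : {set I * Q}) i : A \in nofull ->
  (#|[set q | (i, q) \in A]| <= #|Q|.-1)%N.
Proof.
move/nofullP/(_ i) => [q nq]; rewrite -ltnS prednK; last by apply/card_gt0P; exists q0.
rewrite -cardsT; apply: proper_card; rewrite properT; apply/eqP => e.
by have : q \in [set: Q] by []; rewrite -e inE (negPf nq).
Qed.

Lemma nofull_card (A : {set I * Q}) : A \in nofull -> (#|A| <= sphdim)%N.
Proof.
move=> AK; rewrite card_blocks /sphdim -sum_nat_const.
by apply: leq_sum => i _; apply: nofull_block.
Qed.

Let v i : I * Q := (i, q0).
Let K := nofull.

Definition cone_trunc i (A : {set I * Q}) : chain :=
  if v i |: A \in K then cone_simplex F rk (v i) A else 0.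

(* [1 - (d h + h d)] for the truncated cone [h] with apex [(i, q0)]: it kills  *)
(* all simplices but those whose [i]-th block is the facet opposite to [q0],   *)
(* so the composite over all [i] leaves a single facet.                        *)
Definition retr i (A : {set I * Q}) : chain :=
  delta A - (lin bd (cone_trunc i A) + lin (cone_trunc i) (bd A)).

Let full i (A : {set I * Q}) := [forall q, ((i, q) \in A) == (q != q0)].

Let fullP i (A : {set I * Q}) : reflect (forall q, ((i, q) \in A) = (q != q0)) (full i A).
Proof. by apply: (iffP forallP) => h q; apply/eqP. Qed.

Let cone_in i (A : {set I * Q}) : A \in K -> ~~ full i A -> v i |: A \in K.
Proof.
move=> /[dup] AK /nofullP h nf; apply/nofullP => j; have [q nq] := h j.
have [->{j q nq}|nji] := eqVneq j i; last first.
  by exists q; rewrite !inE negb_or nq andbT; apply: contraNneq nji => -[->].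
have [vA|vA] := boolP (v i \in A).
  have [q nq] := h i; exists q; rewrite !inE negb_or nq andbT.
  by apply: contraNneq nq => ->.
have [q] : exists q, ((i, q) \notin A) && (q != q0).
  apply/existsP; apply: contraNT nf; rewrite negb_exists => /forallP hq.
  apply/fullP => q; have := hq q; rewrite negb_and !negbK => /orP[iq|/eqP->].
    by rewrite iq; apply/esym; apply: contraNneq vA => e; rewrite /v -e.
  by rewrite eqxx; apply/negbTE.
case/andP=> nq qq0; exists q; rewrite !inE negb_or nq andbT.
by apply: contraNneq qq0 => -[->].
Qed.

Lemma retr_eq0 i (A : {set I * Q}) : A \in K -> ~~ full i A -> retr i A = 0.
Proof.
move=> AK nf; have vAK := cone_in AK nf.
rewrite /retr {1}/cone_trunc vAK [lin (cone_trunc i) _](@eq_lin _ _ _ _ (cone_simplex F rk (v i))).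
  by rewrite coneP ?subrr //; apply: in2W.
move=> B /bd_supp[sBA _]; rewrite /cone_trunc ifT //.
exact: nofull_dclosed vAK (setUS _ sBA).
Qed.

Lemma cone_trunc_inC i q c : inC K q c -> inC K q.+1 (lin (cone_trunc i) c).
Proof.
apply: inC_lin => A AK cA; rewrite /cone_trunc; case: ifP => vA; last exact: inC0.
rewrite /cone_simplex; case: ifP => nvA; first exact: inC0.
by apply/inCZ/inC_delta => //; rewrite cardsU1 nvA cA.
Qed.

Lemma lin_retr i c :
  lin (retr i) c = c - (lin bd (lin (cone_trunc i) c) + lin (cone_trunc i) (lin bd c)).
Proof. by rewrite !lin_comp lin_add lin_opp -{2}[c]lin_deltaE lin_add. Qed.

Lemma retr_inC i q c : inC K q c -> inC K q (lin (retr i) c).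
Proof.
move=> cK; rewrite lin_retr; apply: inCB => //; apply: inCD.
  exact: (bdD nofull_dclosed (cone_trunc_inC cK)).
case: q cK => [|q] cK; first by rewrite (bd0 _ cK) linear0; apply: inC0.
by apply/cone_trunc_inC/(bdD nofull_dclosed).
Qed.

Lemma retr_bd i q c : inC K q c -> lin bd (lin (retr i) c) = lin (retr i) (lin bd c).
Proof.
move=> cK; rewrite !lin_retr linearB linearD /=.
rewrite (lin_bd_bd nofull_ranked (cone_trunc_inC cK)) add0r.
by rewrite (lin_bd_bd nofull_ranked cK) linear0 addr0.
Qed.

(** When block i of [A] is the facet opposite to the apex, the cone on [A] is truncated to 0. In the
    boundary of [A], only faces dropping a vertex of block i have a cone, and it just restores the
    apex in that block. *)
Lemma retr_supp i (A B : {set I * Q}) : A \in K -> retr i A B != 0 ->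
  full i A /\ forall j q, j != i -> ((j, q) \in B) = ((j, q) \in A).
Proof.
move=> AK nz; have [fA|nf] := boolP (full i A); last first.
  by move: nz; rewrite retr_eq0 // ffunE eqxx.
split=> // j q nji; move: nz; rewrite /retr /cone_trunc ifN; last first.
  apply/negP => /nofullP/(_ i)[q']; rewrite !inE negb_or => /andP[n1].
  rewrite (fullP _ _ fA) negbK => /eqP e; case/eqP: n1.
  by rewrite e.
rewrite linear0 add0r !ffunE.
have [-> //|_] := eqVneq B A; rewrite sub0r oppr_eq0 linE => nz.
have [C nzC] : exists C, bd A C * (if v i |: C \in K then cone_simplex F rk (v i) C else 0) B != 0.
  apply/existsP; apply: contraNT nz; rewrite negb_exists => /forallP h.
  by rewrite big1 // => C _; apply/eqP; rewrite -[_ == _]negbK.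
have /bd_supp[sCA cA] : bd A C != 0 by apply: contraNneq nzC => ->; rewrite mul0r.
move: nzC; case: ifP => [vCK|_]; last by rewrite ffunE mulr0 eqxx.
rewrite /cone_simplex; case: ifP => _; first by rewrite ffunE mulr0 eqxx.
rewrite !ffunE; have [-> _|_] := eqVneq B; last by rewrite scaler0 mulr0 eqxx.
have [[i' x] xA xC] : exists2 x, x \in A & x \notin C.
  apply/exists_inP; apply: contraT; rewrite negb_exists_in => /forall_inP h.
  have /subset_leq_card : A \subset C by apply/subsetP => x /h; rewrite negbK.
  by rewrite cA ltnn.
have eA : A = (i', x) |: C.
  apply/esym/eqP; rewrite eqEcard subUset sub1set xA sCA cardsU1 xC cA.
  by rewrite leqnn.
have ei : i' = i.
  have /nofullP/(_ i)[q'] := vCK; rewrite !inE negb_or => /andP[n1 n2].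
  have : (i, q') \in A.
    by rewrite (fullP _ _ fA); apply: contraNneq n1 => ->.
  by rewrite eA !inE (negPf n2) orbF => /eqP[->].
rewrite eA !inE ei; congr (_ || _).
by rewrite !xpair_eqE (negPf nji).
Qed.

Definition retrs (s : seq I) (c : chain) := foldr (fun i c => lin (retr i) c) c s.

Lemma retrs_inC s q c : inC K q c -> inC K q (retrs s c).
Proof. by move=> cK; elim: s => //= i s IH; apply: retr_inC. Qed.

Lemma retrs_bd s q c : inC K q c -> lin bd (retrs s c) = retrs s (lin bd c).
Proof. by move=> cK; elim: s => //= i s <-; apply: retr_bd; apply: retrs_inC cK. Qed.

Lemma retrs_homologous s q c : inC K q c -> lin bd c = 0 ->
  exists2 b, inC K q.+1 b & c - retrs s c = lin bd b.
Proof.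
move=> cK zc; elim: s => [|i s [b bK e]] /=.
  by exists 0; [exact: inC0 | rewrite subrr linear0].
exists (b + lin (cone_trunc i) (retrs s c)).
  by apply: inCD => //; apply: cone_trunc_inC; apply: retrs_inC.
rewrite lin_retr (retrs_bd s cK) zc [in RHS]linearD /= -e.
have -> : retrs s 0 = 0 by elim: (s) => //= j t ->; rewrite linear0.
by rewrite linear0 addr0 opprB addrA addrAC.
Qed.

Lemma retrs_supp s q c B : inC K q c -> retrs s c B != 0 ->
  exists A, [/\ c A != 0, {in s, forall i, full i A} &
    forall j q, j \notin s -> ((j, q) \in B) = ((j, q) \in A)].
Proof.
move=> cK; elim: s B => [|i s IH] B /=; first by exists B.
rewrite linE => nz.
have [C nzC] : exists C, retrs s c C * retr i C B != 0.
  apply/existsP; apply: contraNT nz; rewrite negb_exists => /forallP h.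
  by rewrite big1 // => C _; apply/eqP; rewrite -[_ == _]negbK.
have nz1 : retrs s c C != 0 by apply: contraNneq nzC => ->; rewrite mul0r.
have nz2 : retr i C B != 0 by apply: contraNneq nzC => ->; rewrite mulr0.
have [CK _] := retrs_inC cK nz1.
have [fC hB] := retr_supp CK nz2; have [A [nA fA hC]] := IH _ nz1.
exists A; split=> // [j|j x].
  rewrite inE => /predU1P[->|/fA//].
  have [/fA//|nis] := boolP (i \in s).
  by apply/fullP => x; rewrite -hC // (fullP _ _ fC).
by rewrite inE negb_or => /andP[nji njs]; rewrite hB // hC.
Qed.

Definition base_facet : {set I * Q} := [set x | x.2 != q0].

Lemma base_facet_full (A : {set I * Q}) : (forall i, full i A) -> A = base_facet.
Proof. by move=> h; apply/setP => -[i q]; rewrite inE (fullP _ _ (h i)). Qed.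

Lemma base_facet_in : base_facet \in K.
Proof. by apply/nofullP => i; exists q0; rewrite inE eqxx. Qed.

Lemma base_facet_card : #|base_facet| = sphdim.
Proof.
rewrite card_blocks /sphdim -sum_nat_const; apply: eq_bigr => i _.
rewrite (_ : [set q | _] = [set~ q0]) ?cardsC1 //.
by apply/setP => q; rewrite !inE.
Qed.

Lemma retrs_enum q c B : inC K q c -> retrs (enum I) c B != 0 ->
  c base_facet != 0 /\ q = sphdim.
Proof.
move=> cK /(retrs_supp cK)[A [nA fA _]].
have eA : A = base_facet by apply: base_facet_full => i; apply: fA; rewrite mem_enum.
by rewrite -eA -base_facet_card; split=> //; have [_ <-] := cK _ nA; rewrite eA.
Qed.

(** The composite of all retractions is homotopic to the identity and kills every simplex but one
    facet, of degree [sphdim]. *)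
Lemma nofull_acyclic q : (q < sphdim)%N -> acyclic F rk K q.
Proof.
move=> ltq c cK zc; have [b bK e] := retrs_homologous (enum I) cK zc.
exists b; rewrite // -e (_ : retrs _ c = 0) ?subr0 //.
apply/ffunP => B; rewrite [RHS]ffunE; apply/eqP; apply: contraLR ltq => nz.
by have [_ ->] := retrs_enum cK nz; rewrite ltnn.
Qed.

(** In the top degree the homotopy vanishes, so a cycle equals its retraction, which depends only on
    its coefficient at [base_facet]. *)
Lemma nofull_top c : inC K sphdim c -> lin bd c = 0 -> c base_facet = 0 -> c = 0.
Proof.
move=> cK zc c0; have [b bK e] := retrs_homologous (enum I) cK zc.
have b0 : b = 0 by apply: inC_eq0 bK => A /nofull_card; rewrite ltnS.
move/eqP: e; rewrite b0 linear0 subr_eq0 => /eqP->.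
apply/ffunP => B; rewrite [RHS]ffunE; apply/eqP; apply: contraT => nz.
by have [] := retrs_enum cK nz; rewrite c0 eqxx.
Qed.

Lemma retr_base i q c : inC K q c -> lin (retr i) c base_facet = c base_facet.
Proof.
move=> cK; rewrite linE -{2}[c]lin_deltaE linE; apply: eq_bigr => A _.
have [->|/cK[AK _]] := eqVneq (c A) 0; first by rewrite !mul0r.
have vbase : v i \notin base_facet by rewrite inE eqxx.
have [fA|nf] := boolP (full i A); last first.
  rewrite retr_eq0 // !ffunE; case: eqP => // e.
  by case/negP: nf; apply/fullP => x; rewrite -e inE.
congr (_ * _); rewrite /retr {1}/cone_trunc ifN; last first.
  apply/negP => /nofullP/(_ i)[x]; rewrite !inE negb_or => /andP[n1].
  rewrite (fullP _ _ fA) negbK => /eqP e; case/eqP: n1.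
  by rewrite e.
rewrite linear0 add0r !ffunE linE big1 ?subr0 // => B _.
rewrite /cone_trunc; case: ifP => _; last by rewrite ffunE mulr0.
rewrite /cone_simplex; case: ifP => _; first by rewrite ffunE mulr0.
rewrite !ffunE; case: eqP => [e|_]; last by rewrite scaler0 mulr0.
by case/negP: vbase; rewrite e setU11.
Qed.

Lemma nofull_fundamental : (0 < sphdim)%N ->
  exists s, [/\ inC K sphdim s, lin bd s = 0 & s base_facet = 1].
Proof.
move=> m0; have dK : inC K sphdim (delta base_facet).
  by apply: inC_delta; rewrite ?base_facet_in ?base_facet_card.
exists (retrs (enum I) (delta base_facet)); split.
- exact: retrs_inC.
- rewrite (retrs_bd _ dK); apply/ffunP => B; rewrite [RHS]ffunE; apply/eqP.
  apply: contraT => nz; have bK : inC K sphdim.-1 (lin bd (delta base_facet)).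
    by apply: (bdD nofull_dclosed); rewrite prednK.
  have [_ e] := retrs_enum bK nz.
  by case: (sphdim) m0 e => // m _ /n_Sn.
elim: (enum I) => [|i s IH] /=; first by rewrite ffunE eqxx.
by rewrite (retr_base i (retrs_inC dK)).
Qed.

End BoundaryJoin.

(** * The homology of the order complex *)

Section OrderComplex.
Variable F : fieldType.
Local Notation chain := (chain F).
Local Notation delta := (@delta F _).
Local Notation bd := (@boundary F _).
Local Notation sd := (@sd F _).
Local Notation push := (@push_simplex F _ _).

Lemma cover_flag (T : finType) (K : {set {set T}}) t :
  t \in flags K -> t != set0 -> cover t \in t.
Proof.
move=> /flagsP[_ h] /set0Pn[A0 A0t].
have [A At maxA] := arg_maxnP (fun A : {set T} => #|A|) A0t.
suff -> : cover t = A by [].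
apply/eqP; rewrite eqEsubset (bigcup_sup A) // andbT; apply/bigcupsP => B Bt.
case/orP: (h A B At Bt) => // sAB.
by rewrite (_ : B = A) //; apply/esym/eqP; rewrite eqEcard sAB; apply: maxA.
Qed.

Lemma cover_flag_in (T : finType) (K : {set {set T}}) t :
  set0 \in K -> t \in flags K -> cover t \in K.
Proof.
move=> K0 tK; have [->|nt] := eqVneq t set0; first by rewrite /cover big_set0.
by have /flagsP[h _] := tK; have [] := h _ (cover_flag tK nt).
Qed.

Lemma flags_cover (T : finType) (K : {set {set T}}) t :
  t \in flags K -> t \in flags (powerset (cover t)).
Proof.
move=> /flagsP[h1 h2]; apply/flagsP; split=> // A At; have [_ nA] := h1 A At.
by rewrite powersetE (bigcup_sup A).
Qed.

Lemma cover_neq0 (T : finType) (K : {set {set T}}) t :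
  t \in flags K -> t != set0 -> cover t != set0.
Proof.
by move=> tK nt; have /flagsP[h _] := tK; have [] := h _ (cover_flag tK nt).
Qed.

Lemma coverS (T : finType) (t u : {set {set T}}) : t \subset u -> cover t \subset cover u.
Proof.
move=> /subsetP s; apply/bigcupsP => A /s Au; exact: (bigcup_sup A).
Qed.

Section MaxVertex.
Variables (T : finType) (rk : T -> nat) (K : {set {set T}}) (t0 : T).
Hypotheses (rk_inj : injective rk) (dK : dclosed K) (K0 : set0 \in K).

(* Sending a simplex to its top vertex approximates the identity.             *)
Definition maxv (A : {set T}) : T :=
  if [pick x in A] is Some x then [arg max_(y > x in A) rk y] else t0.

Lemma maxvP (A : {set T}) : A != set0 ->
  maxv A \in A /\ (forall x, x \in A -> (rk x <= rk (maxv A))%N).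
Proof.
rewrite /maxv; case: pickP => [x xA _|A0 /set0Pn[x]]; last by rewrite A0.
by case: arg_maxnP.
Qed.

Lemma maxv_imset t : t \in flags K -> maxv @: t \subset cover t.
Proof.
move=> /flagsP[h _]; apply/subsetP => _ /imsetP[A At ->].
by apply/bigcupP; exists A => //; have [_ /maxvP[]] := h A At.
Qed.

Lemma push_maxv_bd t : t \in flags K ->
  lin (bd rk) (push maxv t) = lin (push maxv) (bd (@crk T) t).
Proof.
move=> tK; apply: push_bd; [exact: flags_ranked tK | exact: in2W |].
have /flagsP[h1 h2] := tK; move=> A B At Bt ltAB.
have [_ nA] := h1 A At; have [_ nB] := h1 B Bt.
have [m1 _] := maxvP nA; have [_ m2] := maxvP nB; apply: m2.
case/orP: (h2 A B At Bt) => [/subsetP->//|/subset_leq_card].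
by rewrite leqNgt [X in ~~ X]ltAB.
Qed.

Lemma push_maxv_inC q c : inC (flags K) q c -> inC K q (lin (push maxv) c).
Proof.
apply: inC_lin => t tK <-; apply: push_inC.
exact: dK (cover_flag_in K0 tK) (maxv_imset tK).
Qed.

(** The identity and [sd] after [maxv] are both carried by the subdivided simplex on the largest
    member of a flag, which is a cone. *)
Lemma maxv_homotopy : exists2 E : {set {set T}} -> chain {set T},
  (forall q c, inC (flags K) q c -> inC (flags K) q.+1 (lin E c)) &
  (forall q c, inC (flags K) q c ->
    lin (bd (@crk T)) (lin E c) + lin E (lin (bd (@crk T)) c) =
    c - lin (sd rk) (lin (push maxv) c)).
Proof.
pose Car (t : {set {set T}}) := flags (powerset (cover t)).
pose alpha (t : {set {set T}}) := delta t - lin (sd rk) (push maxv t).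
have linalpha c : lin alpha c = c - lin (sd rk) (lin (push maxv) c).
  by rewrite -{2}[c]lin_deltaE lin_comp lin_opp lin_add.
have CarK t : t \in flags K -> {subset Car t <= flags K}.
  move=> tK; apply: flags_sub => A; rewrite powersetE.
  exact: dK (cover_flag_in K0 tK).
have aC t : t \in flags K -> inC (Car t) #|t| (alpha t).
  move=> tK; apply: inCB; first by apply: inC_delta => //; apply: flags_cover tK.
  rewrite /push_simplex; case: eqP => [e|_]; last by rewrite linear0; apply: inC0.
  rewrite lin_delta -e; apply: inC_sub (@sd_inC _ _ _ _).
  exact/flags_powersetS/maxv_imset.
have [||||||||E E1 E2] := @homotopy F _ _ (@crk T) (@crk T) (flags K) Car alpha.
- exact: flags_dclosed.
- exact: flags_ranked.
- by move=> t _; apply: flags_ranked.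
- by move=> t u _ stu; apply/flags_powersetS/coverS.
- exact: aC.
- move=> t tK; rewrite linalpha /alpha linearB /= lin_delta; congr (_ - _).
  rewrite (@lin_sd_bd _ _ _ K #|t|) ?push_maxv_bd //; first by move=> A _; apply: in2W.
  by rewrite -[push _ _]lin_delta; apply/push_maxv_inC/inC_delta.
- move=> t tK nt; apply: (@cone_acyclic _ _ _ _ (cover t)); first exact: flags_ranked.
  by move=> u; apply: flags_apex; apply: cover_neq0 tK nt.
- exists 0; first exact: inC0.
  by rewrite linear0 /alpha /push_simplex imset0 !cards0 eqxx lin_delta sd0 subrr.
exists E => q c cK.
  by apply: inC_lin cK => t tK <-; apply: inC_sub (E1 t tK); apply: CarK.
rewrite -linalpha !lin_comp lin_add; apply: (eq_lin_inC cK) => t tK _.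
exact: E2.
Qed.

Lemma flags_acyclic q : acyclic F rk K q -> acyclic F (@crk T) (flags K) q.
Proof.
move=> acy c cK zc; have [E E1 E2] := maxv_homotopy.
have rK : ranked (@crk T) (flags K) by apply: flags_ranked.
have zp : lin (bd rk) (lin (push maxv) c) = 0.
  rewrite lin_comp (eq_lin_inC cK (g := fun t => lin (push maxv) (bd (@crk T) t))).
    by rewrite -lin_comp zc linear0.
  by move=> t tK _; apply: push_maxv_bd.
have [b bK eb] := acy _ (push_maxv_inC cK) zp.
exists (lin E c + lin (sd rk) b); first by apply: inCD; [apply: E1 | apply: lin_sd_inC].
rewrite linearD /= (lin_sd_bd _ bK); last by move=> A _; apply: in2W.
have := E2 _ _ cK; rewrite zc linear0 addr0 => ->.
by rewrite eb subrK.
Qed.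

(** In the top degree the homotopy has no room, so a cycle is exactly the subdivision of a cycle of
    [K]. *)
Lemma flags_top m c : (forall A, A \in K -> (#|A| <= m)%N) ->
  inC (flags K) m c -> lin (bd (@crk T)) c = 0 ->
  [/\ inC K m (lin (push maxv) c), lin (bd rk) (lin (push maxv) c) = 0 &
      c = lin (sd rk) (lin (push maxv) c)].
Proof.
move=> Km cK zc; have [E E1 E2] := maxv_homotopy; split.
- exact: push_maxv_inC.
- rewrite lin_comp (eq_lin_inC cK (g := fun t => lin (push maxv) (bd (@crk T) t))).
    by rewrite -lin_comp zc linear0.
  by move=> t tK _; apply: push_maxv_bd.
have E0 : lin E c = 0.
  apply: inC_eq0 (E1 _ _ cK) => t /(@flags_card _ _ 1 m); rewrite ltnS; apply => //.
  by move=> A /Km; rewrite dvd1n muln1.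
have := E2 _ _ cK; rewrite zc linear0 addr0 E0 linear0 => /eqP.
by rewrite eq_sym subr_eq0 => /eqP.
Qed.

End MaxVertex.

Definition onedim (T : finType) (rk : T -> nat) (K : {set {set T}}) m :=
  exists s : chain T, forall t, inC K m t -> lin (bd rk) t = 0 -> exists l, t = l *: s.

Section Retract.
Variables (T1 T2 : finType) (rk1 : T1 -> nat) (rk2 : T2 -> nat).
Variables (K1 : {set {set T1}}) (K2 : {set {set T2}}) (a : T1 -> T2) (b : T2 -> T1).
Hypotheses (rK1 : ranked rk1 K1) (rK2 : ranked rk2 K2).
Hypothesis aK : forall A : {set T1}, A \in K1 -> a @: A \in K2.
Hypothesis bK : forall A : {set T2}, A \in K2 -> b @: A \in K1.
Hypothesis baK : forall A : {set T1}, A \in K1 -> {in A, forall x, b (a x) = x}.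
Hypothesis a_mono : forall A : {set T1}, A \in K1 ->
  {in A &, forall x y, (rk1 x < rk1 y)%N -> (rk2 (a x) <= rk2 (a y))%N}.
Hypothesis b_mono : forall A : {set T2}, A \in K2 ->
  {in A &, forall x y, (rk2 x < rk2 y)%N -> (rk1 (b x) <= rk1 (b y))%N}.

Let a_bd q c : inC K1 q c -> lin (bd rk2) (lin (push a) c) = lin (push a) (lin (bd rk1) c).
Proof.
move=> cK; rewrite !lin_comp; apply: (eq_lin_inC cK) => A AK _.
by apply: push_bd; [apply: rK1|apply/rK2/aK|apply: a_mono].
Qed.

Let b_bd q c : inC K2 q c -> lin (bd rk1) (lin (push b) c) = lin (push b) (lin (bd rk2) c).
Proof.
move=> cK; rewrite !lin_comp; apply: (eq_lin_inC cK) => A AK _.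
by apply: push_bd; [apply: rK2|apply/rK1/bK|apply: b_mono].
Qed.

Let a_inC q c : inC K1 q c -> inC K2 q (lin (push a) c).
Proof. by apply: inC_lin => A AK <-; apply/push_inC/aK. Qed.

Let b_inC q c : inC K2 q c -> inC K1 q (lin (push b) c).
Proof. by apply: inC_lin => A AK <-; apply/push_inC/bK. Qed.

Let ba_id q c : inC K1 q c -> lin (push b) (lin (push a) c) = c.
Proof.
move=> cK; rewrite lin_comp -[RHS]lin_deltaE; apply: (eq_lin_inC cK) => A AK _.
by rewrite push_comp push_id // => x xA; apply: baK xA.
Qed.

Lemma retract_acyclic q : acyclic F rk2 K2 q -> acyclic F rk1 K1 q.
Proof.
move=> acy c cK zc; have [||d dK ed] := acy (lin (push a) c).
- exact: a_inC.
- by rewrite (a_bd cK) zc linear0.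
by exists (lin (push b) d); [exact: b_inC | rewrite (b_bd dK) ed (ba_id cK)].
Qed.

Lemma retract_onedim m : onedim rk2 K2 m -> onedim rk1 K1 m.
Proof.
move=> [s hs]; exists (lin (push b) s) => t tK zt.
have [||l el] := hs (lin (push a) t).
- exact: a_inC.
- by rewrite (a_bd tK) zt linear0.
by exists l; rewrite -[t in LHS](ba_id tK) el linearZ.
Qed.

End Retract.

Section OneDim.
Variable p : nat.
Hypotheses (p_prime : prime p) (charF : p \in [pchar F]).
Variables (T : finType) (rk : T -> nat) (f : T -> T) (K : {set {set T}}).
Hypothesis hK : zp_complex p rk f K.

(** The generator acts on a line by a scalar n with n^p = 1, and 1 is the only p-th root of unity in
    characteristic p. *)
Lemma onedim_act m t : onedim rk K m -> inC K m t -> lin (bd rk) t = 0 -> act f t = t.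
Proof.
move=> [s hs] tK zt; have [l el] := hs t tK zt.
have aK : inC K m (act f t).
  by move=> A; rewrite ffunE => /tK; rewrite (zp_stable hK) card_imset //; apply: zp_inj hK.
have za : lin (bd rk) (act f t) = 0.
  by rewrite -act_bd ?zt ?linear0 //; [apply: zp_inj hK | apply: zp_rk hK].
have [m1 em] := hs _ aK za.
have [l0|nl] := eqVneq l 0; first by rewrite el l0 scale0r linear0.
pose n := m1 / l; have en : act f t = n *: t.
  by rewrite em el scalerA divfK.
have [->|nt] := eqVneq t 0; first by rewrite linear0.
have it i : iter i (act f) t = n ^+ i *: t.
  elim: i => [|i IH]; first by rewrite expr0 scale1r.
  by rewrite /= IH linearZ /= en scalerA exprSr.
have := it p; rewrite (iterp_act hK) => e.
have np : n ^+ p = 1.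
  apply/eqP; rewrite -subr_eq0; have : (n ^+ p - 1) *: t = 0.
    by rewrite scalerBl scale1r -e subrr.
  by move/eqP; rewrite scaler_eq0 (negPf nt) orbF.
(* Frobenius: (n - 1)^p = n^p - 1. *)
have : (n - 1) ^+ p = 0.
  by rewrite -!(pFrobenius_autE charF) pFrobenius_autB_comm ?pFrobenius_aut1 ?pFrobenius_autE ?np ?subrr //; apply: mulrC.
by move/eqP; rewrite expf_eq0 subr_eq0 => /andP[_ /eqP n1]; rewrite en n1 scale1r.
Qed.

Lemma onedim_norm m t : onedim rk K m -> inC K m t -> lin (bd rk) t = 0 ->
  smith p f false t = 0.
Proof.
move=> hs tK zt; have at_ := onedim_act hs tK zt.
rewrite smithF; have it i : iter i (act f) t = t by elim: i => //= i ->.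
under eq_bigr do rewrite it.
by rewrite sumr_const card_ord -scaler_nat (pcharf0 charF) scale0r.
Qed.

End OneDim.
End OrderComplex.

(** * Descent through the fixed complexes of successive generators *)

Section Tower.
Variables (F : fieldType) (p k : nat).
Hypotheses (p_prime : prime p) (charF : p \in [pchar F]).
Local Notation chain := (chain F).
Local Notation bd := (@boundary F _).
Local Notation delta := (@delta F _).

Fixpoint tower (T : finType) (g : nat -> T -> T) (K : {set {set T}}) (i : nat) :=
  if i is i'.+1 then fixset (g i') (tower g K i') else K.

Lemma towerP (T : finType) (g : nat -> T -> T) (K : {set {set T}}) i (A : {set T}) :
  reflect (A \in K /\ forall j x, (j < i)%N -> x \in A -> g j x = x) (A \in tower g K i).
Proof.
elim: i => [|i IH] /=; first by apply: (iffP idP) => [|[]].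
apply: (iffP (@fixsetP _ _ _ _)) => [[/IH[KA h1] h2]|[KA h]].
  split=> // j x; rewrite ltnS leq_eqVlt => /predU1P[->|]; [exact: h2 | exact: h1].
split; last by move=> x; apply: h.
by apply/IH; split=> // j x ji; apply: h; apply: leqW.
Qed.

Section OneTower.
Variables (T : finType) (rk : T -> nat) (g : nat -> T -> T) (K : {set {set T}}).
Hypothesis cK : forall i, (i < k)%N -> zp_complex p rk (g i) K.
Hypothesis gC : forall i j x, g i (g j x) = g j (g i x).

(** The generators commute, so each of them still acts on the flags fixed by the earlier ones. *)
Lemma tower_zp i j : (i < k)%N -> zp_complex p rk (g i) (tower g K j).
Proof.
move=> ik; have [dK rK inj iter_p rkg st] := cK ik; split=> //.
- move=> A B /towerP[KA h] /[dup] sBA /subsetP sB; apply/towerP.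
  split=> [|l x lj /sB]; [exact: dK KA sBA | exact: h].
- by move=> A /towerP[/rK].
move=> A; apply/towerP/towerP; rewrite st => -[KA h]; split=> // l x lj xA.
  by apply: inj; rewrite gC h // imset_f.
by case/imsetP: xA => y yA ->; rewrite gC; congr (g i _); apply: h yA.
Qed.

End OneTower.

Variables (T T' : finType) (rk : T -> nat) (rk' : T' -> nat).
Variables (g : nat -> T -> T) (g' : nat -> T' -> T').
Variables (Y : {set {set T}}) (S : {set {set T'}}) (m : nat -> nat).
Hypothesis cY : forall i, (i < k)%N -> zp_complex p rk (g i) Y.
Hypothesis cS : forall i, (i < k)%N -> zp_complex p rk' (g' i) S.
Hypothesis gC : forall i j x, g i (g j x) = g j (g i x).
Hypothesis gC' : forall i j x, g' i (g' j x) = g' j (g' i x).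
Hypothesis mlt : forall i, (i < k)%N -> (m i.+1 < m i)%N.
Hypothesis mk : m k = 0%N.
Hypothesis Ym : forall i A, (i <= k)%N -> A \in tower g Y i -> (#|A| <= m i)%N.
Hypothesis Sm : forall i A, (i <= k)%N -> A \in tower g' S i -> (#|A| <= m i)%N.
Hypothesis Sacyclic : forall i q, (i <= k)%N -> (q < m i)%N ->
  acyclic F rk' (tower g' S i) q.
Hypothesis Sonedim : forall i, (i < k)%N -> onedim F rk' (tower g' S i) (m i).

Record tower_map (Phi : {linear chain T -> chain T'}) : Prop := TowerMap {
  tower_inC : forall i q c, (i <= k)%N -> inC (tower g Y i) q c ->
    inC (tower g' S i) q (Phi c);
  tower_bd : forall q c, inC Y q c -> lin (bd rk') (Phi c) = Phi (lin (bd rk) c);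
  tower_act : forall i q c, (i < k)%N -> inC Y q c -> act (g' i) (Phi c) = Phi (act (g i) c) }.

Let tower_sub i : {subset tower g Y i <= Y}.
Proof. by move=> A /towerP[]. Qed.

Lemma tower_zp_map Phi i : tower_map Phi -> (i < k)%N ->
  zp_map rk (g i) (tower g Y i) rk' (g' i) (tower g' S i) Phi.
Proof.
move=> [h1 h2 h3] ik; split.
- by move=> q c; apply: h1; apply: ltnW.
- by move=> q c; apply: (h1 i.+1).
- by move=> q c cK; apply: (h2 q); apply: inC_sub cK; apply: tower_sub.
by move=> q c cK; apply: (h3 i q) => //; apply: inC_sub cK; apply: tower_sub.
Qed.

(** Invariance under [g j] is the vanishing of 1 - [g j]. Viewed as an equivariant chain map, the
    latter is subject to [desc_zero], so invariance is inherited along the descent. *)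
Let diff (f : T -> T) : {linear chain T -> chain T} :=
  lin (fun A => delta A - act f (delta A)).

Let diffE f c : diff f c = c - act f c.
Proof.
rewrite /diff /= -lin_add lin_deltaE; congr (_ + _).
rewrite -lin_opp; congr (- _); rewrite -[in RHS](lin_deltaE c) /lin linear_sum.
by apply: eq_bigr => A _; rewrite linearZ.
Qed.

Lemma diff_zp_map i j : (i < k)%N -> (j < k)%N ->
  zp_map rk (g i) (tower g Y i) rk (g i) (tower g Y i) (diff (g j)).
Proof.
move=> ik jk.
have inA l q c : inC (tower g Y l) q c -> inC (tower g Y l) q (diff (g j) c).
  have hl := @tower_zp T rk g Y cY gC j l jk; move=> cK; rewrite diffE; apply: inCB => // A.
  by rewrite ffunE => /cK; rewrite (zp_stable hl) card_imset //; apply: zp_inj hl.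
split.
- by move=> q c; apply: inA.
- by move=> q c; apply: (inA i.+1).
- move=> q c _; rewrite !diffE linearB /= act_bd //; first exact: zp_inj (cY jk).
  exact: zp_rk (cY jk).
move=> q c _; rewrite !diffE linearB /=; congr (_ - _).
apply/ffunP => A; rewrite !ffunE -!imset_comp; congr (c _).
by apply: eq_imset => x /=.
Qed.

(* Smith descent turns [y] into cycles of the successive stages; [Phi] keeps   *)
(* vanishing on them, and the multiple of the empty simplex reached at stage   *)
(* [k] must then be 0. Going back up, acyclicity of the stages of [S] below    *)
(* the top degree propagates [Psi v = 0].                                      *)
Theorem tower_zero (Phi Psi : {linear chain T -> chain T'}) (y : chain T) :
  tower_map Phi -> tower_map Psi -> Phi (delta set0) = delta set0 ->
  inC Y (m 0) y -> lin (bd rk) y = 0 -> (forall i, (i < k)%N -> act (g i) y = y) ->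
  Phi y = 0 -> Psi y = 0.
Proof.
move=> mPhi mPsi Phi0 yY zy gy Py0.
suff step i : (i <= k)%N -> exists v, [/\ inC (tower g Y i) (m i) v, lin (bd rk) v = 0,
    forall j, (j < k)%N -> act (g j) v = v, Phi v = 0 & Psi v = 0 -> Psi y = 0].
  have [v [vK _ _ Pv0 up]] := step k (leqnn k); apply: up; rewrite mk in vK; have ev : v = v set0 *: delta set0.
    apply/ffunP => A; rewrite !ffunE; have [->|nA] := eqVneq A set0.
      exact/esym/mulr1.
    rewrite scaler0; apply/eqP; apply: contraT => /vK[_ /eqP].
    by rewrite cards_eq0 (negPf nA).
  have : v set0 = 0.
    have e1 : Phi v = v set0 *: delta set0 by rewrite [in LHS]ev linearZ /= Phi0.
    have := congr1 (fun u : chain T' => u set0) Pv0.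
    rewrite e1 !ffunE eqxx => <-; exact/esym/mulr1.
  move=> v0; rewrite ev v0 scale0r linear0 //.
elim: i => [|i IH] ik; first by exists y.
have [v [vK zv gv Pv0 up]] := IH (ltnW ik).
have hi := @tower_zp T rk g Y cY gC i i ik; have hi' := @tower_zp T' rk' g' S cS gC' i i ik.
have [n en] : exists n, (m i - m i.+1 = n.+1)%N.
  by exists (m i - m i.+1).-1; rewrite prednK // subn_gt0 mlt.
have nm : (n.+1 <= m i)%N by rewrite -en leq_subr.
have em : (m i - n.+1 = m i.+1)%N by rewrite -en subKn // ltnW // mlt.
have ov : smith p (g i) true v = 0 by rewrite smithT (gv i ik) subrr.
have [|v' [dv vK' zv']] := desc_exists p_prime charF hi nm _ vK zv ov.
  by move=> A; rewrite em; apply: (@Ym i.+1 A ik).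
rewrite em in vK'.
(* This starts [desc_zero] with zero primitives; it serves both for [Phi] and for the maps 1 -
   [g j]. *)
have zero (T1 : finType) (rk1 : T1 -> nat) f1 K1 (Th : {linear chain T -> chain T1}) :
    zp_complex p rk1 f1 K1 -> zp_map rk (g i) (tower g Y i) rk1 f1 K1 Th ->
    (forall A, A \in fixset f1 K1 -> (#|A| <= m i.+1)%N) -> Th v = 0 -> Th v' = 0.
  move=> h1 hm Km Th0; apply: (desc_zero p_prime charF hi h1 hm nm dv (inC0 _ _) (inC0 _ _)).
    by rewrite !linear0 addr0.
  by rewrite em.
exists v'; split=> //.
- move=> j jk; apply/eqP; rewrite eq_sym -subr_eq0 -diffE; apply/eqP.
  apply: (zero _ _ _ _ _ hi (diff_zp_map ik jk)); last by rewrite diffE (gv j jk) subrr.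
  by move=> A; apply: (@Ym i.+1 A ik).
- apply: (zero _ _ _ _ _ hi' (tower_zp_map mPhi ik)) => //.
  by move=> A; apply: (@Sm i.+1 A ik).
move=> Pv'; apply: up.
apply: (desc_top p_prime charF hi hi' (tower_zp_map mPsi ik) nm dv vK Pv').
- by move=> q; apply: Sacyclic; apply: ltnW.
- by move=> q; rewrite em; apply: (Sacyclic (i := i.+1)).
by move=> t; apply: (onedim_norm charF hi' (Sonedim ik)).
Qed.

End Tower.

Section NofullFlags.
Variables (F : fieldType) (I Q : finType) (q0 : Q).
Local Notation K := (nofull I Q).
Let rk (x : I * Q) : nat := enum_rank x.

Let rk_inj : injective rk.
Proof. by move=> x y /val_inj/enum_rank_inj. Qed.

Lemma nofull0 : set0 \in K.
Proof. by apply/nofullP => i; exists q0; rewrite inE. Qed.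

Lemma flags_nofull_card t : t \in flags K -> (#|t| <= sphdim I Q)%N.
Proof.
apply: (@flags_card _ _ 1) => // A AK; rewrite dvd1n muln1; split=> //.
exact: nofull_card AK.
Qed.

Lemma flags_nofull_acyclic (i0 : I) q : (q < sphdim I Q)%N ->
  acyclic F (@crk _) (flags K) q.
Proof.
move=> ltq; apply: (@flags_acyclic F _ rk K (i0, q0)) => //.
- exact: nofull_dclosed.
- exact: nofull0.
exact: (@nofull_acyclic F _ _ q0 rk).
Qed.

Lemma flags_nofull_onedim (i0 : I) : (0 < sphdim I Q)%N ->
  onedim F (@crk _) (flags K) (sphdim I Q).
Proof.
move=> m0; have [s [sK zs s1]] := nofull_fundamental F q0 rk_inj m0.
exists (lin (sd F rk) s) => t tK zt.
have [|||uK zu et] := @flags_top F _ rk K (i0, q0) rk_inj _ _ (sphdim I Q) t _ tK zt.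
- exact: nofull_dclosed.
- exact: nofull0.
- by move=> A; apply: nofull_card.
set u := lin _ t in uK zu et; exists (u (base_facet I q0)).
rewrite et -linearZ; congr (lin _ _); apply/eqP; rewrite -subr_eq0; apply/eqP.
apply: (@nofull_top F _ _ q0 rk).
- exact: rk_inj.
- by apply: inCB => //; apply: inCZ.
- by rewrite linearB linearZ /= zu zs scaler0 subrr.
by rewrite !ffunE s1 [_ *: _]mulr1 subrr.
Qed.

End NofullFlags.

(** * Flags of saturated sets *)

Section Saturated.
Variables (F : fieldType) (I R Q : finType) (q : R -> Q) (s : Q -> R).
Hypothesis qs : forall x, q (s x) = x.
Variable K1 : {set {set {set I * R}}}.

Definition saturated (A : {set I * R}) :=
  forall b r r', q r = q r' -> (b, r) \in A -> (b, r') \in A.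

Hypothesis K1P : forall t,
  t \in K1 <-> t \in flags (nofull I R) /\ forall A, A \in t -> saturated A.

Let G (x : I * R) := (x.1, q x.2).
(** A saturated set is the preimage of its image in [I * Q]. Image and preimage thus make [K1] a
    retract of the order complex of the smaller join, from which it inherits acyclicity and the line
    of top cycles. *)
Let a (A : {set I * R}) : {set I * Q} := G @: A.
Let b (B : {set I * Q}) : {set I * R} := G @^-1: B.

Let rK1 : ranked (@crk _) K1.
Proof. by move=> t /K1P[tK _]; apply: flags_ranked tK. Qed.

Let rK2 : ranked (@crk _) (flags (nofull I Q)).
Proof. exact: flags_ranked. Qed.

Let ba (A : {set I * R}) : saturated A -> b (a A) = A.
Proof.
move=> sA; apply/setP => -[i r]; rewrite inE; apply/imsetP/idP => [[[j r'] rA [-> e]]|rA].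
  exact: sA (esym e) rA.
by exists (i, r).
Qed.

Let aK t : t \in K1 -> a @: t \in flags (nofull I Q).
Proof.
move=> /K1P[/flagsP[h1 h2] st]; apply/flagsP; split=> [_ /imsetP[A At ->]|].
  have [/nofullP nA nA0] := h1 A At; split; last by rewrite imset_eq0.
  apply/nofullP => i; have [r nr] := nA i; exists (q r).
  apply: contra nr => /imsetP[[j r'] rA [-> e]].
  exact: (st A At) (esym e) rA.
move=> _ _ /imsetP[A At ->] /imsetP[B Bt ->].
by case/orP: (h2 A B At Bt) => sAB; rewrite /a (imsetS _ sAB) ?orbT.
Qed.

Let bK t : t \in flags (nofull I Q) -> b @: t \in K1.
Proof.
move=> /flagsP[h1 h2]; apply/K1P; split.
  apply/flagsP; split=> [_ /imsetP[A At ->]|].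
    have [/nofullP nA /set0Pn[[i x] xA]] := h1 A At; split.
      by apply/nofullP => j; have [y ny] := nA j; exists (s y); rewrite inE /G /= qs.
    by apply/set0Pn; exists (i, s x); rewrite inE /G /= qs.
  move=> _ _ /imsetP[A At ->] /imsetP[B Bt ->].
  by case/orP: (h2 A B At Bt) => sAB; rewrite /b (preimsetS _ sAB) ?orbT.
by move=> _ /imsetP[A At ->] i r r' e; rewrite !inE /G /= e.
Qed.

Let baK t : t \in K1 -> {in t, forall A, b (a A) = A}.
Proof. by move=> /K1P[_ st] A /st; apply: ba. Qed.

Let a_mono t : t \in K1 ->
  {in t &, forall A B, (crk A < crk B)%N -> (crk (a A) <= crk (a B))%N}.
Proof.
move=> /K1P[/flagsP[_ h] _] A B At Bt ltAB; apply: subset_leq_card; apply: imsetS.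
case/orP: (h A B At Bt) => // /subset_leq_card.
by rewrite leqNgt [X in ~~ X]ltAB.
Qed.

Let b_mono t : t \in flags (nofull I Q) ->
  {in t &, forall A B, (crk A < crk B)%N -> (crk (b A) <= crk (b B))%N}.
Proof.
move=> /flagsP[_ h] A B At Bt ltAB; apply: subset_leq_card; apply: preimsetS.
case/orP: (h A B At Bt) => // /subset_leq_card.
by rewrite leqNgt [X in ~~ X]ltAB.
Qed.

Lemma saturated_card (q0 : Q) t : t \in K1 -> (#|t| <= sphdim I Q)%N.
Proof.
move=> tK; rewrite -(@card_in_imset _ _ a); first exact/(flags_nofull_card q0)/aK.
by move=> A B At Bt e; rewrite -(baK tK At) e (baK tK Bt).
Qed.

Lemma saturated_acyclic (i0 : I) (q0 : Q) n : (n < sphdim I Q)%N ->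
  acyclic F (@crk _) K1 n.
Proof.
move=> ltn; apply: (retract_acyclic rK1 rK2 aK bK baK a_mono b_mono).
exact: flags_nofull_acyclic.
Qed.

Lemma saturated_onedim (i0 : I) (q0 : Q) : (0 < sphdim I Q)%N ->
  onedim F (@crk _) K1 (sphdim I Q).
Proof.
move=> m0; apply: (retract_onedim rK1 rK2 aK baK a_mono).
exact: flags_nofull_onedim.
Qed.

End Saturated.

(** * The action of the first generators on the rows *)

Lemma iter_imset (V : finType) (f : V -> V) n (A : {set V}) :
  iter n (fun B : {set V} => f @: B) A = iter n f @: A.
Proof.
by elim: n => /= [|n ->]; [rewrite imset_id | rewrite -imset_comp].
Qed.

Lemma flags_stable (V : finType) (f : V -> V) (K t : {set {set V}}) :
  injective f -> (forall A : {set V}, (f @: A \in K) = (A \in K)) ->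
  ((fun A : {set V} => f @: A) @: t \in flags K) = (t \in flags K).
Proof.
move=> f_inj fK; have im := imset_inj f_inj; apply/flagsP/flagsP => -[h1 h2]; split.
- by move=> A At; have := h1 _ (imset_f (fun B : {set V} => f @: B) At); rewrite fK imset_eq0.
- move=> A B At Bt; have := h2 _ _ (imset_f (fun B : {set V} => f @: B) At)
    (imset_f (fun B : {set V} => f @: B) Bt).
  have sE (C D : {set V}) : (f @: C \subset f @: D) = (C \subset D).
    apply/idP/idP => [/subsetP s|]; last exact: imsetS.
    by apply/subsetP => x xC; have := s _ (imset_f f xC); rewrite mem_imset.
  by rewrite !sE.
- by move=> _ /imsetP[A At ->]; rewrite fK imset_eq0; apply: h1.
move=> _ _ /imsetP[A At ->] /imsetP[B Bt ->].
by case/orP: (h2 A B At Bt) => s; rewrite (imsetS _ s) ?orbT.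
Qed.

Lemma zp_flags p (V : finType) (f : V -> V) (K : {set {set V}}) :
  injective f -> (forall x, iter p f x = x) ->
  (forall A : {set V}, (f @: A \in K) = (A \in K)) ->
  zp_complex p (@crk V) (fun A : {set V} => f @: A) (flags K).
Proof.
move=> f_inj fp fK; split.
- exact: flags_dclosed.
- exact: flags_ranked.
- exact: imset_inj.
- by move=> A; rewrite iter_imset (eq_imset (g := id)) ?imset_id.
- by move=> A; rewrite /crk card_imset.
by move=> t; apply: flags_stable.
Qed.

Section Rows.
Variables (p k : nat) (R : finType) (e : R -> 'rV['Z_p]_k).
Hypotheses (p_prime : prime p) (e_bij : bijective e).

Let p_gt1 : (1 < p)%N. Proof. exact: prime_gt1. Qed.
Let e_inj : injective e. Proof. exact: bij_inj. Qed.

Variable gam : nat -> R -> R.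
Hypothesis gamE : forall (j : 'I_k) r, e (gam j r) = delta_mx 0 j + e r.
Hypothesis gam_id : forall j r, (k <= j)%N -> gam j r = r.

Lemma gam_inj j : injective (gam j).
Proof.
case: (ltnP j k) => [jk|kj] r r'; last by rewrite !gam_id.
move/(congr1 e); rewrite !(gamE (Ordinal jk)) => /addrI; exact: e_inj.
Qed.

Lemma gamC i j r : gam i (gam j r) = gam j (gam i r).
Proof.
case: (ltnP i k) => [ik|ki]; last by rewrite !(gam_id _ ki).
case: (ltnP j k) => [jk|kj]; last by rewrite !(gam_id _ kj).
apply: e_inj; rewrite (gamE (Ordinal ik)) (gamE (Ordinal jk)).
by rewrite (gamE (Ordinal jk)) (gamE (Ordinal ik)) addrCA.
Qed.

Lemma iter_gamE (j : 'I_k) n r : e (iter n (gam j) r) = delta_mx 0 j *+ n + e r.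
Proof.
by elim: n => [|n IH] /=; [rewrite mulr0n add0r | rewrite gamE IH mulrS addrA].
Qed.

Lemma iter_gam j r : iter p (gam j) r = r.
Proof.
case: (ltnP j k) => [jk|kj]; last by elim: p => //= n ->; apply: gam_id.
apply: e_inj; rewrite (iter_gamE (Ordinal jk)) -scaler_nat.
by rewrite (pchar_Zp p_gt1) scale0r add0r.
Qed.

Section Stage.
Variable i : nat.
Hypothesis ik : (i <= k)%N.

Lemma tail_proof (j : 'I_(k - i)) : (i + j < k)%N.
Proof. by rewrite -ltn_subRL. Qed.

(* The orbit of a row under the first [i] generators. *)
Definition tail (r : R) : 'rV['Z_p]_(k - i) := \row_j e r 0 (Ordinal (tail_proof j)).

Lemma tailP r r' : tail r = tail r' <->
  forall l : 'I_k, (i <= l)%N -> e r 0 l = e r' 0 l.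
Proof.
split=> [/rowP h l il|h]; last by apply/rowP => j; rewrite !mxE h // leq_addr.
have lt : (l - i < k - i)%N by rewrite ltn_sub2r // (leq_ltn_trans il).
have := h (Ordinal lt); rewrite !mxE; congr (e _ 0 _ = e _ 0 _);
by apply: val_inj; rewrite /= subnKC.
Qed.

Lemma card_tail : #|{: 'rV['Z_p]_(k - i)}| = (p ^ (k - i))%N.
Proof. by rewrite card_mx card_ord mul1n Zp_cast. Qed.

Lemma tail_surj : exists s : 'rV['Z_p]_(k - i) -> R, forall x, tail (s x) = x.
Proof.
have [e' eK e'K] := e_bij.
pose w (x : 'rV['Z_p]_(k - i)) : 'rV['Z_p]_k :=
  \row_l (if insub (l - i)%N is Some j then x 0 j else 0).
exists (fun x => e' (w x)) => x; apply/rowP => j; rewrite !mxE e'K !mxE /=.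
by rewrite addKn valK.
Qed.

Variable I : finType.
Definition rowmap (f : R -> R) (x : I * R) : I * R := (x.1, f x.2).

Lemma rowmap_inj f : injective f -> injective (rowmap f).
Proof. by move=> inj [a b] [c d'] [-> /inj->]. Qed.

(** The first i generators act simply transitively on the rows with given last k - i coordinates, so
    invariant sets are unions of fibres of [tail]. *)
Lemma saturatedP (A : {set I * R}) :
  (forall j, (j < i)%N -> rowmap (gam j) @: A = A) <-> saturated tail A.
Proof.
split=> [h|sA j ji].
  suff claim n : (n <= i)%N -> forall b r r', (b, r) \in A ->
      (forall l : 'I_k, (n <= l)%N -> e r 0 l = e r' 0 l) -> (b, r') \in A.
    by move=> b r r' /tailP h' rA; apply: claim rA h'.
  elim: n => [_|n IH ni] b r r' rA hr.
    by rewrite -(e_inj (_ : e r = e r')) //; apply/rowP => l; apply: hr.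
  have nk : (n < k)%N := leq_trans ni ik; pose j := Ordinal nk.
  (* Read as a natural number, [c] is how often generator n must be applied to match coordinate n of
     r'; the other coordinates do not move. *)
  pose c := e r' 0 j - e r 0 j.
  have inA m : (b, iter m (gam n) r) \in A.
    elim: m => //= m IHm; rewrite -(h n ni); exact: (imset_f (rowmap (gam n)) IHm).
  apply: (IH (ltnW ni) _ _ _ (inA c)) => l.
  rewrite (iter_gamE j) mxE -scaler_nat natr_Zp !mxE eqxx /=.
  rewrite leq_eqVlt => /predU1P[enl|nl].
    by rewrite (_ : l = j) ?eqxx ?mulr1 ?subrK //; apply: val_inj.
  rewrite (_ : (l == j) = false) ?mulr0 ?add0r ?hr //.
  by apply/negbTE; rewrite neq_ltn /= nl orbT.
have injj := rowmap_inj (@gam_inj j).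
apply/eqP; rewrite eqEcard card_imset // leqnn andbT.
apply/subsetP => _ /imsetP[[b r] rA ->]; apply: sA rA.
apply/tailP => l il; rewrite (gamE (Ordinal (leq_trans ji ik))) !mxE /=.
rewrite (_ : (l == _) = false) ?add0r //.
by apply/negbTE; rewrite neq_ltn /= (leq_trans ji il) orbT.
Qed.

End Stage.

Section RowTower.
Variables (F : fieldType) (I : finType) (i0 : I).
Let g j (A : {set I * R}) : {set I * R} := rowmap (gam j) @: A.
Let S := flags (nofull I R).
Definition stage_dim i := (#|I| * (p ^ (k - i)).-1)%N.

Let stageP i (ik : (i <= k)%N) t : t \in tower g S i <->
  t \in flags (nofull I R) /\ forall A, A \in t -> saturated (@tail i) A.
Proof.
split=> [/towerP[tS h]|[tS h]]; first split=> // A At.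
  by apply/(saturatedP ik) => j ji; apply: h.
by apply/towerP; split=> // j A ji At; have /(saturatedP ik) := h A At; apply.
Qed.

Let sphdimE i : sphdim I 'rV['Z_p]_(k - i) = stage_dim i.
Proof. by rewrite /sphdim card_tail. Qed.

Lemma stage_card i t : (i <= k)%N -> t \in tower g S i -> (#|t| <= stage_dim i)%N.
Proof.
move=> ik; have [s hs] := tail_surj i; rewrite -sphdimE.
exact: (saturated_card (stageP ik) 0).
Qed.

Lemma stage_acyclic i n : (i <= k)%N -> (n < stage_dim i)%N ->
  acyclic F (@crk _) (tower g S i) n.
Proof.
move=> ik; have [s hs] := tail_surj i; rewrite -sphdimE.
apply: (saturated_acyclic hs (stageP ik) i0 0).
Qed.

Lemma stage_dim_lt i : (i < k)%N -> (stage_dim i.+1 < stage_dim i)%N.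
Proof.
move=> ik; rewrite /stage_dim ltn_mul2l; apply/andP; split; first by apply/card_gt0P; exists i0.
rewrite -ltnS !prednK ?expn_gt0 ?prime_gt0 // ltn_exp2l //.
by rewrite ltn_sub2l.
Qed.

Lemma stage_dim_last : stage_dim k = 0%N.
Proof. by rewrite /stage_dim subnn expn0 muln0. Qed.

Lemma stage_onedim i : (i < k)%N -> onedim F (@crk _) (tower g S i) (stage_dim i).
Proof.
move=> ik; have [s hs] := tail_surj i; rewrite -sphdimE.
apply: (saturated_onedim F (stageP (ltnW ik)) i0 0).
by rewrite sphdimE (leq_ltn_trans _ (stage_dim_lt ik)).
Qed.

Lemma nofull_stable j (A : {set I * R}) : (g j A \in nofull I R) = (A \in nofull I R).
Proof.
have gp (B : {set I * R}) n : (iter n (g j) B) = iter n (rowmap (gam j)) @: B.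
  exact: iter_imset.
have imp (B : {set I * R}) : B \in nofull I R -> g j B \in nofull I R.
  move=> /nofullP h; apply/nofullP => b; have [r nr] := h b; exists (gam j r).
  by rewrite (mem_imset _ (b, r)) //; apply/rowmap_inj/gam_inj.
apply/idP/idP; last exact: imp.
have iterg n (B : {set I * R}) : B \in nofull I R -> iter n (g j) B \in nofull I R.
  by move=> BK; elim: n => //= n; apply: imp.
move=> /(iterg p.-1); rewrite -iterSr prednK ?prime_gt0 // gp.
rewrite (eq_imset (g := id)) ?imset_id // => -[b r].
have -> n : iter n (rowmap (gam j)) (b, r) = (b, iter n (gam j) r) by elim: n => //= n ->.
by rewrite iter_gam.
Qed.

Lemma stage_zp j : zp_complex p (@crk _) (g j) S.
Proof.
apply: zp_flags; [exact/rowmap_inj/gam_inj | | exact: nofull_stable].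
move=> [b r]; have -> n : iter n (rowmap (gam j)) (b, r) = (b, iter n (gam j) r).
  by elim: n => //= n ->.
by rewrite iter_gam.
Qed.

End RowTower.
End Rows.

(** * The chessboard complex and its fundamental cycle *)

Section SdCover.
Variables (F : fieldType) (T : finType) (rk : T -> nat).
Local Notation sd := (@sd F T rk).

Lemma flags_full_cover t (A : {set T}) :
  t \in flags (powerset A) -> #|t| = #|A| -> cover t = A.
Proof.
move=> tA ct; apply/eqP; rewrite eqEcard; apply/andP; split.
  by apply/bigcupsP => B; apply: flags_powerset.
rewrite -ct; apply: (@flags_card _ (powerset (cover t)) 1) (flags_cover tA) => // B.
by rewrite powersetE dvd1n muln1 => /subset_leq_card.
Qed.

Lemma sd_cover t (A : {set T}) : sd A t != 0 -> cover t = A.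
Proof. by move=> /sd_inC[tA ct]; apply: flags_full_cover. Qed.

(** A full flag determines the simplex it subdivides, namely its union, so the subdivisions of
    distinct simplices have disjoint supports. This makes subdivision injective. *)
Lemma lin_sdE (c : chain F T) t : lin sd c t = c (cover t) * sd (cover t) t.
Proof.
rewrite linE (bigD1 (cover t)) //= big1 ?addr0 // => A nA.
have [->|/sd_cover e] := eqVneq (sd A t) 0; first by rewrite mulr0.
by rewrite e eqxx in nA.
Qed.

Lemma sd_neq0 (A : {set T}) : exists t, sd A t != 0.
Proof.
have [n] := ubnP #|A|; elim: n A => // n IH A; rewrite ltnS => leA.
have [->|nA] := eqVneq A set0; first by exists set0; rewrite sd0 ffunE eqxx oner_neq0.
have /set0Pn[x xA] := nA.
have lt : (#|A :\ x| < n)%N by rewrite (leq_trans _ leA) // [in X in (_ < X)%N](cardsD1 x A) xA.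
have [t nt] := IH _ lt; have ct := sd_cover nt.
have At : A \notin t.
  apply: contraL xA => At; have sA : A \subset cover t by apply: (bigcup_sup A).
  by apply/negP => /(subsetP sA); rewrite ct !inE eqxx.
exists (A |: t); rewrite sdE // coneE setU11 setU1K // mulf_neq0 ?signr_eq0 //.
rewrite lin_sdE ct mulf_neq0 // /boundary sum_ffunE (bigD1 x) //= big1 ?addr0.
  by rewrite !ffunE eqxx [_ *: _]mulr1 signr_eq0.
move=> y /andP[yA nyx]; rewrite !ffunE; case: eqP => [e|_]; last by rewrite scaler0.
have : x \in A :\ y by rewrite !inE eq_sym nyx.
by rewrite -e !inE eqxx.
Qed.

Lemma lin_sd_eq0 (c : chain F T) : lin sd c = 0 -> c = 0.
Proof.
move=> c0; apply/ffunP => A; rewrite [RHS]ffunE; have [t nt] := sd_neq0 A.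
have := congr1 (fun u : chain F {set T} => u t) c0; rewrite lin_sdE (sd_cover nt) ffunE.
by move/eqP; rewrite mulf_eq0 (negPf nt) orbF => /eqP.
Qed.

End SdCover.

Section Chess.
Variables (F : fieldType) (I C R : finType) (L : C -> nat) (r0 : R).
Hypothesis sumL : (\sum_c L c = #|R|.-1)%N.
Local Notation VY := (I * (C * R))%type.
Local Notation N := (sphdim I R).

(* The squares of the [b]-th board are the [(b, (column, row))].              *)
Definition mchess : {set {set VY}} :=
  [set A : {set VY} | [forall b, forall r, #|[set c | (b, (c, r)) \in A]| <= 1]%N &&
    [forall b, forall c, #|[set r | (b, (c, r)) \in A]| <= L c]%N].

Definition row_proj (x : VY) : I * R := (x.1, x.2.2).

Lemma mchessP (A : {set VY}) :
  reflect ((forall b r, #|[set c | (b, (c, r)) \in A]| <= 1)%N /\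
           (forall b c, #|[set r | (b, (c, r)) \in A]| <= L c)%N) (A \in mchess).
Proof.
rewrite inE; apply: (iffP andP) => -[h1 h2]; split.
- by move=> b r; apply: (forallP (forallP h1 b) r).
- by move=> b c; apply: (forallP (forallP h2 b) c).
- by apply/forallP => b; apply/forallP => r.
by apply/forallP => b; apply/forallP => c.
Qed.

Lemma mchess_dclosed : dclosed mchess.
Proof.
move=> A B /mchessP[h1 h2] /subsetP sBA; apply/mchessP; split=> b x.
  apply: leq_trans (h1 b x); apply/subset_leq_card/subsetP => c.
  by rewrite !inE => /sBA.
apply: leq_trans (h2 b x); apply/subset_leq_card/subsetP => c.
by rewrite !inE => /sBA.
Qed.

Lemma row_proj_inj (A : {set VY}) : A \in mchess -> {in A &, injective row_proj}.
Proof.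
move=> /mchessP[h _] [b [c r]] [b' [c' r']] xA yA [/= eb er]; rewrite -eb -er in yA *.
have /card_le1_eqP/(_ c c') := h b r; rewrite !inE => -> //.
Qed.

Lemma card_cells (A : {set VY}) :
  #|A| = (\sum_b \sum_c #|[set r | (b, (c, r)) \in A]|)%N.
Proof.
rewrite card_blocks; apply: eq_bigr => b _; rewrite card_blocks.
by apply: eq_bigr => c _; apply: eq_card => r; rewrite !inE.
Qed.

Lemma card_row_proj_block (A : {set VY}) b : A \in mchess ->
  #|[set r | (b, r) \in row_proj @: A]| = (\sum_c #|[set r | (b, (c, r)) \in A]|)%N.
Proof.
move=> AY; transitivity #|[set q | (b, q) \in A]|; last first.
  by rewrite card_blocks; apply: eq_bigr => c _; apply: eq_card => r; rewrite !inE.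
rewrite -(@card_in_imset _ _ (fun q : C * R => q.2) [set q | (b, q) \in A]).
  apply: eq_card => r; rewrite inE; apply/imsetP/imsetP => [[[b' [c r']] xA [/= -> ->]]|].
    by exists (c, r'); rewrite // inE.
  by move=> [[c r']]; rewrite inE => xA ->; exists (b, (c, r')).
move=> [c r] [c' r']; rewrite !inE /= => xA yA e.
by have := row_proj_inj AY xA yA; rewrite /row_proj /= e => /(_ erefl) [->].
Qed.

(** Pigeonhole: the capacities allow at most #|R| - 1 squares on a board, so some row stays
    empty. *)
Lemma row_proj_nofull (A : {set VY}) : A \in mchess -> row_proj @: A \in nofull I R.
Proof.
move=> AY; apply/nofullP => b; apply/existsP; apply: contraT; rewrite negb_exists => /forallP h.
have : (#|[set r | (b, r) \in row_proj @: A]| <= #|R|.-1)%N.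
  rewrite card_row_proj_block // -sumL; apply: leq_sum => c _.
  by have /mchessP[_] := AY; apply.
rewrite (_ : [set r | _] = [set: R]); last by apply/setP => r; rewrite !inE -[LHS]negbK h.
rewrite cardsT -ltnS prednK ?ltnn //; by apply/card_gt0P; exists r0.
Qed.

Lemma mchess_card (A : {set VY}) : A \in mchess -> (#|A| <= N)%N.
Proof.
move=> AY; rewrite -(card_in_imset (row_proj_inj AY)).
exact/(nofull_card r0)/row_proj_nofull.
Qed.

(** The capacities of all boards add up to exactly [N], so a simplex of that size fills every
    column. *)
Lemma facet_cells (A : {set VY}) b c : A \in mchess -> #|A| = N ->
  #|[set r | (b, (c, r)) \in A]| = L c.
Proof.
move=> AY cA; have /mchessP[_ h] := AY; apply/eqP; apply: contraT => ne.
have lt : (#|[set r | (b, (c, r)) \in A]| < L c)%N by rewrite ltn_neqAle ne h.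
suff : (#|A| < N)%N by rewrite cA ltnn.
rewrite card_cells /sphdim -sum_nat_const -sumL.
rewrite [X in (X < _)%N](bigD1 b) //= [X in (_ < X)%N](bigD1 b) //=.
rewrite -addSn leq_add //; last by apply: leq_sum => b' _; apply: leq_sum => c' _; apply: h.
rewrite [X in (X < _)%N](bigD1 c) //= [X in (_ < X)%N](bigD1 c) //=.
by rewrite -addSn leq_add //; apply: leq_sum => c' _; apply: h.
Qed.

Lemma setU1_cells (B : {set VY}) b c r b' c' : (b, (c, r)) \notin B ->
  #|[set r' | (b', (c', r')) \in (b, (c, r)) |: B]| =
  (((b' == b) && (c' == c)) + #|[set r' | (b', (c', r')) \in B]|)%N.
Proof.
move=> nB; case: (boolP ((b' == b) && (c' == c))) => [/andP[/eqP-> /eqP->]|ne].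
  rewrite (_ : [set r' | _] = r |: [set r' | (b, (c, r')) \in B]); last first.
    by apply/setP => r'; rewrite !inE !xpair_eqE !eqxx.
  by rewrite cardsU1 inE nB.
rewrite add0n; apply: eq_card => r'; rewrite !inE !xpair_eqE.
by case: (b' == b) ne => //=; case: (c' == c).
Qed.

Let rkU (x : I * R) : nat := enum_rank x.
Let rkU_inj : injective rkU.
Proof. by move=> x y /val_inj/enum_rank_inj. Qed.
(** Pulling back the rank makes the projection preserve signs; it is still injective on simplices,
    which have at most one square per row. *)
Let rkY (x : VY) : nat := rkU (row_proj x).

Lemma mchess_ranked : ranked rkY mchess.
Proof. by move=> A AY x y xA yA /rkU_inj; apply: (row_proj_inj AY). Qed.

(** The transfer of a top chain: every facet gets the coefficient of its projection. *)
Definition pull (s0 : chain F (I * R)%type) : chain F VY :=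
  [ffun A : {set VY} => if (A \in mchess) && (#|A| == N) then s0 (row_proj @: A) else 0].

Lemma pull_inC s0 : inC mchess N (pull s0).
Proof. by move=> A; rewrite ffunE; case: ifP => [/andP[-> /eqP]|]; rewrite ?eqxx. Qed.

(* Above a ridge, the free rows of the chessboard and of the boundary of the  *)
(* simplex are the same, because exactly one column is deficient.             *)
Lemma pull_bd s0 : inC (nofull I R) N s0 -> lin (boundary F rkU) s0 = 0 ->
  lin (boundary F rkY) (pull s0) = 0.
Proof.
move=> s0K zs; apply/ffunP => B; rewrite bdE [RHS]ffunE.
have [/andP[BY /eqP cB]|nB] := boolP ((B \in mchess) && (#|B|.+1 == N)); last first.
  rewrite big1 // => x xB; rewrite ffunE; case: ifP => [/andP[xY /eqP cx]|_]; last by rewrite mulr0.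
  case/negP: nB; rewrite (mchess_dclosed xY (subsetUr _ _)) /=.
  by rewrite -cx cardsU1 xB.
pose P := [set x | (x \notin B) && (x |: B \in mchess)].
have PE x : (x \in P) = (x \notin B) && (x |: B \in mchess) by rewrite inE.
have cP x : x \in P -> #|x |: B| = N by rewrite inE => /andP[xB _]; rewrite cardsU1 xB add1n.
have projU x : row_proj @: (x |: B) = row_proj x |: row_proj @: B by rewrite imsetU1.
have nproj x : x \in P -> row_proj x \notin row_proj @: B.
  rewrite inE => /andP[xB xY]; apply/imsetP => -[y yB e].
  have := row_proj_inj xY (setU11 _ _) (setU1r _ yB) e => ey.
  by rewrite ey yB in xB.
have injP : {in P &, injective row_proj}.
  move=> [b [c r]] [b' [c' r']] xP yP [/= eb er]; rewrite -eb -er in yP *.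
  have [-> //|ncc] := eqVneq c c'.
  move: (xP) (yP); rewrite !PE => /andP[xB xY] /andP[yB yY].
  have := facet_cells b c' yY (cP _ yP); rewrite setU1_cells // !eqxx add1n.
  (* Two free squares in the same row but in distinct columns are impossible: adding the first gives
     a facet in which column c' is full, leaving no room for the second. *)
  have := facet_cells b c' xY (cP _ xP); rewrite setU1_cells // eq_sym (negPf ncc) andbF.
  by rewrite add0n => -> /esym/n_Sn.
have imP : row_proj @: P = [set u | (u \notin row_proj @: B) &&
    (u |: row_proj @: B \in nofull I R)].
  apply/setP => -[b r]; rewrite [RHS]inE; apply/imsetP/andP => [[x xP ->]|[nu uK]].
    split; first exact: nproj.
    by rewrite -projU; apply: row_proj_nofull; move: xP; rewrite PE => /andP[].
  have lt : (\sum_c #|[set r' | (b, (c, r')) \in B]| < \sum_c L c)%N.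
    rewrite -card_row_proj_block // sumL.
    apply: leq_trans (nofull_block r0 b uK); apply: proper_card; apply/properP.
    split; first by apply/subsetP => r'; rewrite !inE => ->; rewrite orbT.
    by exists r; rewrite !inE ?eqxx // (negPf nu).
  (* As the projection of [B] still misses two rows of board b, some column there has spare
     capacity; the square of row r in it is the lift of the free vertex. *)
  have [c ltc] : exists c, (#|[set r' | (b, (c, r')) \in B]| < L c)%N.
    apply/existsP; apply: contraLR lt; rewrite negb_exists -leqNgt => /forallP h.
    by apply: leq_sum => c _; rewrite leqNgt.
  have xB : (b, (c, r)) \notin B.
    by apply: contra nu => xB; apply/imsetP; exists (b, (c, r)).
  exists (b, (c, r)) => //; rewrite PE xB; apply/mchessP; split=> [b' r'|b' c'].
    apply/card_le1_eqP => c1 c2; rewrite !inE !xpair_eqE.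
    have nuE c' : (b, (c', r)) \in B -> False.
      by move=> h; case/negP: nu; apply/imsetP; exists (b, (c', r)).
    case/orP=> [/and3P[/eqP-> /eqP-> /eqP->]|h1] /orP[/and3P[/eqP e1 /eqP-> /eqP e2]|h2] //.
    - by case: (nuE c2).
    - by rewrite e1 e2 in h1; case: (nuE c1).
    have /mchessP[/(_ b' r')/card_le1_eqP/(_ c1 c2) h _] := BY.
    by apply: h; rewrite inE.
  rewrite setU1_cells //; case: (boolP ((b' == b) && (c' == c))) => [/andP[/eqP-> /eqP->]|_].
    by rewrite add1n.
  by rewrite add0n; have /mchessP[_] := BY; apply.
transitivity (lin (boundary F rkU) s0 (row_proj @: B)); last by rewrite zs ffunE.
rewrite bdE; transitivity (\sum_(u in row_proj @: P)
    (-1) ^+ lo rkU u (row_proj @: B) * s0 (u |: row_proj @: B)).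
  rewrite big_imset //= (bigID (mem P)) /= [X in _ + X]big1 ?addr0.
    apply: eq_big => [x|x]; first by rewrite PE andb_idl // => /andP[].
    move=> /andP[xB xP]; rewrite ffunE cP // eqxx andbT.
    move: (xP); rewrite PE => /andP[_ xY]; rewrite xY projU; congr ((-1) ^+ _ * _).
    rewrite -[RHS]lo_setU1x -[LHS]lo_setU1x -projU.
    apply/esym; apply: (@lo_imset _ _ rkY rkU row_proj); rewrite ?setU11 //.
    exact: row_proj_inj.
  move=> x /andP[xB]; rewrite PE xB /= => nY; rewrite ffunE (negPf nY).
  exact: mulr0.
rewrite imP [RHS](bigID (fun u => u |: row_proj @: B \in nofull I R)) /=.
rewrite [X in _ = _ + X]big1 ?addr0.
  by apply: eq_bigl => u; rewrite inE.
move=> u /andP[_ nK]; rewrite (_ : s0 _ = 0) ?mulr0 //.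
by apply/eqP; apply: contraNT nK => /s0K[].
Qed.

Variable s0 : chain F (I * R)%type.
Hypotheses (s0K : inC (nofull I R) N s0) (zs0 : lin (boundary F rkU) s0 = 0) (s0n : s0 != 0).
Let s := lin (sd F rkU) s0.
Let y := lin (sd F rkY) (pull s0).
Let Pi (A : {set VY}) : {set I * R} := row_proj @: A.

Lemma fund_inC : inC (flags mchess) N y.
Proof. exact: (lin_sd_inC mchess_dclosed (@pull_inC s0)). Qed.

Lemma fund_bd : lin (boundary F (@crk VY)) y = 0.
Proof. by rewrite (lin_sd_bd mchess_ranked (@pull_inC s0)) pull_bd ?linear0. Qed.

Let mono (A : {set VY}) :
  {in A &, forall x z, (rkU (row_proj x) < rkU (row_proj z))%N = (rkY x < rkY z)%N}.
Proof. by []. Qed.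

Lemma cover_imset (V V' : finType) (f : V -> V') (t : {set {set V}}) :
  cover ((fun A : {set V} => f @: A) @: t) = f @: cover t.
Proof.
apply/setP => x; apply/bigcupP/imsetP => [[_ /imsetP[A At ->] /imsetP[z zA ->]]|].
  by exists z => //; apply/bigcupP; exists A.
move=> [z /bigcupP[A At zA] ->]; exists (f @: A); last exact: imset_f.
exact: (imset_f (fun A : {set V} => f @: A)).
Qed.

(** A full flag of a facet projects to a full flag of its image, with the same coefficient by
    [sd_natural]. *)
Lemma fundE t : t \in flags mchess -> #|t| = N -> y t = s (Pi @: t).
Proof.
move=> tY ct; rewrite /y /s !lin_sdE cover_imset.
have cY : cover t \in mchess.
  apply: cover_flag_in tY; apply/mchessP; split=> b x; rewrite (_ : [set _ | _] = set0) ?cards0 //.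
    by apply/setP => c; rewrite !inE.
  by apply/setP => c; rewrite !inE.
have cN : #|cover t| = N.
  apply/eqP; rewrite eqn_leq mchess_card //= -ct.
  apply: (@flags_card _ (powerset (cover t)) 1) (flags_cover tY) => // B.
  by rewrite powersetE dvd1n muln1 => /subset_leq_card.
rewrite ffunE cY cN eqxx; congr (_ * _).
apply/esym; apply: (@sd_natural F _ _ rkY rkU); [exact: row_proj_inj | exact: mono |].
by move=> B Bt; apply: (bigcup_sup B).
Qed.

(** The rank [rkY] need not be invariant under permutations of the rows, so the invariance of [y] is
    read off from that of [s] through [fundE]. *)
Lemma fund_act (f : VY -> VY) (f' : I * R -> I * R) :
  injective f -> (forall x, row_proj (f x) = f' (row_proj x)) ->
  (forall t : {set {set VY}}, ((fun A : {set VY} => f @: A) @: t \in flags mchess) = (t \in flags mchess)) ->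
  act (fun A : {set I * R} => f' @: A) s = s ->
  act (fun A : {set VY} => f @: A) y = y.
Proof.
move=> f_inj fp fY sE; apply/ffunP => t; rewrite ffunE.
have ci : #|[set f @: (A : {set VY}) | A in t]| = #|t| by rewrite card_imset //; apply: imset_inj.
have [/andP[tY /eqP ct]|nt] := boolP ((t \in flags mchess) && (#|t| == N)).
  rewrite !fundE ?fY ?ci // -[in RHS]sE ffunE; congr (s _).
  rewrite -!imset_comp; apply: eq_imset => A /=.
  by rewrite /Pi -!imset_comp; apply: eq_imset => x /=; rewrite fp.
transitivity (0 : F); last apply/esym; apply/eqP; apply: contraNT nt => /fund_inC[].
  by rewrite fY ci => -> ->; rewrite eqxx.
by move=> -> ->; rewrite eqxx.
Qed.

(** Projecting the transfer multiplies [s0] by [D], and subdivision is natural and injective. *)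
Lemma fund_proj (D : nat) :
  (forall B : {set I * R}, B \in nofull I R -> #|B| = N ->
     #|[set A in mchess | (row_proj @: A == B) && (#|A| == N)]| = D) ->
  (D%:R != 0 :> F) -> lin (push_simplex F Pi) y != 0.
Proof.
move=> hD nD; have -> : lin (push_simplex F Pi) y = lin (sd F rkU) (lin (push_simplex F row_proj) (pull s0)).
  rewrite /y !lin_comp; apply: (eq_lin_inC (@pull_inC s0)) => A AY _.
  rewrite (@push_sd F _ _ rkY rkU row_proj) //; last exact: row_proj_inj.
  by rewrite /push_simplex card_in_imset ?eqxx ?lin_delta //; apply: row_proj_inj.
apply: contraNneq s0n => /lin_sd_eq0 e; apply/eqP/ffunP => B; rewrite [RHS]ffunE.
apply/eqP; apply: contraT => nB; have [BK cB] := s0K nB.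
have := congr1 (fun u : chain F (I * R)%type => u B) e; rewrite linE ffunE.
rewrite (eq_bigr (fun A : {set VY} =>
   if A \in [set A in mchess | (row_proj @: A == B) && (#|A| == N)] then s0 B else 0)).
  rewrite -big_mkcond sumr_const hD // -mulr_natl => /eqP.
  by rewrite mulf_eq0 (negPf nD) (negPf nB).
move=> A _; rewrite ffunE (_ : (A \in [set A in mchess | (row_proj @: A == B) && (#|A| == N)]) =
  [&& A \in mchess, row_proj @: A == B & #|A| == N]); last by rewrite inE.
have [AY|] //= := boolP (A \in mchess); last by rewrite mul0r.
rewrite andbC; case: ifP => cA /=; last by rewrite mul0r.
rewrite /push_simplex card_in_imset ?eqxx; last exact: row_proj_inj.
rewrite ffunE eq_sym; case: eqP => [->|_]; last by rewrite mulr0.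
exact: mulr1.
Qed.

End Chess.

Local Open Scope nat_scope.

(** * Counting the facets above a facet of the sphere *)

Section Fillings.
Variables (I C R : finType).
Local Notation VY := (I * (C * R))%type.
Local Notation proj := (@row_proj I C R).

Definition cells (A : {set VY}) b c := #|[set r | (b, (c, r)) \in A]|.
Definition rows (B : {set I * R}) b := #|[set r | (b, r) \in B]|.

Definition fillings (B : {set I * R}) (l : I -> C -> nat) : {set {set VY}} :=
  [set A : {set VY} | [&& proj @: A == B, #|A| == #|B| &
     [forall b, forall c, cells A b c == l b c]]].

Lemma fillingsP (B : {set I * R}) l (A : {set VY}) :
  reflect [/\ proj @: A = B, #|A| = #|B| & forall b c, cells A b c = l b c]
    (A \in fillings B l).
Proof.
rewrite inE; apply: (iffP and3P) => -[h1 h2 h3].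
  split; [exact/eqP|exact/eqP|move=> b c].
  exact/eqP/(forallP (forallP h3 b) c).
split; [exact/eqP|exact/eqP|apply/forallP => b; apply/forallP => c].
exact/eqP.
Qed.

Lemma fillings_inj (B : {set I * R}) l (A : {set VY}) :
  A \in fillings B l -> {in A &, injective proj}.
Proof. by move=> /fillingsP[e c _]; apply/imset_injP; rewrite e c. Qed.

(** The subtraction is truncated; the factor [0 < l b c] in [card_fillings_recr] discards the case
    where this matters. *)
Definition decr (l : I -> C -> nat) b0 c0 b c := (l b c - ((b == b0) && (c == c0)))%N.

Lemma fillings_recr (B : {set I * R}) l b r c : (b, r) \in B -> (0 < l b c)%N ->
  [set A in fillings B l | (b, (c, r)) \in A] =
  (fun A => (b, (c, r)) |: A) @: fillings (B :\ (b, r)) (decr l b c).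
Proof.
move=> xB lc; apply/setP => A; rewrite inE; apply/andP/imsetP => [[AF zA]|[A' AF ->]].
  have /fillingsP[e cA lA] := AF.
  have zD : (b, (c, r)) \notin A :\ (b, (c, r)) by rewrite !inE eqxx.
  exists (A :\ (b, (c, r))); last by rewrite setD1K.
  apply/fillingsP; split.
  - apply/setP => u; rewrite !inE -e; apply/imsetP/andP => [[y]|[nu /imsetP[y yA eu]]].
      rewrite !inE => /andP[ny yA] ->; rewrite imset_f //; split=> //.
      apply: contraNneq ny => ey; apply/eqP; apply: (fillings_inj AF) => //.
    exists y => //; rewrite !inE yA andbT; apply: contraNneq nu => ey.
    by rewrite eu ey.
  - by have := cardsD1 (b, (c, r)) A; rewrite (cardsD1 (b, r) B) in cA; rewrite cA zA xB => /addnI.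
  move=> b' c'; rewrite /decr -lA -{2}(setD1K zA) /cells setU1_cells // addKn.
  by [].
have /fillingsP[e cA lA] := AF.
have zA' : (b, (c, r)) \notin A'.
  apply/negP => zA; have : (b, r) \in B :\ (b, r) by rewrite -e; apply/imsetP; exists (b, (c, r)).
  by rewrite !inE eqxx.
rewrite setU11; split=> //; apply/fillingsP; split.
- by rewrite imsetU1 e setD1K.
- by rewrite cardsU1 zA' cA (cardsD1 (b, r) B) xB.
move=> b' c'; rewrite /cells setU1_cells // [#|_|](lA b' c') /decr subnKC //.
by case: (b' =P b) => // ->; case: (c' =P c) => // ->.
Qed.

Lemma card_fillings_recr (B : {set I * R}) l b r : (b, r) \in B ->
  #|fillings B l| = \sum_c (0 < l b c) * #|fillings (B :\ (b, r)) (decr l b c)|.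
Proof.
move=> xB; rewrite -sum1_card.
transitivity (\sum_(A in fillings B l) \sum_c ((b, (c, r)) \in A : nat)).
  apply: eq_bigr => A AF; have /fillingsP[e _ _] := AF.
  have : (b, r) \in proj @: A by rewrite e.
  case/imsetP => -[b' [c r']] zA [/= eb er]; rewrite -eb -er in zA.
  rewrite (bigD1 c) //= zA big1 // => c' ncc; apply/eqP; rewrite eqb0.
  by apply: contra ncc => zA'; have [->] := fillings_inj AF zA zA' erefl.
rewrite exchange_big; apply: eq_bigr => c _ /=.
transitivity #|[set A in fillings B l | (b, (c, r)) \in A]|.
  rewrite -sum1_card big_mkcond [RHS]big_mkcond; apply: eq_bigr => A _.
  by rewrite [in RHS]inE; case: ifP => //= _; case: ifP.
case: (posnP (l b c)) => lc.
  rewrite mul0n; apply/eqP; rewrite cards_eq0; apply/eqP/setP => A.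
  rewrite inE [RHS]inE; apply/negP => /andP[/fillingsP[_ _ /(_ b c)]].
  rewrite lc => /eqP; rewrite cards_eq0 => /eqP/setP/(_ r); rewrite !inE => ->.
  by [].
rewrite mul1n fillings_recr // card_in_imset // => A1 A2 A1F A2F e12.
have nz A : A \in fillings (B :\ (b, r)) (decr l b c) -> (b, (c, r)) \notin A.
  case/fillingsP=> e _ _; apply/negP => zA.
  have : (b, r) \in B :\ (b, r) by rewrite -e; apply/imsetP; exists (b, (c, r)).
  by rewrite !inE eqxx.
by rewrite -(setU1K (nz _ A1F)) e12 (setU1K (nz _ A2F)).
Qed.

Lemma rowsD1 (B : {set I * R}) b r b' : (b, r) \in B ->
  rows B b' = ((b' == b) + rows (B :\ (b, r)) b')%N.
Proof.
move=> xB; rewrite /rows; case: (b' =P b) => [->|ne].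
  rewrite (cardsD1 r) inE xB; congr (_ + _)%N; apply: eq_card => r'; rewrite !inE.
  by rewrite xpair_eqE eqxx.
by apply: eq_card => r'; rewrite !inE xpair_eqE; case: (b' =P b) => // e; case: ne.
Qed.

(** The multinomial count, one board at a time. Removing a row of board b and classifying by the
    column of its square gives terms [l b c] times a common factor; as the [l b c] add up to the
    number of rows, this restores the factorial. *)
Lemma card_fillings (B : {set I * R}) l :
  (forall b, \sum_c l b c = rows B b) ->
  (#|fillings B l| * \prod_b \prod_c (l b c)`! = \prod_b (rows B b)`!)%N.
Proof.
have [n] := ubnP #|B|; elim: n B l => // n IH B l; rewrite ltnS => leB sl.
have [B0|[[b r] xB]] := set_0Vmem B.
  have r0 b : rows B b = 0%N by rewrite /rows B0; apply/eqP; rewrite cards_eq0; apply/eqP/setP => r; rewrite !inE.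
  have l0 b c : l b c = 0%N.
    by apply/eqP; have /eqP := sl b; rewrite r0 sum_nat_eq0 => /forallP/(_ c).
  rewrite (_ : fillings B l = [set set0]).
    rewrite cards1 mul1n; apply: eq_bigr => b _; rewrite r0 big1 // => c _.
    by rewrite l0.
  apply/setP => A; rewrite [RHS]inE; apply/fillingsP/eqP => [[e _ _]|->].
    by apply/eqP; rewrite -(imset_eq0 proj) e B0.
  rewrite B0 imset0 !cards0; split=> // b c; rewrite l0 /cells.
  by apply/eqP; rewrite cards_eq0; apply/eqP/setP => r; rewrite !inE.
rewrite (card_fillings_recr l xB) big_distrl /=.
have rb : (0 < rows B b)%N by rewrite (rowsD1 b xB) eqxx.
have term c : ((0 < l b c) * #|fillings (B :\ (b, r)) (decr l b c)| *
    \prod_b \prod_c (l b c)`! = l b c * ((rows B b).-1`! * \prod_(b' | b' != b) (rows B b')`!))%N.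
  case: (posnP (l b c)) => [->|lc]; first by rewrite !mul0n.
  have sl' b' : \sum_c' decr l b c b' c' = rows (B :\ (b, r)) b'.
    apply: (@addnI ((b' == b) : nat)); rewrite -rowsD1 // -sl.
    rewrite (bigD1 c) //= [RHS](bigD1 c) //= addnA; congr (_ + _)%N.
      by rewrite /decr eqxx andbT subnKC //; case: eqP => // ->.
    by apply: eq_bigr => c' ncc; rewrite /decr (negPf ncc) andbF subn0.
  have cB : (#|B :\ (b, r)| < n)%N by rewrite (leq_trans _ leB) // [in X in (_ < X)%N](cardsD1 (b, r) B) xB.
  have := IH _ _ cB sl'; rewrite (bigD1 b) //= [X in _ = X -> _](bigD1 b) //=.
  rewrite (eq_bigr (fun b' => \prod_c' (l b' c')`!)%N) => [|b' nb]; last first.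
    by apply: eq_bigr => c' _; rewrite /decr (negPf nb) subn0.
  rewrite [X in _ = (_ * X)%N -> _](eq_bigr (fun b' => (rows B b')`!)) => [|b' nb]; last first.
    by rewrite (rowsD1 b' xB) (negPf nb).
  rewrite (rowsD1 b xB) eqxx add1n /= => <-.
  rewrite [in LHS](bigD1 b) //= mul1n [in RHS]mulnCA; congr (_ * _)%N.
  rewrite mulnA; congr (_ * _)%N.
  rewrite (bigD1 c) //= [in RHS](bigD1 c) //= mulnA; congr (_ * _)%N.
    by rewrite /decr !eqxx subn1; case: (l b c) lc.
  by apply: eq_bigr => c' ncc; rewrite /decr (negPf ncc) andbF subn0.
rewrite (eq_bigr _ (fun c _ => term c)) -big_distrl /= sl mulnA [RHS](bigD1 b) //=.
by congr (_ * _)%N; case: (rows B b) rb.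
Qed.

End Fillings.

Section ChessCount.
Variables (I C R : finType) (L : C -> nat) (r0 : R).
Hypothesis sumL : (\sum_c L c = #|R|.-1)%N.

Lemma nofull_full_rows (B : {set I * R}) b : B \in nofull I R -> #|B| = sphdim I R ->
  rows B b = #|R|.-1.
Proof.
move=> BK cB; have le b' := nofull_block r0 b' BK.
apply/eqP; apply: contraT => ne.
suff : (#|B| < sphdim I R)%N by rewrite cB ltnn.
rewrite card_blocks /sphdim -sum_nat_const (bigD1 b) //= [X in (_ < X)%N](bigD1 b) //=.
by rewrite -addSn leq_add //; [rewrite ltn_neqAle ne le | apply: leq_sum => b' _].
Qed.

Lemma card_facets_over (B : {set I * R}) : B \in nofull I R -> #|B| = sphdim I R ->
  #|[set A in mchess I R L | (@row_proj I C R @: A == B) && (#|A| == sphdim I R)]| =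
  (((#|R|.-1)`! ^ #|I|) %/ (\prod_c (L c)`!) ^ #|I|)%N.
Proof.
move=> BK cB; have -> : [set A in mchess I R L | (@row_proj I C R @: A == B) && (#|A| == sphdim I R)]
    = fillings B (fun _ => L).
  apply/setP => A; rewrite inE; apply/and3P/fillingsP => [[AY /eqP e /eqP cA]|[e cA lA]].
    by split=> // [|b c]; [rewrite cA cB | apply: facet_cells cA].
  split; [|exact/eqP|by rewrite cA cB].
  have inj : {in A &, injective (@row_proj I C R)} by apply/imset_injP; rewrite e cA.
  apply/mchessP; split=> [b r|b c]; last by rewrite [X in (X <= _)%N]lA.
  apply/card_le1_eqP => c c'; rewrite !inE => xA yA.
  by have [] := inj _ _ xA yA erefl.
have sl b : \sum_c L c = rows B b by rewrite sumL nofull_full_rows.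
have := card_fillings sl; rewrite !prod_nat_const.
rewrite [X in _ = X -> _](eq_bigr (fun _ => #|R|.-1`!)) => [|b _]; last by rewrite nofull_full_rows.
rewrite prod_nat_const => <-; rewrite mulnK // expn_gt0 prodn_gt0 // => c.
exact: fact_gt0.
Qed.

End ChessCount.

Local Open Scope ring_scope.

(** * Equivariant simplicial approximation *)

Section Barycenter.
Variable R : realFieldType.

Definition push_pt (V W : finType) (a : V -> W) (x : V -> R) : W -> R :=
  fun w => \sum_(v | a v == w) x v.

Lemma push_ptE (V : finType) (a : V -> V) (x : V -> R) v :
  injective a -> push_pt a x (a v) = x v.
Proof. by move=> inj; rewrite /push_pt (big_pred1 v) // => u /=; rewrite inj_eq. Qed.

Definition bary (V T : finType) (pt : T -> V -> R) (A : {set T}) : V -> R :=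
  fun v => #|A|%:R^-1 * \sum_(x in A) pt x v.

Lemma bary_ge0 (V T : finType) (pt : T -> V -> R) (A : {set T}) v :
  (forall x, x \in A -> 0 <= pt x v) -> 0 <= bary pt A v.
Proof. by move=> h; rewrite mulr_ge0 ?invr_ge0 ?ler0n // sumr_ge0. Qed.

Lemma bary_sum (V T : finType) (pt : T -> V -> R) (A : {set T}) : A != set0 ->
  (forall x, x \in A -> \sum_v pt x v = 1) -> \sum_v bary pt A v = 1.
Proof.
move=> nA h; rewrite -mulr_sumr exchange_big (eq_bigr (fun _ => 1)) //= sumr_const.
by rewrite mulVf // pnatr_eq0 cards_eq0.
Qed.

Lemma bary_push (V T : finType) (pt : T -> V -> R) (g : V -> V) (a : T -> T) (A : {set T}) v :
  injective a -> (forall x v, pt (a x) v = push_pt g (pt x) v) ->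
  bary pt (a @: A) v = push_pt g (bary pt A) v.
Proof.
move=> inj h; rewrite /bary card_imset // big_imset /=; last exact: in2W.
rewrite /push_pt -mulr_sumr exchange_big; congr (_ * _).
by apply: eq_bigr => x _; rewrite h.
Qed.

(** The classical estimate for one subdivision, coordinatewise. Each vertex of [B] is within (1 -
    1/#|B|) mu of the barycentre of [B], since its difference with itself drops out of the average;
    the barycentre of [A] averages such vertices. *)
Lemma bary_mesh (V T : finType) (pt : T -> V -> R) (A B : {set T}) (M : nat) mu v :
  A != set0 -> A \subset B -> (#|B| <= M)%N ->
  {in B &, forall x y, `|pt x v - pt y v| <= mu} ->
  `|bary pt A v - bary pt B v| <= (1 - M%:R^-1) * mu.
Proof.
move=> nA sAB leB h; have cA : #|A|%:R != 0 :> R by rewrite pnatr_eq0 cards_eq0.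
have /set0Pn[a aA] := nA; have aB := subsetP sAB _ aA.
have B0 : (0 < #|B|)%N by apply/card_gt0P; exists a.
have cB : #|B|%:R != 0 :> R by rewrite pnatr_eq0 -lt0n.
have M0 : (0 < M)%N := leq_trans B0 leB.
have mu0 : 0 <= mu by apply: le_trans (normr_ge0 _) (h a a aB aB).
have dist x : x \in B -> `|pt x v - bary pt B v| <= (1 - M%:R^-1) * mu.
  move=> xB; have -> : pt x v - bary pt B v = #|B|%:R^-1 * \sum_(y in B) (pt x v - pt y v).
    by rewrite sumrB sumr_const mulrBr -[X in _ * X - _]mulr_natl mulrA mulVf // mul1r.
  rewrite normrM ger0_norm ?invr_ge0 ?ler0n //.
  rewrite (bigD1 x) //= subrr add0r.
  apply: le_trans (_ : #|B|%:R^-1 * (#|B|.-1%:R * mu) <= _).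
    rewrite ler_wpM2l ?invr_ge0 ?ler0n //; apply: le_trans (ler_norm_sum _ _ _) _.
    apply: le_trans (_ : \sum_(y in B | y != x) mu <= _).
      by apply: ler_sum => y /andP[yB _]; apply: h.
    rewrite (eq_bigl (mem (B :\ x))) => [|y]; last by rewrite !inE andbC.
    by rewrite sumr_const (cardsD1 x B) xB /= mulr_natl.
  rewrite mulrA ler_wpM2r // -(ler_pM2l (_ : 0 < #|B|%:R)) ?ltr0n // mulrA divff // mul1r.
  rewrite mulrBr mulr1 -subn1 natrB // lerD2l lerN2 ler_pdivrMr ?ltr0n // mul1r ler_nat.
  exact: leB.
have -> : bary pt A v - bary pt B v = #|A|%:R^-1 * \sum_(x in A) (pt x v - bary pt B v).
  by rewrite sumrB sumr_const mulrBr -[X in _ = _ - _ * X]mulr_natl mulrA mulVf // mul1r.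
rewrite normrM ger0_norm ?invr_ge0 ?ler0n //.
apply: le_trans (_ : #|A|%:R^-1 * (#|A|%:R * ((1 - M%:R^-1) * mu)) <= _).
  rewrite ler_wpM2l ?invr_ge0 ?ler0n //; apply: le_trans (ler_norm_sum _ _ _) _.
  rewrite mulr_natl -sumr_const; apply: ler_sum => x xA.
  by apply: dist; apply: (subsetP sAB).
by rewrite mulKf.
Qed.

End Barycenter.

Section Approximation.
Variables (F : fieldType) (R : realFieldType) (V U : finType) (G : Type).
Variables (X : {set {set V}}) (S : {set {set U}}).
Variables (gV : G -> V -> V) (gU : G -> U -> U).
Hypothesis gU_inj : forall i, injective (gU i).
Hypothesis dX : dclosed X.
Hypothesis dS : dclosed S.

Definition supp (W : finType) (x : W -> R) : {set W} := [set v | x v != 0].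
Definition point (W : finType) (K : {set {set W}}) (x : W -> R) :=
  [/\ forall v, 0 <= x v, \sum_v x v = 1 & supp x \in K].

Variable f : (V -> R) -> (U -> R).
Hypothesis f_in : forall x, point X x -> point S (f x).
Hypothesis f_eq : forall i x, point X x -> f (push_pt (gV i) x) =1 push_pt (gU i) (f x).
Hypothesis f_ext : forall x y, x =1 y -> f x =1 f y.
Variables delta0 : R.
Hypothesis f_unif : forall x y, point X x -> point X y ->
  (forall v, `|x v - y v| <= delta0) -> forall w, `|f x w - f y w| < #|U|%:R^-1.

(** An iterated subdivision [K] of [X]: [pt] gives the positions of its vertices in the realization
    of [X], [mesh_supp] places each simplex inside a simplex of [X], and [mu] bounds its size
    coordinatewise. *)
Record mesh_complex (T : finType) (K : {set {set T}}) (aT : G -> T -> T)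
    (pt : T -> V -> R) (M : nat) (mu : R) : Prop := MeshComplex {
  mesh_dclosed : dclosed K;
  mesh_inj : forall i, injective (aT i);
  mesh_stable : forall i (A : {set T}), (aT i @: A \in K) = (A \in K);
  mesh_pt : forall i x v, pt (aT i x) v = push_pt (gV i) (pt x) v;
  mesh_ge0 : forall A x v, A \in K -> x \in A -> 0 <= pt x v;
  mesh_sum : forall A x, A \in K -> x \in A -> \sum_v pt x v = 1;
  mesh_supp : forall A, A \in K -> A != set0 -> [set v | [exists x in A, pt x v != 0]] \in X;
  mesh_card : forall A, A \in K -> (#|A| <= M)%N;
  mesh_le : forall A x y v, A \in K -> x \in A -> y \in A -> `|pt x v - pt y v| <= mu }.

(** [approx_fix] makes the chain map send fixed simplices to fixed flags, as the passage to fixed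
    complexes demands. *)
Record approx_map (T : finType) (rk : T -> nat) (K : {set {set T}}) (aT : G -> T -> T)
    (phi : {set T} -> chain F {set U}) : Prop := ApproxMap {
  approx_inC : forall A, A \in K -> inC (flags S) #|A| (phi A);
  approx_bd : forall A, A \in K -> lin (boundary F (@crk U)) (phi A) = lin phi (boundary F rk A);
  approx_act : forall i c,
    act (fun B : {set U} => gU i @: B) (lin phi c) = lin phi (act (aT i) c);
  approx_fix : forall i A t, A \in K -> phi A t != 0 -> {in A, forall x, aT i x = x} ->
    {in t, forall B : {set U}, gU i @: B = B};
  approx_empty : phi set0 = delta F set0 }.

Lemma lin_neq0 (T : finType) (W : finType) (phi : {set T} -> chain F W) c t :
  lin phi c t != 0 -> exists A, c A != 0 /\ phi A t != 0.
Proof.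
rewrite linE => nz; have [A nA] : exists A, c A * phi A t != 0.
  apply/existsP; apply: contraNT nz; rewrite negb_exists => /forallP h.
  by rewrite big1 // => A _; apply/eqP; rewrite -[_ == _]negbK.
by exists A; split; apply: contraNneq nA => ->; rewrite ?mul0r ?mulr0.
Qed.

Lemma mesh_point (T : finType) K aT pt M mu (A : {set T}) x :
  mesh_complex K aT pt M mu -> A \in K -> x \in A -> point X (pt x).
Proof.
move=> h AK xA; split=> [v||]; [exact: (mesh_ge0 h v AK xA) | exact: (mesh_sum h AK xA) |].
apply: (dX (mesh_supp h AK _)); first by apply/set0Pn; exists x.
by apply/subsetP => v; rewrite !inE => nv; apply/exists_inP; exists x.
Qed.

(* A vertex [x] goes to the set of [w] where [f x] is at least average; this  *)
(* set is nonempty and, by [f_unif], contained in the support of [f y] for    *)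
(* every [y] in a common simplex with [x].                                    *)
Lemma approx_base T rk K aT pt M : @mesh_complex T K aT pt M delta0 ->
  ranked rk K -> (forall i x, rk (aT i x) = rk x) -> exists phi, approx_map rk K aT phi.
Proof.
move=> h rK rka; pose phi0 x := [set w | #|U|%:R^-1 <= f (pt x) w].
pose psi (A : {set T}) : {set U} := if A \in K then \bigcup_(x in A) phi0 x else set0.
have dK := mesh_dclosed h.
have phi0N A x : A \in K -> x \in A -> phi0 x != set0.
  move=> AK xA; have [p0 p1 _] := f_in (mesh_point h AK xA).
  apply: contraT; rewrite negbK => /eqP/setP e.
  have U0 : (0 < #|U|)%N.
    by rewrite lt0n; apply/eqP => /card0_eq U0; move: p1; rewrite big_pred0 // => /esym/eqP; rewrite oner_eq0.
  have : \sum_w f (pt x) w < \sum_(w : U) #|U|%:R^-1.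
    have /card_gt0P[w0 _] := U0.
    apply: ltr_sum; first by apply/hasP; exists w0; rewrite ?mem_index_enum.
    by move=> w _; rewrite ltNge; have := e w; rewrite !inE => ->.
  by rewrite p1 sumr_const -[X in _ < X]mulr_natl divff ?ltxx // pnatr_eq0 -lt0n.
have psiS A : A \in K -> A != set0 -> psi A \in S /\ psi A != set0.
  move=> AK /set0Pn[x xA]; have px := mesh_point h AK xA; have [p0 p1 pS] := f_in px.
  rewrite /psi AK; split; last first.
    have /set0Pn[w xw] := phi0N _ _ AK xA; apply/set0Pn; exists w.
    by apply/bigcupP; exists x.
  apply: (dS pS); apply/subsetP => w /bigcupP[y yA]; rewrite !inE => yw.
  have := f_unif px (mesh_point h AK yA) (fun v => mesh_le h v AK xA yA) w.
  apply: contraTneq => ->; rewrite sub0r normrN -leNgt.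
  exact: le_trans yw (ler_norm _).
have psi_mono (A B : {set T}) : B \in K -> A \subset B -> psi A \subset psi B.
  move=> BK sAB; rewrite /psi BK (dK _ _ BK sAB).
  by apply/bigcupsP => x /(subsetP sAB) xB; apply: (bigcup_sup x).
have psi_flags t : t \in flags K -> psi @: t \in flags S.
  move=> /flagsP[h1 h2]; apply/flagsP; split=> [_ /imsetP[A At ->]|].
    by have [AK nA] := h1 A At; apply: psiS.
  move=> _ _ /imsetP[A At ->] /imsetP[B Bt ->].
  by case/orP: (h2 A B At Bt) => s; rewrite (psi_mono _ _ _ s) ?orbT //; [case: (h1 B Bt)|case: (h1 A At)].
have push_psi_bd t : t \in flags K ->
    lin (boundary F (@crk U)) (push_simplex F psi t) = lin (push_simplex F psi) (boundary F (@crk T) t).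
  move=> tK; apply: push_bd; [exact: flags_ranked tK | exact: flags_ranked (psi_flags _ tK) |].
  have /flagsP[h1 h2] := tK; move=> A B At Bt lt; apply: subset_leq_card.
  apply: psi_mono; first by case: (h1 B Bt).
  case/orP: (h2 A B At Bt) => // /subset_leq_card.
  by rewrite leqNgt [X in ~~ X]lt.
have psi_act i (A : {set T}) : psi (aT i @: A) = gU i @: psi A.
  rewrite /psi (mesh_stable h); case: ifP => [AK|_]; last by rewrite imset0.
  have phi0E x : x \in A -> forall w, (gU i w \in phi0 (aT i x)) = (w \in phi0 x).
    move=> xA w; rewrite !inE.
    rewrite (f_ext (y := push_pt (gV i) (pt x))); last by move=> v; rewrite (mesh_pt h).
    by rewrite (f_eq i (mesh_point h AK xA)) push_ptE.
  have [gi giK giK'] := injF_bij (@gU_inj i).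
  apply/setP => w; rewrite -[w]giK'; move: (gi w) => {}w; rewrite mem_imset //.
  apply/bigcupP/bigcupP => [[_ /imsetP[x xA ->]]|[x xA]].
    by rewrite phi0E // => xw; exists x.
  by rewrite -(phi0E x xA) => xw; exists (aT i x) => //; apply: imset_f.
exists (fun A => lin (push_simplex F psi) (sd F rk A)); split.
- move=> A AK; apply: (@inC_lin _ _ _ (flags K)); last exact: sd_inC_flags.
  by move=> t tK <-; apply/push_inC/psi_flags.
- move=> A AK; have sdC := sd_inC_flags (F := F) (rk := rk) dK AK.
  rewrite lin_comp (eq_lin_inC sdC (g := fun t => lin (push_simplex F psi) (boundary F (@crk T) t))).
    by rewrite -lin_comp sd_bd ?lin_comp //; apply: rK.
  by move=> t tK _; apply: push_psi_bd.
- move=> i c; rewrite -!lin_comp -act_sd; [|exact: mesh_inj h i|exact: rka].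
  by apply: act_push => //; apply: imset_inj; [apply: mesh_inj h i | apply: gU_inj].
- move=> i A t AK /lin_neq0[u [/sd_inC[uA _]]].
  rewrite /push_simplex; case: ifP => _; last by rewrite ffunE eqxx.
  rewrite ffunE; case: (t =P _) => [-> _|_]; last by rewrite eqxx.
  move=> fixA _ /imsetP[C Cu ->]; rewrite -psi_act; congr psi.
  have sCA := flags_powerset uA Cu; rewrite (eq_in_imset (g := id)) ?imset_id //.
  by move=> x /(subsetP sCA)/fixA.
by rewrite sd0 lin_delta /push_simplex imset0 !cards0 eqxx.
Qed.

Lemma mesh_step (T : finType) K aT pt M mu : @mesh_complex T K aT pt M mu ->
  mesh_complex (flags K) (fun i (A : {set T}) => aT i @: A) (bary pt) M
    ((1 - M%:R^-1) * mu).
Proof.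
move=> h; have inK t A : t \in flags K -> A \in t -> A \in K /\ A != set0.
  by move=> /flagsP[h1 _]; apply: h1.
split.
- exact: flags_dclosed.
- by move=> i; apply/imset_inj/(mesh_inj h).
- by move=> i t; apply: flags_stable; [apply: mesh_inj h i | apply: mesh_stable h i].
- by move=> i A v; apply: bary_push; [apply: mesh_inj h i | apply: mesh_pt h i].
- move=> t A v tK /(inK _ _ tK)[AK _]; apply: bary_ge0 => x xA.
  exact: (mesh_ge0 h v AK xA).
- move=> t A tK /(inK _ _ tK)[AK nA]; apply: bary_sum => // x xA.
  exact: (mesh_sum h AK xA).
- move=> t tK nt; have [cK nc] := inK _ _ tK (cover_flag tK nt).
  apply: (dX (mesh_supp h cK nc)); apply/subsetP => v; rewrite !inE => /exists_inP[A At nz].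
  have [x xA nx] : exists2 x, x \in A & pt x v != 0.
    apply/exists_inP; apply: contraNT nz; rewrite negb_exists_in => /forall_inP hx.
    by rewrite /bary big1 ?mulr0 // => x /hx; rewrite negbK => /eqP.
  by apply/exists_inP; exists x => //; apply/bigcupP; exists A.
- move=> t; apply: (@flags_card _ _ 1) => // A AK; rewrite dvd1n muln1; split=> //.
  exact: mesh_card h _ AK.
move=> t A B v tK At Bt; have [AK nA] := inK _ _ tK At; have [BK nB] := inK _ _ tK Bt.
have /flagsP[_ h2] := tK; case/orP: (h2 A B At Bt) => s.
  apply: bary_mesh => //; first exact: mesh_card h _ BK.
  by move=> x y xB yB; apply: (mesh_le h v BK).
rewrite distrC; apply: bary_mesh => //; first exact: mesh_card h _ AK.
by move=> x y xB yB; apply: (mesh_le h v AK).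
Qed.

Lemma vertex_mesh : (forall i, injective (gV i)) ->
  (forall i (A : {set V}), (gV i @: A \in X) = (A \in X)) ->
  mesh_complex X gV (fun v w => (w == v)%:R) #|V| 1.
Proof.
move=> gV_inj gX; split=> //.
- move=> i x v; rewrite /push_pt big_mkcond (bigD1 x) //= eqxx.
  rewrite [X in _ + X]big1 ?addr0; last by move=> u /negPf->; case: ifP.
  by rewrite eq_sym; case: eqP.
- move=> A x _ _; rewrite (bigD1 x) //= eqxx big1 ?addr0 // => u /negPf->.
  by [].
- move=> A AX _; rewrite (_ : [set v | _] = A) //; apply/setP => v; rewrite inE.
  apply/exists_inP/idP => [[x xA]|vA]; last by exists v; rewrite // eqxx oner_neq0.
  by case: (v =P x) => [->|_]; rewrite ?eqxx.
- by move=> A _; apply: max_card.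
move=> A x y v _ _ _; case: (v == x); case: (v == y);
  by rewrite ?subrr ?subr0 ?sub0r ?normrN ?normr0 ?normr1.
Qed.

(** After n subdivisions the mesh is below [delta0] and [approx_base] applies; composing with the
    subdivision operators brings the chain map back to [K]. *)
Lemma approx_exists n (T : finType) rk K aT pt M mu : @mesh_complex T K aT pt M mu ->
  ranked rk K -> (forall i x, rk (aT i x) = rk x) ->
  (1 - M%:R^-1) ^+ n * mu <= delta0 -> exists phi, approx_map rk K aT phi.
Proof.
elim: n T rk K aT pt mu => [|n IH] T rk K aT pt mu h rK rka le.
  apply: (@approx_base _ _ _ _ pt M) => //; case: h => *; split=> //.
  by move=> A x y v *; apply: (@le_trans _ _ mu); [eauto | rewrite expr0 mul1r in le].
have [|||phi hphi] := IH _ (@crk T) _ _ _ _ (mesh_step h).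
- exact: flags_ranked.
- by move=> i A; rewrite /crk card_imset //; apply: mesh_inj h i.
- by rewrite mulrA -exprSr.
have dK := mesh_dclosed h.
exists (fun A => lin phi (sd F rk A)); split.
- move=> A AK; apply: (@inC_lin _ _ _ (flags K)); last exact: sd_inC_flags.
  by move=> t tK <-; apply: approx_inC hphi _ tK.
- move=> A AK; have sdC := sd_inC_flags (F := F) (rk := rk) dK AK.
  rewrite lin_comp (eq_lin_inC sdC (g := fun t => lin phi (boundary F (@crk T) t))).
    by rewrite -lin_comp sd_bd ?lin_comp //; apply: rK.
  by move=> t tK _; apply: approx_bd hphi _ tK.
- move=> i c; rewrite -!lin_comp -act_sd; [|exact: mesh_inj h i|exact: rka].
  exact: approx_act hphi i _.
- move=> i A t AK /lin_neq0[u [nu nt]] fixA.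
  have [uK _] := sd_inC_flags dK AK nu; have [uA _] := sd_inC nu.
  apply: (approx_fix hphi uK nt) => C Cu; have sCA := flags_powerset uA Cu.
  by rewrite (eq_in_imset (g := id)) ?imset_id // => x /(subsetP sCA)/fixA.
by rewrite sd0 lin_delta (approx_empty hphi).
Qed.

End Approximation.

(** * The obstruction *)

Section Obstruction.
Variables (p k : nat) (R : finType) (e : R -> 'rV['Z_p]_k).
Hypotheses (p_prime : prime p) (e_bij : bijective e).
Variable gam : nat -> R -> R.
Hypothesis gamE : forall (j : 'I_k) r, e (gam j r) = delta_mx 0 j + e r.
Hypothesis gam_id : forall j r, (k <= j)%N -> gam j r = r.
Variables (F : fieldType) (I C : finType) (L : C -> nat) (i0 : I) (r0 : R).
Hypotheses (charF : p \in [pchar F]) (k_gt0 : (0 < k)%N).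
Hypothesis sumL : (\sum_c L c = #|R|.-1)%N.
Hypothesis cop : ~~ (p %| ((#|R|.-1)`! ^ #|I|) %/ (\prod_c (L c)`!) ^ #|I|)%N.
Local Notation VY := (I * (C * R))%type.
Local Notation V := (VY + R)%type.
Local Notation U := (I * R)%type.
Local Notation Y := (flags (mchess I R L)).
Local Notation S := (flags (nofull I R)).
Local Notation stage := (stage_dim p k I).

Definition mjoin : {set {set V}} :=
  [set A : {set V} | (inl @^-1: A \in mchess I R L) && (#|inr @^-1: A| <= 1)%N].

Lemma mjoinE (A : {set V}) :
  (A \in mjoin) = (inl @^-1: A \in mchess I R L) && (#|inr @^-1: A| <= 1)%N.
Proof. by rewrite inE. Qed.

Definition board_act (f : R -> R) (x : VY) : VY := (x.1, (x.2.1, f x.2.2)).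
Definition mjoin_act (f : R -> R) (v : V) : V :=
  match v with inl x => inl (board_act f x) | inr r => inr (f r) end.

Lemma board_act_inj f : injective f -> injective (board_act f).
Proof. by move=> inj [a [b c]] [a' [b' c']] [-> -> /inj->]. Qed.

Lemma mjoin_act_inj f : injective f -> injective (mjoin_act f).
Proof. by by move=> inj [[a [b c]]|r] [[a' [b' c']]|r'] //= [] => [-> -> /inj->|/inj->]. Qed.

Let gI j : injective (gam j) := gam_inj e_bij gamE gam_id (j := j).
Let iterg j r : iter p (gam j) r = r := iter_gam p_prime e_bij gamE gam_id j r.

(** One implication suffices, since the inverse of [f] is its (p - 1)-st iterate. *)
Lemma iter_stable (T : finType) (f : T -> T) (K : {set {set T}}) :
  (forall x, iter p f x = x) -> (forall A : {set T}, A \in K -> f @: A \in K) ->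
  forall A : {set T}, (f @: A \in K) = (A \in K).
Proof.
move=> fp imp A; apply/idP/idP; last exact: imp.
have it n (B : {set T}) : B \in K -> iter n (fun B : {set T} => f @: B) B \in K.
  by move=> BK; elim: n => //= n; apply: imp.
move=> /(it p.-1); rewrite -iterSr prednK ?prime_gt0 // iter_imset.
by rewrite (eq_imset (g := id)) ?imset_id.
Qed.

Lemma iter_board j x : iter p (board_act (gam j)) x = x.
Proof.
case: x => b [c r]; rewrite -[in RHS](iterg j r).
by elim: (p) => //= n ->.
Qed.

Lemma iter_mjoin j v : iter p (mjoin_act (gam j)) v = v.
Proof.
case: v => [x|r]; last by rewrite -[in RHS](iterg j r); elim: (p) => //= n ->.
by rewrite -[in RHS](iter_board j x); elim: (p) => //= n ->.
Qed.

Lemma board_cells f (A : {set VY}) b c r : injective f ->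
  ((b, (c, f r)) \in board_act f @: A) = ((b, (c, r)) \in A).
Proof. by move=> inj; rewrite -(mem_imset A _ (board_act_inj inj)). Qed.

Lemma mchess_act f (A : {set VY}) : injective f -> A \in mchess I R L ->
  board_act f @: A \in mchess I R L.
Proof.
move=> inj /mchessP[h1 h2]; have [f' fK f'K] := injF_bij inj.
apply/mchessP; split=> b x.
  rewrite -[x]f'K; apply: leq_trans (h1 b (f' x)); apply/subset_leq_card/subsetP => c.
  by rewrite !inE board_cells.
rewrite (_ : [set r | _] = f @: [set r | (b, (x, r)) \in A]) ?card_imset //.
by apply/setP => r; rewrite inE -[r]f'K mem_imset // board_cells // inE.
Qed.

Lemma preim_inl f (A : {set V}) : injective f ->
  inl @^-1: (mjoin_act f @: A) = board_act f @: (inl @^-1: A).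
Proof.
move=> inj; apply/setP => x; rewrite inE; apply/imsetP/imsetP => [[[y|//] yA [->]]|[y]].
  by exists y; rewrite // inE.
by rewrite inE => yA ->; exists (inl y).
Qed.

Lemma preim_inr f (A : {set V}) : injective f ->
  inr @^-1: (mjoin_act f @: A) = f @: (inr @^-1: A).
Proof.
move=> inj; apply/setP => x; rewrite inE; apply/imsetP/imsetP => [[[//|y] yA [->]]|[y]].
  by exists y; rewrite // inE.
by rewrite inE => yA ->; exists (inr y).
Qed.

Lemma mchess_stable j (A : {set VY}) :
  (board_act (gam j) @: A \in mchess I R L) = (A \in mchess I R L).
Proof. by apply: iter_stable => [x|B]; [apply: iter_board | apply: mchess_act]. Qed.

Lemma mjoin_stable j (A : {set V}) :
  (mjoin_act (gam j) @: A \in mjoin) = (A \in mjoin).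
Proof.
apply: iter_stable => [x|B]; first exact: iter_mjoin.
rewrite !mjoinE preim_inl // preim_inr // card_imset // => /andP[h ->].
by rewrite mchess_act.
Qed.

Lemma mjoin_dclosed : dclosed mjoin.
Proof.
move=> A B; rewrite !mjoinE => /andP[h1 h2] sBA; apply/andP; split.
  by apply: mchess_dclosed h1 _; apply: preimsetS.
by apply: leq_trans h2; apply/subset_leq_card/preimsetS.
Qed.

Let g j (A : {set VY}) : {set VY} := board_act (gam j) @: A.
Let g' j (A : {set U}) : {set U} := rowmap (gam j) @: A.
Let iota (A : {set VY}) : {set V} := inl @: A.
Let Pi (A : {set VY}) : {set U} := @row_proj I C R @: A.

Let inl_inj : injective (@inl VY R).
Proof. by move=> x y []. Qed.

Let iota_inj : injective iota.
Proof. exact: imset_inj. Qed.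

Let iota_inl (A : {set VY}) : inl @^-1: iota A = A.
Proof. by apply/setP => x; rewrite inE mem_imset. Qed.

Let iota_inr (A : {set VY}) : inr @^-1: iota A = set0.
Proof. by apply/setP => x; rewrite !inE; apply/imsetP => -[]. Qed.

Lemma iota_flags t : t \in Y -> iota @: t \in flags mjoin.
Proof.
move=> /flagsP[h1 h2]; apply/flagsP; split=> [_ /imsetP[A At ->]|].
  have [AK nA] := h1 A At; rewrite imset_eq0; split=> //.
  by rewrite mjoinE iota_inl iota_inr cards0 AK.
move=> _ _ /imsetP[A At ->] /imsetP[B Bt ->].
by case/orP: (h2 A B At Bt) => s; rewrite /iota (imsetS _ s) ?orbT.
Qed.

Let Y_zp j : zp_complex p (@crk VY) (g j) Y.
Proof.
by apply: zp_flags; [apply/board_act_inj | move=> x; apply: iter_board | apply: mchess_stable].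
Qed.

Let gC i j A : g i (g j A) = g j (g i A).
Proof.
rewrite /g -!imset_comp; apply: eq_imset => -[a [b c]] /=.
by rewrite /board_act /= (gamC e_bij gamE gam_id).
Qed.

Let gC' i j A : g' i (g' j A) = g' j (g' i A).
Proof.
rewrite /g' -!imset_comp; apply: eq_imset => -[a b] /=.
by rewrite /rowmap /= (gamC e_bij gamE gam_id).
Qed.

Let PigE j A : Pi (g j A) = g' j (Pi A).
Proof. by rewrite /Pi /g /g' -!imset_comp; apply: eq_imset => -[b [c r]]. Qed.

Lemma Pi_inj t : t \in Y -> {in t &, injective Pi}.
Proof.
move=> tY A B At Bt eAB; apply: (flags_ranked tY) => //=.
have /flagsP[h _] := tY; have [[AK _] [BK _]] := (h _ At, h _ Bt).
rewrite -(card_in_imset (row_proj_inj AK)) -(card_in_imset (row_proj_inj BK)).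
by congr #|pred_of_set _|.
Qed.

Lemma Pi_flags t : t \in Y -> Pi @: t \in S.
Proof.
move=> /flagsP[h1 h2]; apply/flagsP; split=> [_ /imsetP[A At ->]|].
  have [AK nA] := h1 A At; rewrite imset_eq0; split=> //.
  exact: row_proj_nofull r0 sumL _ AK.
move=> _ _ /imsetP[A At ->] /imsetP[B Bt ->].
by case/orP: (h2 A B At Bt) => s; rewrite /Pi (imsetS _ s) ?orbT.
Qed.

Lemma Pi_tower i t : t \in tower g Y i -> Pi @: t \in tower g' S i.
Proof.
move=> /towerP[tY h]; apply/towerP; split; first exact: Pi_flags.
by move=> j _ ji /imsetP[A At ->]; rewrite -PigE h.
Qed.

Let Ym i t : (i <= k)%N -> t \in tower g Y i -> (#|t| <= stage i)%N.
Proof.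
move=> ik tY; have /towerP[/Pi_inj/card_in_imset<- _] := tY.
exact: (stage_card p_prime e_bij gamE gam_id ik (Pi_tower tY)).
Qed.

Variable phi : {set {set V}} -> chain F {set U}.
Hypothesis hphi : approx_map (nofull I R) (fun j => rowmap (gam j)) (@crk V) (flags mjoin)
  (fun j (A : {set V}) => mjoin_act (gam j) @: A) phi.

Let Phi := lin (fun t => lin phi (push_simplex F iota t)).
Let Psi := lin (push_simplex F Pi).

Let PhiE c : lin (fun t => lin phi (push_simplex F iota t)) c = lin phi (lin (push_simplex F iota) c).
Proof. by rewrite lin_comp. Qed.

Let push_iota (t : {set {set VY}}) : push_simplex F iota t = delta F (iota @: t).
Proof. by rewrite /push_simplex card_imset ?eqxx. Qed.

Let push_iota_bd t : t \in Y ->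
  lin (boundary F (@crk V)) (push_simplex F iota t) = lin (push_simplex F iota) (boundary F (@crk VY) t).
Proof.
move=> tY; apply: push_bd; [exact: flags_ranked tY | exact/flags_ranked/iota_flags/tY|].
by move=> A B _ _; rewrite /crk !card_imset //; apply: ltnW.
Qed.

Let Phi_tower : tower_map k (@crk VY) (@crk U) g g' Y S Phi.
Proof.
split.
- move=> i q c ik; apply: inC_lin => t tY ct u; rewrite push_iota lin_delta => nu.
  have /towerP[tK h] := tY; have [uS cu] := approx_inC hphi (iota_flags tK) nu.
  split; last by rewrite cu card_imset.
  apply/towerP; split=> // j B ji Bu.
  apply: (approx_fix hphi (iota_flags tK) nu _ Bu) => _ /imsetP[A At ->].
  by rewrite -{2}(h j A ji At) /iota /g -!imset_comp.
- move=> q c cY; rewrite /= PhiE [RHS]PhiE !lin_comp; apply: (eq_lin_inC cY) => t tY _.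
  by rewrite -[RHS]lin_comp -push_iota_bd // push_iota !lin_delta (approx_bd hphi) ?iota_flags.
move=> j q c jk cY; rewrite /= !PhiE (approx_act hphi); congr (lin phi _).
apply: act_push; [exact/imset_inj/board_act_inj | exact/imset_inj/mjoin_act_inj|].
by move=> A; rewrite /iota -!imset_comp.
Qed.

Let Psi_tower : tower_map k (@crk VY) (@crk U) g g' Y S Psi.
Proof.
split.
- by move=> i q c ik; apply: inC_lin => t tY <-; apply/push_inC/Pi_tower.
- move=> q c cY; rewrite /= !lin_comp; apply: (eq_lin_inC cY) => t tY _.
  apply: push_bd; [exact: flags_ranked tY | exact/flags_ranked/Pi_flags/tY|].
  have /flagsP[h1 h2] := tY; move=> A B At Bt lt; apply/subset_leq_card/imsetS.
  case/orP: (h2 A B At Bt) => // /subset_leq_card.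
  by rewrite leqNgt [X in ~~ X]lt.
move=> j q c jk cY; apply: act_push => [||A]; [exact/imset_inj/board_act_inj | | exact: PigE].
exact/imset_inj/rowmap_inj.
Qed.

(* In the join with the discrete set [R], the complex [Y] is contracted to a  *)
(* vertex; the resulting primitive of a top cycle of [Y] has degree too big   *)
(* for its image under [phi] to be non-zero.                                  *)
Lemma Phi_top y : inC Y (sphdim I R) y -> lin (boundary F (@crk VY)) y = 0 -> Phi y = 0.
Proof.
move=> yY zy.
pose apex (t : {set {set VY}}) : {set V} := inr r0 |: iota (cover t).
pose Car t := flags (powerset (apex t)).
have K0 : set0 \in mchess I R L.
  by apply/mchessP; split=> b x; rewrite (_ : [set _ | _] = set0) ?cards0 //;
     apply/setP => z; rewrite !inE.
have apex_in t : t \in Y -> apex t \in mjoin.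
  move=> tY; rewrite mjoinE; apply/andP; split.
    rewrite (_ : inl @^-1: _ = cover t); first exact: cover_flag_in tY.
    by apply/setP => x; rewrite !inE /= mem_imset.
  rewrite (_ : inr @^-1: _ = [set r0]) ?cards1 //.
  apply/setP => x; rewrite !inE; case: (x =P r0) => [->|nx]; first by rewrite eqxx.
  by apply/orP => -[/eqP[] //|/imsetP[]].
have apexN t : apex t != set0 by apply/set0Pn; exists (inr r0); apply: setU11.
have CarX t : t \in Y -> {subset Car t <= flags mjoin}.
  move=> tY; apply: flags_sub => A; rewrite powersetE.
  exact/mjoin_dclosed/apex_in.
have [||||||||E E1 E2] := @homotopy F _ _ (@crk VY) (@crk V) Y Car (push_simplex F iota).
- exact: flags_dclosed.
- exact: flags_ranked.
- by move=> t _; apply: flags_ranked.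
- by move=> t u _ stu; apply/flags_powersetS/setUS/imsetS/coverS.
- move=> t tY; apply: push_inC; have /flagsP[h1 h2] := iota_flags tY.
  apply/flagsP; split=> // A At; have [_ nA] := h1 A At; split=> //.
  case/imsetP: At => B Bt ->; rewrite powersetE (subset_trans _ (subsetUr _ _)) //.
  by apply/imsetS; apply: (bigcup_sup B).
- exact: push_iota_bd.
- move=> t tY nt; apply: (@cone_acyclic _ _ _ _ (apex t)); first exact: flags_ranked.
  by move=> u; apply: flags_apex.
(* In degree 0 the empty flag is the boundary of the vertex [[set inr r0]] of the order complex. *)
- exists (delta F [set [set inr r0]]).
    apply: inC_delta; last by rewrite cards1.
    apply/flagsP; split=> [A|A B]; rewrite !inE.
      move=> /eqP->; rewrite sub1set setU11; split=> //.
      by apply/set0Pn; exists (inr r0); rewrite inE.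
    by move=> /eqP-> /eqP->; rewrite subxx.
  rewrite lin_delta /boundary big_set1 push_iota imset0 (_ : lo _ _ _ = 0%N).
    by rewrite expr0 scale1r setDv.
  by apply/eqP; rewrite cards_eq0; apply/eqP/setP => A; rewrite !inE; case: eqP => // ->; rewrite ltnn.
have EX : inC (flags mjoin) (sphdim I R).+1 (lin E y).
  by apply: inC_lin yY => t tY <-; apply: inC_sub (CarX t tY) (E1 t tY).
have dE : lin (boundary F (@crk V)) (lin E y) = lin (push_simplex F iota) y.
  have E0 : lin E (lin (boundary F (@crk VY)) y) = 0 by rewrite zy linear0.
  rewrite -[LHS]addr0 -E0 !lin_comp lin_add.
  by apply: (eq_lin_inC yY) => t tY _; apply: E2.
have phiE0 : lin phi (lin E y) = 0.
  apply: (@inC_eq0 _ _ S (sphdim I R).+1) => [t /(flags_nofull_card r0)|]; first by rewrite ltnS.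
  by apply: inC_lin EX => t tX <-; exact: (approx_inC hphi tX).
rewrite /Phi PhiE -dE [LHS]lin_comp (eq_lin_inC EX (g := fun t => lin (boundary F (@crk U)) (phi t))).
  by rewrite -lin_comp phiE0 linear0.
by move=> t tX _; rewrite (approx_bd hphi).
Qed.

(** [tower_zero] applied to the transfer of the fundamental cycle yields [Psi y = 0], whereas
    [fund_proj] excludes it. *)
Theorem no_approx_map : False.
Proof.
pose rkU (x : U) : nat := enum_rank x.
have rkU_inj : injective rkU by move=> x y /val_inj/enum_rank_inj.
pose rkY (x : VY) := rkU (row_proj x).
have cR : #|R| = (p ^ k)%N.
  by rewrite (bij_eq_card e_bij) card_mx card_ord mul1n Zp_cast ?prime_gt1.
have st0 : stage 0 = sphdim I R by rewrite /stage_dim /sphdim cR subn0.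
have N0 : (0 < sphdim I R)%N.
  by rewrite -st0 (leq_ltn_trans _ (stage_dim_lt p_prime i0 k_gt0)).
have [s0 [s0K zs0 s01]] := nofull_fundamental F r0 rkU_inj N0.
have s0n : s0 != 0 by apply/eqP => e0; move/eqP: s01; rewrite e0 ffunE eq_sym oner_eq0.
pose s := lin (sd F rkU) s0; pose y := lin (sd F rkY) (pull L s0).
have sS : inC S (stage 0) s by rewrite st0; apply: lin_sd_inC => //; apply: nofull_dclosed.
have zs : lin (boundary F (@crk U)) s = 0.
  rewrite /s (lin_sd_bd _ s0K) ?zs0 ?linear0 //.
  exact: nofull_ranked.
have sact j : act (g' j) s = s.
  have hS := stage_zp p_prime e_bij gamE gam_id I j.
  apply: (onedim_act charF hS _ sS zs).
  exact: (stage_onedim p_prime e_bij gamE gam_id F i0 k_gt0).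
have yY : inC Y (stage 0) y by rewrite st0; apply: fund_inC.
have zy : lin (boundary F (@crk VY)) y = 0 by apply: (fund_bd r0 sumL s0K zs0).
have gy j : act (g j) y = y.
  apply: (fund_act r0 sumL (f' := rowmap (gam j))) => //.
  - exact: board_act_inj.
  - by move=> t; apply: flags_stable; [apply: board_act_inj | apply: mchess_stable].
  exact: sact.
have Phi0 : Phi (delta F set0) = delta F set0.
  by rewrite /Phi lin_delta push_iota imset0 lin_delta (approx_empty hphi).
have Py : Phi y = 0 by apply: Phi_top; rewrite -?st0.
have := @tower_zero F p k p_prime charF _ _ _ _ g g' Y S stage (fun i _ => Y_zp i)
  (fun i _ => stage_zp p_prime e_bij gamE gam_id I i) gC gC'
  (@stage_dim_lt p k p_prime I i0) (stage_dim_last p k I) Ym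
  (fun i t => @stage_card _ _ _ _ p_prime e_bij _ gamE gam_id I i t)
  (fun i q ik => stage_acyclic p_prime e_bij gamE gam_id i0 ik (n := q))
  (fun i ik => stage_onedim p_prime e_bij gamE gam_id F i0 ik)
  _ _ _ Phi_tower Psi_tower Phi0 yY zy (fun j _ => gy j) Py.
apply/eqP; rewrite /Psi.
apply: (@fund_proj F I C R L s0 s0K s0n) => [B BK cB|]; first exact: (card_facets_over r0 sumL BK cB).
by rewrite -(dvdn_pcharf charF).
Qed.

End Obstruction.

Local Open Scope nat_scope.

(** * The joins of the statement in the form used by the obstruction *)

Section Comparison.
Variables d m n : nat.

Lemma iterjoin_boundaryE :
  iterjoin d (simplex_boundary n) = nofull 'I_d 'I_n :> {set {set 'I_d * 'I_n}}.
Proof.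
apply/setP => A; rewrite [LHS]inE; apply/forallP/nofullP => h i; have := h i.
  rewrite inE properE subsetT andTb => /subsetPn[q _]; rewrite inE => ?.
  by exists q.
case=> q nq; rewrite inE properE subsetT andTb; apply/subsetPn.
by exists q; rewrite // inE.
Qed.

Lemma iterjoin_chessboardE (L : m.-tuple nat) :
  iterjoin d (chessboard (nseq_tuple n 1) L) = mchess 'I_d 'I_n (tnth L)
  :> {set {set 'I_d * ('I_m * 'I_n)}}.
Proof.
have rowE (A : {set 'I_d * ('I_m * 'I_n)}) b r :
    #|[set v in pair b @^-1: A | v.2 == r]| = #|[set c | (b, (c, r)) \in A]|.
  rewrite -[RHS](@card_imset _ _ (fun c => (c, r))) => [|c c' [->] //].
  apply: eq_card => -[c r']; rewrite inE inE; apply/andP/imsetP => [[cA /eqP e]|[c']].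
    by exists c; rewrite ?inE -e.
  by rewrite inE => cA [-> ->].
have colE (A : {set 'I_d * ('I_m * 'I_n)}) b c :
    #|[set v in pair b @^-1: A | v.1 == c]| = #|[set r | (b, (c, r)) \in A]|.
  rewrite -[RHS](@card_imset _ _ (fun r => (c, r))) => [|r r' [->] //].
  apply: eq_card => -[c' r]; rewrite inE inE; apply/andP/imsetP => [[cA /eqP e]|[r']].
    by exists r; rewrite ?inE -e.
  by rewrite inE => cA [-> ->].
apply/setP => A; rewrite [LHS]inE; apply/forallP/mchessP => [h|[h1 h2] b].
  split=> b x; have := h b; rewrite inE => /andP[/forallP h1 /forallP h2].
    by have := h1 x; rewrite tnth_nseq rowE.
  by have := h2 x; rewrite colE.
rewrite inE; apply/andP; split; apply/forallP => x; first by rewrite tnth_nseq rowE.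
by rewrite colE.
Qed.

Lemma configuration_spaceE (L : m.-tuple nat) :
  join (iterjoin d (chessboard (nseq_tuple n 1) L)) (points n) = mjoin 'I_n 'I_d (tnth L)
  :> {set {set 'I_d * ('I_m * 'I_n) + 'I_n}}.
Proof.
by apply/setP => A; rewrite [LHS]inE mjoinE iterjoin_chessboardE [X in _ && X]inE.
Qed.

End Comparison.

Lemma sum_Ltuple p k : \sum_c tnth (Ltuple p k) c = (p ^ k).-1.
Proof.
by rewrite -sum_Lseq -(big_tuple _ _ (Ltuple p k) predT id).
Qed.

Lemma count_coprime p k a : prime p ->
  ~~ (p %| ((p ^ k).-1)`! ^ a %/ (\prod_c (tnth (Ltuple p k) c)`!) ^ a).
Proof.
move=> p_prime; apply: multinomial_coprime => //.
by rewrite -(big_tuple _ _ (Ltuple p k) predT (fun l => l`!)).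
Qed.

From mathcomp Require Import all_classical all_reals all_analysis.
Import numFieldNormedType.Exports.
Local Open Scope classical_set_scope.
Local Open Scope ring_scope.

(** * From continuous maps to chain maps *)

Section UniformContinuity.
Variable R : realType.

Lemma ptws_box (V : finType) (x : {ptws V -> R}) (e : R) : 0 < e ->
  \forall y \near x, forall v, `|x v - y v| < e.
Proof.
move=> e0; apply: (@filter_forall _ V (fun v (y : {ptws V -> R}) => `|x v - y v| < e) _ (nbhs_filter x)) => v.
have nb : nbhs (x v : R) [set z : R | `|x v - z| < e] by apply/nbhs_ballP; exists e.
exact: (@proj_continuous V (fun _ => R : topologicalType) v x _ nb).
Qed.

(** As there are finitely many coordinates, the product topology is that of the sup norm, whose
    boxes form a neighbourhood base. *)
Lemma ptws_boxP (V : finType) (x : {ptws V -> R}) (A : set {ptws V -> R}) :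
  nbhs x A -> exists2 e : R, 0 < e & forall y, (forall v, `|x v - y v| < e) -> A y.
Proof.
pose B (e : R) : set {ptws V -> R} := [set y | forall v, `|x v - y v| < e].
pose F := filter_from [set e : R | 0 < e] B.
have FF : Filter F.
  apply: filter_from_filter; first by exists 1 => /=.
  move=> e1 e2 /= e10 e20; exists (Num.min e1 e2); first by rewrite /= lt_min e10.
  by move=> y h; split=> v; have := h v; rewrite lt_min => /andP[].
have Fx : F --> x.
  apply/cvg_sup => v U [B' [[Z oZ <-] Zx ZU]].
  have : nbhs (x v : R) Z by apply: open_nbhs_nbhs.
  move=> /nbhs_ballP[e /= e0 he]; exists e => // y hy; apply: ZU; apply: he.
  exact: hy.
by move=> /Fx [e /= e0 h]; exists e.
Qed.

Variables (V W : finType) (K : scomplex V).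

(** The support condition is closed because a non-zero coordinate stays non-zero nearby: the support
    of a limit lies in that of a nearby point, and complexes are closed under subsets. *)
Lemma realization_closed : closed (realization R K).
Proof.
move=> p clp; have near_p (A : set {ptws V -> R}) : nbhs p A ->
    exists x, realization R K x /\ A x by move=> /clp[x [? ?]]; exists x.
split.
- move=> v; rewrite leNgt; apply/negP => pv; have e0 : 0 < - p v by rewrite oppr_gt0.
  have [x [[x0 _ _]] /(_ v)] := near_p _ (ptws_box p e0).
  rewrite ltNge => /negP; apply; rewrite ltr0_norm ?opprB.
    by rewrite lerDr.
  by rewrite subr_lt0 (lt_le_trans pv).
- apply/eqP; apply: contraT => ne; pose e := `|\sum_v p v - 1| / (#|V|%:R + 1).
  have c0 : 0 < #|V|%:R + 1 :> R by rewrite ltr_wpDl ?ler0n.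
  have e0 : 0 < e by rewrite divr_gt0 // normr_gt0 subr_eq0.
  have [x [[_ x1 _] h]] := near_p _ (ptws_box p e0).
  have : `|\sum_v p v - 1| <= #|V|%:R * e.
    rewrite [leLHS](_ : _ = `|\sum_v (p v - x v)|); last by rewrite sumrB x1.
    apply: le_trans (ler_norm_sum _ _ _) _.
    rewrite [X in _ <= X]mulr_natl -sumr_const; apply: ler_sum => v _; exact: ltW (h v).
  rewrite /e mulrA ler_pdivlMr // mulrC ler_pM2r ?normr_gt0 ?subr_eq0 //.
  by rewrite leNgt ltrDl ltr01.
have nsupp : \forall y \near p, forall v, p v != 0 -> y v != 0.
  apply: (@filter_forall _ V (fun v (y : {ptws V -> R}) => p v != 0 -> y v != 0) _ (nbhs_filter p)) => v.
  have [pv|pv] := eqVneq (p v) 0.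
    by apply: nearW => y /=; rewrite ?eqxx.
  have e0 : 0 < `|p v| by rewrite normr_gt0.
  move: (ptws_box p e0); apply: (@filterS _ (nbhs p) (nbhs_filter p)) => y /= h _.
  by apply: contraTneq (h v) => ->; rewrite subr0 ltxx.
have [x [[_ _ xK] h]] := near_p _ nsupp.
apply: simplices_sub xK _; apply/fintype.subsetP => v; rewrite !finset.inE.
exact: h.
Qed.

Lemma realization_compact : compact (realization R K).
Proof.
apply: (subclosed_compact realization_closed
  (@tychonoff V (fun _ => R) (fun _ => `[0, 1]%classic) (fun _ => @segment_compact R 0 1))).
move=> x [x0 x1 _] v /=; rewrite in_itv /= x0 /= -x1 (bigD1 v) //= lerDl.
by apply: sumr_ge0 => w _; apply: x0.
Qed.

(** The Heine-Cantor theorem on the compact realization, in terms of coordinates. *)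
Lemma realization_unif (f : {ptws V -> R} -> {ptws W -> R}) (e : R) : 0 < e ->
  {within realization R K, continuous f} ->
  exists2 d : R, 0 < d & forall x y, realization R K x -> realization R K y ->
    (forall v, `|x v - y v| <= d) -> forall w, `|f x w - f y w| < e.
Proof.
move=> e0 /subspace_continuousP cf.
(* The tolerance 1/(n+1) turns uniformity into a property of all large n, which compactness allows
   to be checked near each point. *)
pose P (n : nat) (x : {ptws V -> R}) := realization R K x -> forall y, realization R K y ->
  (forall v, `|x v - y v| <= n.+1%:R^-1) -> forall w, `|f x w - f y w| < e.
have e20 : 0 < e / 2 by rewrite divr_gt0.
have /compact_near_coveringP/(_ nat \oo P) := realization_compact.
case=> [|N _ hN]; last first.
  exists N.+1%:R^-1; first by rewrite invr_gt0 ltr0n.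
  by move=> x y xK yK; apply: (hN N (leqnn N) x xK).
move=> x xK; have nf : \forall y \near x, realization R K y -> forall w, `|f x w - f y w| < e / 2.
  exact: (cf x xK _ (ptws_box (f x) e20)).
have [d d0 hd] := ptws_boxP nf.
have d20 : 0 < d / 2 by rewrite divr_gt0.
have [N hN] : exists N, forall n, (N <= n)%N -> n.+1%:R^-1 < d / 2.
  have [N _ hN] : \forall n \near \oo, n.+1%:R^-1 < d / 2.
    by have /cvgrPdist_lt/(_ _ d20) := @cvg_harmonic R; apply: filterS => n; rewrite sub0r normrN /harmonic /= ger0_norm.
  by exists N.
(* With y within d/2 of x and z within d/2 of y, both lie in the box of radius d, where f stays
   within e/2 of [f x]. *)
exists ([set y | forall v, `|x v - y v| < d / 2], [set n | (N <= n)%N]).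
  by split; [exact: ptws_box | exists N].
move=> [y n] [/= hy Nn] yK z zK hyz w.
rewrite -(subrKA (f x w)) (splitr e).
apply: le_lt_trans (ler_normD _ _) _; apply: ltrD.
  rewrite distrC; apply: hd => // v; apply: lt_trans (hy v) _.
  by rewrite ltr_pdivrMr // ltr_pMr // ltr1n.
apply: hd => // v; rewrite -(subrKA (y v)) (splitr d).
apply: le_lt_trans (ler_normD _ _) _; apply: ltrD; first exact: hy.
by apply: le_lt_trans (hyz v) _; apply: hN.
Qed.

End UniformContinuity.

Lemma mesh_small (R : realType) (M : nat) (e : R) : (0 < M)%N -> 0 < e ->
  exists n, (1 - M%:R^-1) ^+ n <= e.
Proof.
move=> M0 e0; have q1 : `|1 - M%:R^-1 : R| < 1.
  have M0' : 0 < M%:R^-1 :> R by rewrite invr_gt0 ltr0n.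
  rewrite ger0_norm ?subr_ge0; first by rewrite ltrBlDr ltrDl.
  by rewrite invf_le1 ?ltr0n // ler1n.
have /cvgrPdist_lt/(_ _ e0)[N _ hN] := cvg_expr q1.
exists N; have := hN N (leqnn N); rewrite sub0r normrN => h.
exact: le_trans (ler_norm _) (ltW h).
Qed.

Theorem theorem2p1 (R : realType) (p k d : nat) (p_prime : prime p)
    (k_ge1 : (1 <= k)%N) (d_ge1 : (1 <= d)%N)
    (rho : 'rV['Z_p]_k -> 'S_(p ^ k)) (rho_regular : regular_embedding rho) :
  ~ exists f,
      @equivariant_map R 'rV['Z_p]_k _ _
        (join (iterjoin d.+1 (chessboard (nseq_tuple (p ^ k) 1%N) (Ltuple p k)))
              (points (p ^ k)))
        (fun g => join_act (iterjoin_act (row_act (rho g))) (rho g))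
        (iterjoin d.+1 (simplex_boundary (p ^ k)))
        (fun g => iterjoin_act (rho g))
        f.
Proof.
case=> f; set X := join _ _; set S := iterjoin _ _ => -[f_cont f_in f_eq].
have [e e_bij e_rho] := rho_regular.
(* The generators are indexed by all naturals; those from k on are 0 and act trivially. *)
pose gen (j : nat) : 'rV['Z_p]_k := if insub j is Some j' then delta_mx 0 j' else 0.
pose gam j (r : 'I_(p ^ k)) := rho (gen j) r.
have gamE (j : 'I_k) r : e (gam j r) = delta_mx 0 j + e r by rewrite e_rho /gen valK.
have gam_id j r : (k <= j)%N -> gam j r = r.
  move=> kj; apply: (bij_inj e_bij); rewrite e_rho /gen insubF ?add0r //.
  by rewrite ltnNge kj.
have gam_inj j : injective (gam j) by apply: perm_inj.
have r0 : 'I_(p ^ k) by apply: (@Ordinal _ 0); rewrite expn_gt0 prime_gt0.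
have charF : p \in [pchar 'F_p] by apply: pchar_Fp.
have XE : X = mjoin 'I_(p ^ k) 'I_d.+1 (tnth (Ltuple p k)) :> {set {set _}}.
  exact: configuration_spaceE.
have SE : S = nofull 'I_d.+1 'I_(p ^ k) :> {set {set _}} by apply: iterjoin_boundaryE.
pose gV j := @mjoin_act 'I_(p ^ k) 'I_d.+1 'I_(k * (p - 1)) (gam j).
have U0 : (0 < #|{: 'I_d.+1 * 'I_(p ^ k)}|)%N by apply/card_gt0P; exists (ord0, r0).
have V0 : (0 < #|{: 'I_d.+1 * ('I_(k * (p - 1)) * 'I_(p ^ k)) + 'I_(p ^ k)}|)%N.
  by apply/card_gt0P; exists (inr r0).
have e0 : 0 < #|{: 'I_d.+1 * 'I_(p ^ k)}|%:R^-1 :> R by rewrite invr_gt0 ltr0n.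
have [delta d0 f_unif] := realization_unif e0 f_cont.
have [n hn] := mesh_small V0 d0.
have dX : dclosed X by move=> A B; apply: simplices_sub.
have dS : dclosed S by move=> A B; apply: simplices_sub.
have gX j (A : {set _}) : (gV j @: A \in X) = (A \in X).
  by rewrite XE (mjoin_stable p_prime e_bij gamE gam_id).
(* The start is the first subdivision rather than [X]: the rank must be invariant under the group,
   and cardinality is, unlike an ordering of the vertices. *)
have mesh := mesh_step dX (vertex_mesh R dX (fun j => mjoin_act_inj (@gam_inj j)) gX).
have rka j (A : {set _}) : crk (gV j @: A) = crk A.
  by rewrite /crk card_imset //; apply: mjoin_act_inj.
have [|||||phi hphi] := @approx_exists 'F_p R _ _ nat X S gV (fun j => rowmap (gam j))
  _ dX dS f _ _ _ delta f_unif n _ _ _ _ _ _ _ mesh (@flags_ranked _ X) rka.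
- by move=> j; apply/rowmap_inj/gam_inj.
- exact: f_in.
- by move=> j x xX; rewrite (f_eq (gen j) x xX).
- by move=> x y /funext->.
- rewrite mulr1; apply: le_trans hn; rewrite ler_piMr ?exprn_ge0 //.
  by rewrite subr_ge0 invf_le1 ?ltr0n // ler1n.
rewrite XE SE in hphi.
apply: (no_approx_map p_prime e_bij gamE gam_id (ord0 : 'I_d.+1) r0 charF k_ge1 _ _ hphi).
  by rewrite sum_Ltuple card_ord.
by rewrite !card_ord; apply: count_coprime.
Qed.
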